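(* Let $\mathcal{B}\subset\mathbb{C}^2$ be any convex domain. Then $\mathcal{B}$ carries complete properly embedded complex curves; that is, there exist an open (connected) Riemann surface $\mathcal{M}$ and a complete holomorphic embedding $Y\colon\mathcal{M}\to\mathbb{C}^2$ such that $Y(\mathcal{M})\subset\mathcal{B}$ and $Y\colon\mathcal{M}\to\mathcal{B}$ is a proper map.
   Context: A domain is a nonempty open connected set; the convex domain $\mathcal{B}$ need be neither bounded nor have regular frontier, and $\mathcal{B}=\mathbb{C}^2$ is allowed. A Riemann surface is open if it is non-compact and has no boundary. A holomorphic immersion $Y\colon\mathcal{M}\to\mathbb{C}^2$ is complete if the pull-back by $Y$ of the Euclidean metric is a complete Riemannian metric on $\mathcal{M}$; equivalently, $Y\circ\gamma$ has infinite Euclidean length for every arc $\gamma\colon[0,1)\to\mathcal{M}$ leaving every compact subset of $\mathcal{M}$. An immersion is an embedding if it is a homeomorphism onto its image. A map $Y\colon\mathcal{M}\to\mathcal{B}$ is proper if $Y^{-1}(K)$ is compact for every compact $K\subset\mathcal{B}$. *)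

(* Defs.v *)
From HB Require Import structures.
From mathcomp Require Import all_boot all_order all_algebra.
From mathcomp Require Import all_classical all_reals all_analysis.
From mathcomp Require Import complex.

Set Implicit Arguments.
Unset Strict Implicit.
Unset Printing Implicit Defensive.

Import Order.TTheory GRing.Theory Num.Theory.
Import numFieldNormedType.Exports.

Local Open Scope classical_set_scope.
Local Open Scope ring_scope.
Local Open Scope complex_scope.

(* R[i] with its usual topology, as a one-dimensional normed space over itself;
   hence [differentiable] between such spaces is complex differentiability.
   A normed space over R[i] is only a vector space over R[i], but [convex_set]
   over R[i] is real convexity: 0 <= t <= 1 in R[i] forces t to be real. *)
Notation Cplx R := (GRing.regular R[i]).
Notation Cplx2 R := (Cplx R * Cplx R)%type.

Definition convex_domain (R : realType) (B : set (Cplx2 R)) : Prop :=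
  [/\ open B, connected B, B !=set0 & convex_set B].

(* The values of chart_map off chart_dom, and of chart_inv off the image of
   chart_dom, are irrelevant. *)
Record chart (R : realType) (M : Type) := Chart {
  chart_dom : set M;
  chart_map : M -> Cplx R;
  chart_inv : Cplx R -> M }.

Definition chart_img (R : realType) (M : Type) (c : chart R M)
  : set (Cplx R) := chart_map c @` chart_dom c.

Definition is_chart (R : realType) (M : topologicalType) (c : chart R M)
  : Prop :=
  [/\ open (chart_dom c), open (chart_img c),
      (forall p, chart_dom c p -> chart_inv c (chart_map c p) = p),
      {within chart_dom c, continuous (chart_map c)} &
      {within chart_img c, continuous (chart_inv c)}].

(* Connected Riemann surfaces without boundary. The atlas is indexed by the
   points: surface_chart p is a chart around p, which also identifies the
   tangent space at p with R[i]. *)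
Record riemann_surface (R : realType) := RiemannSurface {
  surface :> topologicalType;
  surface_chart : surface -> chart R surface;
  surface_nonempty : [set: surface] !=set0;
  surface_connected : connected [set: surface];
  surface_hausdorff : hausdorff_space surface;
  surface_second_countable : @second_countable surface;
  surface_chartP : forall p, is_chart (surface_chart p);
  surface_chart_dom : forall p, chart_dom (surface_chart p) p;
  surface_transition : forall p q z,
    (chart_map (surface_chart p) @`
       (chart_dom (surface_chart p) `&` chart_dom (surface_chart q))) z ->
    differentiable
      (chart_map (surface_chart q) \o chart_inv (surface_chart p)) z }.

Definition open_riemann_surface (R : realType) (M : riemann_surface R) : Prop :=
  ~ compact [set: M].

Section Maps.
Variables (R : realType) (M : riemann_surface R).
Implicit Types (Y : M -> Cplx2 R) (p q : M).

Definition local_expr Y p : Cplx R -> Cplx2 R :=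
  Y \o chart_inv (surface_chart p).

Definition holomorphic Y : Prop :=
  forall p z, chart_img (surface_chart p) z ->
    differentiable (local_expr Y p) z.

Definition tangent_map Y p : Cplx R -> Cplx2 R :=
  'd (local_expr Y p) (chart_map (surface_chart p) p).

Definition holomorphic_immersion Y : Prop :=
  holomorphic Y /\ forall p, injective (tangent_map Y p).

Definition homeomorphism_onto_image Y : Prop :=
  continuous Y /\
  exists2 g : Cplx2 R -> M, cancel Y g & {within range Y, continuous g}.

Definition holomorphic_embedding Y : Prop :=
  holomorphic_immersion Y /\ homeomorphism_onto_image Y.

Definition proper_into Y (B : set (Cplx2 R)) : Prop :=
  forall K : set (Cplx2 R), K `<=` B -> compact K -> compact (Y @^-1` K).

(* A Riemannian metric on M: g p u v, for u and v tangent at p. *)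
Implicit Types g : M -> Cplx R -> Cplx R -> R.

Definition euclidean_metric (u v : Cplx2 R) : R :=
  complex.Re u.1 * complex.Re v.1 + complex.Im u.1 * complex.Im v.1 +
  (complex.Re u.2 * complex.Re v.2 + complex.Im u.2 * complex.Im v.2).

Definition pullback_metric Y : M -> Cplx R -> Cplx R -> R :=
  fun p u v => euclidean_metric (tangent_map Y p u) (tangent_map Y p v).

Implicit Types gam : R -> M.

Definition re_chart gam p : R -> R :=
  fun t => complex.Re (chart_map (surface_chart p) (gam t)).
Definition im_chart gam p : R -> R :=
  fun t => complex.Im (chart_map (surface_chart p) (gam t)).

Definition C1_curve gam : Prop :=
  continuous gam /\
  forall p t, chart_dom (surface_chart p) (gam t) ->
    [/\ derivable (re_chart gam p) t 1, derivable (im_chart gam p) t 1,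
        {for t, continuous (derive1 (re_chart gam p))} &
        {for t, continuous (derive1 (im_chart gam p))}].

Definition velocity gam (t : R) : Cplx R :=
  (derive1 (re_chart gam (gam t)) t) +i* (derive1 (im_chart gam (gam t)) t).

Definition curve_length g gam : \bar R :=
  \int[lebesgue_measure]_(t in `[0, 1])
    (Num.sqrt (g (gam t) (velocity gam t) (velocity gam t)))%:E.

(* piecewise_C1_path g p q l: there is a piecewise C^1 path from p to q of
   g-length l. Every C^1 arc [0, 1] -> M is the restriction of a C^1 curve
   R -> M, so the pieces are taken to be such restrictions. *)
Inductive piecewise_C1_path g : M -> M -> \bar R -> Prop :=
| path_const p : piecewise_C1_path g p p 0%E
| path_cons gam q l : C1_curve gam -> piecewise_C1_path g (gam 1) q l ->
    piecewise_C1_path g (gam 0) q (curve_length g gam + l)%E.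

Definition riemannian_dist g p q : \bar R :=
  ereal_inf [set l | piecewise_C1_path g p q l].

Definition complete_metric g : Prop :=
  forall u : nat -> M,
    (forall e : R, 0 < e -> exists N : nat, forall m n : nat,
      (N <= m)%N -> (N <= n)%N -> (riemannian_dist g (u m) (u n) < e%:E)%E) ->
    exists p, forall e : R, 0 < e -> exists N : nat, forall n : nat,
      (N <= n)%N -> (riemannian_dist g (u n) p < e%:E)%E.

Definition complete_immersion Y : Prop :=
  holomorphic_immersion Y /\ complete_metric (pullback_metric Y).

End Maps.

(* Main.v *)
(* The surface is a connected component of the zero set, in [B], of
   [f + a z + b w + d], where [f = (w - w0) + P_0 + P_1 + ...] and
   [(z0, w0)] lies in [B].  Exhaust [B] by compact convex sets [C_n].  Between
   [C_n] and [C_(n+1)] there is a finite labyrinth of discs of real hyperplanes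
   such that every curve of length less than 1 which starts in [C_n] and avoids
   them stays in [C_(n+1)].  The discs are ordered so that each one is cut off
   by its hyperplane from [C_n] and from the preceding discs; hence a finite sum
   of high powers of affine functions gives [P_n] small, together with its
   derivatives, on [C_n] and with [f] large on the discs.  The zero set avoids
   the discs, and a bounded piece of curve in it is trapped in some [C_n]: it is
   complete.  By Baire, for generic small [a], [b], [d] it has no singular
   point, so that it is locally a graph; Newton's method shows that it meets
   [B], and it is closed in [B], which gives properness. *)
Require Import Defs.
From HB Require Import structures.
From mathcomp Require Import all_boot all_order all_algebra.
From mathcomp Require Import all_classical all_reals all_analysis.
From mathcomp Require Import complex ring lra zify.
Import Order.TTheory GRing.Theory Num.Theory.
Import numFieldNormedType.Exports.

Set Implicit Arguments.
Unset Strict Implicit.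
Unset Printing Implicit Defensive.

Local Open Scope classical_set_scope.
Local Open Scope ring_scope.

(** * The Euclidean plane *)

(** Two scales make a finite labyrinth possible in an arbitrarily thin shell. The discs lie in
    tangent hyperplanes to level sets of a uniformly convex function, so a disc of size [h] rises
    only [O(h^2)] above its level. A fixed number of layers, [O(h^2)] high in all, costs a curve
    length [h]; about [1/h] such groups force length 1 within height [O(h)]. Convexity also makes
    the ordering possible, so that obstacles are treated one at a time, each new term being
    negligible where the earlier ones have done their work. The affine perturbation is chosen after
    the series and may be unbounded on [B]; hence the values prescribed on the discs grow with the
    radius of the exhaustion. Its parameters form six real dimensions, and those creating a singular
    zero only the image of four: this is the room that Baire's theorem needs. Holomorphy is carried
    by uniform Taylor estimates, which survive sums and series by the triangle inequality. They
    yield the implicit graphs and their derivatives; the third order is there for the maximum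
    principle behind non-compactness. *)

Section ComplexModulus.
Variable R : realType.
Implicit Types (z w : Cplx R) (x y : R).

Lemma ReD z w : complex.Re (z + w) = complex.Re z + complex.Re w.
Proof. by case: z => a b; case: w. Qed.
Lemma ImD z w : complex.Im (z + w) = complex.Im z + complex.Im w.
Proof. by case: z => a b; case: w. Qed.
Lemma ReN z : complex.Re (- z) = - complex.Re z.
Proof. by case: z. Qed.
Lemma ImN z : complex.Im (- z) = - complex.Im z.
Proof. by case: z. Qed.
Lemma ReM z w : complex.Re (z * w) =
  complex.Re z * complex.Re w - complex.Im z * complex.Im w.
Proof. by case: z => a b; case: w. Qed.
Lemma ImM z w : complex.Im (z * w) =
  complex.Re z * complex.Im w + complex.Im z * complex.Re w.
Proof. by case: z => a b; case: w. Qed.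
Definition ReImE := (ReD, ImD, ReN, ImN, ReM, ImM).

Lemma complex_ext z w : complex.Re z = complex.Re w ->
  complex.Im z = complex.Im w -> z = w.
Proof. by case: z => a b; case: w => c d /= -> ->. Qed.

Definition cabs z : R := Num.sqrt (complex.Re z ^+ 2 + complex.Im z ^+ 2).

Lemma normCplxE z : `|z| = (cabs z)%:C%C.
Proof. exact: normc_def. Qed.

Lemma cabs_ge0 z : 0 <= cabs z.
Proof. exact: sqrtr_ge0. Qed.

Lemma cabs_sqr z : cabs z ^+ 2 = complex.Re z ^+ 2 + complex.Im z ^+ 2.
Proof. by rewrite sqr_sqrtr// addr_ge0// sqr_ge0. Qed.

Lemma cabsM z w : cabs (z * w) = cabs z * cabs w.
Proof.
apply/eqP; rewrite -(@eqrXn2 _ 2) ?mulr_ge0 ?cabs_ge0//.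
by rewrite exprMn !cabs_sqr ReM ImM; apply/eqP; ring.
Qed.

Lemma cabsD z w : cabs (z + w) <= cabs z + cabs w.
Proof.
have := ler_normD (z : R[i]) w.
by rewrite (normCplxE z) (normCplxE w) (normCplxE (z + w)) -rmorphD lecR.
Qed.

Lemma cabsN z : cabs (- z) = cabs z.
Proof. by rewrite /cabs ReN ImN !sqrrN. Qed.

Lemma cabsBC z w : cabs (z - w) = cabs (w - z).
Proof. by rewrite -cabsN opprB. Qed.

Lemma cabs0 : cabs 0 = 0.
Proof. by rewrite /cabs /= expr0n addr0 sqrtr0. Qed.

Lemma cabs1 : cabs 1 = 1.
Proof. by rewrite /cabs /= expr0n addr0 expr1n sqrtr1. Qed.

Lemma cabs_real x : cabs (x%:C%C) = `|x|.
Proof. by rewrite /cabs /= expr0n addr0 sqrtr_sqr. Qed.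

Lemma cabs_nat n : cabs n%:R = n%:R.
Proof. by rewrite -[n%:R]/(1 *+ n) -(rmorph_nat (real_complex R)) cabs_real normr_nat. Qed.

Lemma cabs_eq0 z : cabs z = 0 -> z = 0.
Proof.
move=> h; have := cabs_sqr z; rewrite h expr0n => /esym/eqP.
by rewrite paddr_eq0 ?sqr_ge0// !sqrf_eq0 => /andP[/eqP a /eqP b]; exact: complex_ext.
Qed.

Lemma cabs_gt0 z : (0 < cabs z) = (z != 0).
Proof.
rewrite lt_neqAle cabs_ge0 andbT eq_sym; congr (~~ _).
by apply/eqP/eqP => [/cabs_eq0//|->]; exact: cabs0.
Qed.

Lemma cabsX z n : cabs (z ^+ n) = cabs z ^+ n.
Proof. by elim: n => [|n ih]; rewrite ?expr0 ?cabs1// !exprS cabsM ih. Qed.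

Lemma cabsV z : z != 0 -> cabs z^-1 = (cabs z)^-1.
Proof.
move=> z0; apply: (@mulfI _ (cabs z)); first by rewrite gt_eqF// cabs_gt0.
by rewrite -cabsM mulfV// cabs1 mulfV// gt_eqF// cabs_gt0.
Qed.

Lemma Re_le_cabs z : `|complex.Re z| <= cabs z.
Proof. by rewrite -sqrtr_sqr ler_wsqrtr// lerDl sqr_ge0. Qed.

Lemma Im_le_cabs z : `|complex.Im z| <= cabs z.
Proof. by rewrite -sqrtr_sqr ler_wsqrtr// lerDr sqr_ge0. Qed.

Lemma cabs_le_ReIm z : cabs z <= `|complex.Re z| + `|complex.Im z|.
Proof.
rewrite -ler_sqr ?nnegrE ?addr_ge0 ?normr_ge0 ?cabs_ge0//.
rewrite cabs_sqr sqrrD !real_normK ?num_real//.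
by have := mulr_ge0 (normr_ge0 (complex.Re z)) (normr_ge0 (complex.Im z)); lra.
Qed.

Lemma cabs_ltD z w x y : cabs z < x -> cabs w < y -> cabs (z + w) < x + y.
Proof. by move=> a b; apply: le_lt_trans (cabsD _ _) (ltrD a b). Qed.

Lemma cabs_leD z w x y : cabs z <= x -> cabs w <= y -> cabs (z + w) <= x + y.
Proof. by move=> a b; apply: le_trans (cabsD _ _) (lerD a b). Qed.

Lemma cabs_leB z w x y : cabs z <= x -> cabs w <= y -> cabs (z - w) <= x + y.
Proof. by move=> a b; apply: cabs_leD => //; rewrite cabsN. Qed.

Lemma cabs_leM z w x y : cabs z <= x -> cabs w <= y -> cabs (z * w) <= x * y.
Proof. by move=> a b; rewrite cabsM ler_pM// cabs_ge0. Qed.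

Lemma cabs_dist z w : cabs z - cabs w <= cabs (z - w).
Proof. by rewrite lerBlDr -{1}(subrK w z) cabsD. Qed.

Lemma nbhs_CplxP z (A : set (Cplx R)) : nbhs z A <->
  exists2 e : R, 0 < e & forall w, cabs (w - z) < e -> A w.
Proof.
split.
  move=> /nbhs_normP[/= e e0 he]; move: (e0); rewrite ltcE /= => /andP[/eqP ei er].
  exists (complex.Re e) => // w hw; apply: he => /=.
  by rewrite normCplxE cabsBC ltcE /= ei eqxx.
move=> [e e0 he]; apply: (proj2 (nbhs_normP z A)).
exists (e%:C%C) => /=; first by rewrite ltcR.
by move=> w /=; rewrite normCplxE ltcR cabsBC => /he.
Qed.

End ComplexModulus.

Section EuclideanPlane.
Variable R : realType.
Implicit Types (u v w p q : Cplx2 R) (t : R).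
Local Notation dot := (@euclidean_metric R).

(** Real multiples, kept apart from the [R[i]]-module structure so that scalars stay in [R]. *)
Definition rscale t u : Cplx2 R := (t%:C%C * u.1, t%:C%C * u.2).

Lemma dotC u v : dot u v = dot v u.
Proof. by rewrite /euclidean_metric; ring. Qed.
Lemma dotDl u v w : dot (u + v) w = dot u w + dot v w.
Proof. by rewrite /euclidean_metric /= !ReImE; ring. Qed.
Lemma dotNl u w : dot (- u) w = - dot u w.
Proof. by rewrite /euclidean_metric /= !ReImE; ring. Qed.
Lemma dotBl u v w : dot (u - v) w = dot u w - dot v w.
Proof. by rewrite dotDl dotNl. Qed.
Lemma dotDr u v w : dot w (u + v) = dot w u + dot w v.
Proof. by rewrite dotC dotDl !(dotC w). Qed.
Lemma dotNr u w : dot w (- u) = - dot w u.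
Proof. by rewrite dotC dotNl dotC. Qed.
Lemma dotBr u v w : dot w (u - v) = dot w u - dot w v.
Proof. by rewrite dotDr dotNr. Qed.
Lemma dotZl t u w : dot (rscale t u) w = t * dot u w.
Proof. by rewrite /euclidean_metric /= !ReImE /= !mul0r !subr0 !addr0; ring. Qed.
Lemma dotZr t u w : dot w (rscale t u) = t * dot w u.
Proof. by rewrite dotC dotZl dotC. Qed.
Lemma dot0l u : dot 0 u = 0.
Proof. by rewrite /euclidean_metric /= !mul0r !addr0. Qed.
Lemma dot_ge0 u : 0 <= dot u u.
Proof. by rewrite /euclidean_metric -!expr2 !addr_ge0// sqr_ge0. Qed.

Definition nrm u : R := Num.sqrt (dot u u).

Lemma nrm_ge0 u : 0 <= nrm u. Proof. exact: sqrtr_ge0. Qed.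
Lemma nrm_sqr u : nrm u ^+ 2 = dot u u.
Proof. by rewrite sqr_sqrtr// dot_ge0. Qed.
Lemma nrm_sqrE u : nrm u ^+ 2 = cabs u.1 ^+ 2 + cabs u.2 ^+ 2.
Proof. by rewrite nrm_sqr !cabs_sqr /euclidean_metric; ring. Qed.

Lemma nrmN u : nrm (- u) = nrm u.
Proof. by rewrite /nrm dotNl dotNr opprK. Qed.
Lemma nrmBC u v : nrm (u - v) = nrm (v - u).
Proof. by rewrite -nrmN opprB. Qed.
Lemma nrm0 : nrm 0 = 0.
Proof. by rewrite /nrm dot0l sqrtr0. Qed.
Lemma nrmZ t u : nrm (rscale t u) = `|t| * nrm u.
Proof.
by rewrite /nrm dotZl dotZr mulrA -expr2 sqrtrM ?sqr_ge0// sqrtr_sqr.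
Qed.

Lemma nrm_eq0 u : nrm u = 0 -> u = 0.
Proof.
move=> h; have := nrm_sqrE u; rewrite h expr0n => /esym/eqP.
rewrite paddr_eq0 ?sqr_ge0// !sqrf_eq0 => /andP[/eqP/cabs_eq0 a /eqP/cabs_eq0 b].
by case: u a b {h} => /= ? ? -> ->.
Qed.

(** With [b = dot v v] and [c = dot u v], the squared norm of [b u - c v] is [b] times the defect in
    the Cauchy-Schwarz inequality; the case [b = 0] is separate. *)
Lemma dot_le u v : dot u v <= nrm u * nrm v.
Proof.
rewrite -[leRHS]ger0_norm ?mulr_ge0 ?nrm_ge0//.
apply: le_trans (ler_norm _) _; rewrite -ler_sqr ?nnegrE ?normr_ge0//.
rewrite !real_normK ?num_real// exprMn !nrm_sqr.
set a := dot u u; set b := dot v v; set c := dot u v.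
have h : 0 <= dot (rscale b u - rscale c v) (rscale b u - rscale c v).
  exact: dot_ge0.
move: h; rewrite !(dotBl, dotBr, dotZl, dotZr) -/a -/b -/c (dotC v u) -/c => h.
have b0 : 0 <= b := dot_ge0 v.
have := b0; rewrite le_eqVlt => /orP[/eqP b00|bp]; last by nra.
have v0 : v = 0 by apply: nrm_eq0; rewrite /nrm -/b -b00 sqrtr0.
by rewrite /c v0 dotC dot0l expr0n mulr_ge0// dot_ge0.
Qed.

Lemma dot_ge u v : - (nrm u * nrm v) <= dot u v.
Proof. by have := dot_le (- u) v; rewrite dotNl nrmN; lra. Qed.

Lemma nrmD u v : nrm (u + v) <= nrm u + nrm v.
Proof.
rewrite -ler_sqr ?nnegrE ?addr_ge0 ?nrm_ge0//.
rewrite nrm_sqr !(dotDl, dotDr) sqrrD !nrm_sqr (dotC v u).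
by have := dot_le u v; lra.
Qed.

Lemma nrm_triangle v u w : nrm (u - w) <= nrm (u - v) + nrm (v - w).
Proof. by have := nrmD (u - v) (v - w); rewrite addrA subrK. Qed.

Lemma nrm_gt0 u : (0 < nrm u) = (u != 0).
Proof.
rewrite lt_neqAle nrm_ge0 andbT eq_sym; congr (~~ _).
by apply/eqP/eqP => [/nrm_eq0//|->]; exact: nrm0.
Qed.

Lemma cabs1_le u : cabs u.1 <= nrm u.
Proof.
rewrite -ler_sqr ?nnegrE ?cabs_ge0 ?nrm_ge0// nrm_sqrE lerDl sqr_ge0//.
Qed.
Lemma cabs2_le u : cabs u.2 <= nrm u.
Proof.
rewrite -ler_sqr ?nnegrE ?cabs_ge0 ?nrm_ge0// nrm_sqrE lerDr sqr_ge0//.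
Qed.
Lemma nrm_le u : nrm u <= cabs u.1 + cabs u.2.
Proof.
rewrite -ler_sqr ?nnegrE ?addr_ge0 ?cabs_ge0 ?nrm_ge0// nrm_sqrE sqrrD.
by have := mulr_ge0 (cabs_ge0 u.1) (cabs_ge0 u.2); lra.
Qed.

(** The plane carries the product topology of complex-valued norms; this exchanges it for real
    Euclidean balls, which serve as neighbourhoods from here on. *)
Lemma nbhs_Cplx2P p (A : set (Cplx2 R)) : nbhs p A <->
  exists2 e : R, 0 < e & forall q, nrm (q - p) < e -> A q.
Proof.
split.
  move=> [[P Q] [/= /nbhs_CplxP[d d0 hd] /nbhs_CplxP[e e0 he]] hA].
  exists (Num.min d e); first by rewrite lt_min d0.
  move=> q; rewrite lt_min => /andP[qd qe]; apply: (hA q); split.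
    by apply: hd; apply: le_lt_trans qd; exact: (cabs1_le (q - p)).
  by apply: he; apply: le_lt_trans qe; exact: (cabs2_le (q - p)).
move=> [e e0 he].
exists ([set z | cabs (z - p.1) < e / 2], [set z | cabs (z - p.2) < e / 2]).
  by split; apply/nbhs_CplxP; exists (e / 2) => //; rewrite divr_gt0.
move=> q [/= h1 h2]; apply: he; apply: le_lt_trans (nrm_le _) _ => /=.
by rewrite (splitr e); apply: ltrD.
Qed.

End EuclideanPlane.

(** * Continuity and compactness in the plane *)

Section PlaneTopology.
Variable R : realType.
Implicit Types (A : set (Cplx2 R)) (p q : Cplx2 R).

Lemma Cplx2_closedP A : closed A <->
  forall p, (forall e : R, 0 < e -> exists2 q, A q & nrm (q - p) < e) -> A p.
Proof.
split=> [cA p h|h p cp].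
  apply: cA => B /nbhs_Cplx2P[e e0 he]; have [q Aq qe] := h e e0.
  by exists q; split=> //; exact: he.
apply: h => e e0; have [|q [Aq qe]] := cp [set q | nrm (q - p) < e].
  by apply/nbhs_Cplx2P; exists e.
by exists q.
Qed.

Lemma Cplx2_openP A : open A <->
  forall p, A p -> exists2 e : R, 0 < e & forall q, nrm (q - p) < e -> A q.
Proof.
rewrite openE; split=> [oA p Ap|h p Ap]; first by apply/nbhs_Cplx2P; exact: oA.
by apply/nbhs_Cplx2P; exact: h.
Qed.

Lemma Cplx2_continuousP (f : Cplx2 R -> R) p : {for p, continuous f} <->
  forall e : R, 0 < e ->
    exists2 d : R, 0 < d & forall q, nrm (q - p) < d -> `|f q - f p| < e.
Proof.
split=> [/cvgrPdist_lt h e e0|h].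
  have /nbhs_Cplx2P[d d0 hd] := h e e0.
  by exists d => // q /hd; rewrite distrC.
apply/cvgrPdist_lt => e e0; have [d d0 hd] := h e e0.
by apply/nbhs_Cplx2P; exists d => // q /hd; rewrite distrC.
Qed.

Lemma lipschitz_Cplx2_continuous (f : Cplx2 R -> R) (L : R) :
  (forall p q, `|f q - f p| <= L * nrm (q - p)) -> continuous f.
Proof.
move=> hL p; apply/Cplx2_continuousP => e e0.
have L1 : 0 < `|L| + 1 by rewrite ltr_pwDr.
exists (e / (`|L| + 1)); first by rewrite divr_gt0.
move=> q; rewrite ltr_pdivlMr// => hq; apply: le_lt_trans (hL _ _) _.
apply: le_lt_trans hq; rewrite mulrC ler_wpM2l ?nrm_ge0//.
by apply: le_trans (ler_norm L) _; rewrite lerDl.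
Qed.

Lemma nrm_lipschitz p q : `|nrm q - nrm p| <= nrm (q - p).
Proof.
rewrite ler_norml; have := nrmD (q - p) p; have := nrmD (p - q) q.
rewrite !subrK (nrmBC p q); lra.
Qed.

Lemma nrm_continuous : continuous (@nrm R).
Proof.
by apply: (@lipschitz_Cplx2_continuous _ 1) => p q; rewrite mul1r nrm_lipschitz.
Qed.

Definition of_coords (x : (R * R) * (R * R)) : Cplx2 R :=
  (Complex x.1.1 x.1.2, Complex x.2.1 x.2.2).

Lemma of_coords_continuous : continuous of_coords.
Proof.
move=> x A /nbhs_Cplx2P[e e0 he].
have e4 : 0 < e / 4 by rewrite divr_gt0.
have hb (y : R) : nbhs y [set z | `|z - y| < e / 4].
  by apply/nbhs_normP; exists (e / 4) => // z /=; rewrite distrC.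
exists ([set y | `|y.1 - x.1.1| < e / 4 /\ `|y.2 - x.1.2| < e / 4],
        [set y | `|y.1 - x.2.1| < e / 4 /\ `|y.2 - x.2.2| < e / 4]).
  split; [exists ([set z | `|z - x.1.1| < e / 4], [set z | `|z - x.1.2| < e / 4])
         |exists ([set z | `|z - x.2.1| < e / 4], [set z | `|z - x.2.2| < e / 4])];
    by [split; exact: hb | move=> z []].
move=> [[a b] [c d]] /= [[h1 h2] [h3 h4]]; apply: he.
apply: le_lt_trans (nrm_le _) _.
apply: le_lt_trans (lerD (cabs_le_ReIm _) (cabs_le_ReIm _)) _ => /=.
by move: h1 h2 h3 h4 => /=; lra.
Qed.

(** Heine-Borel: the set is closed inside the continuous image of a cube of [R^4]. *)
Lemma closed_bounded_compact A r : closed A -> (forall p, A p -> nrm p <= r) ->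
  compact A.
Proof.
move=> cA bA; pose S : set R := `[- r, r]%classic.
have cS : compact (of_coords @` ((S `*` S) `*` (S `*` S))).
  apply: continuous_compact.
    by apply: continuous_subspaceT; exact: of_coords_continuous.
  have c2 : compact (S `*` S) by apply: compact_setX; exact: segment_compact.
  exact: compact_setX.
apply: subclosed_compact cS _ => // -[[a b] [c d]] Ap.
have := bA _ Ap => hp; exists ((a, b), (c, d)) => //.
have h1 := le_trans (cabs1_le _) hp; have h2 := le_trans (cabs2_le _) hp.
have hh (x : R) : `|x| <= r -> S x by rewrite /S /= in_itv /= ler_norml.
by split; split; apply: hh; first
  [exact: le_trans (Re_le_cabs (Complex a b)) h1
  |exact: le_trans (Im_le_cabs (Complex a b)) h1
  |exact: le_trans (Re_le_cabs (Complex c d)) h2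
  |exact: le_trans (Im_le_cabs (Complex c d)) h2].
Qed.

Lemma compact_bounded A : compact A -> exists r : R, forall p, A p -> nrm p <= r.
Proof.
move=> cA; have [[p Ap]|/set0P/negP/negPn/eqP ->] := pselect (A !=set0); last by exists 0.
have := compact_EVT_max (ex_intro _ p Ap) cA.
move=> /(_ R (@nrm R)) [|c _ h].
  by apply: continuous_subspaceT; exact: nrm_continuous.
by exists (nrm c) => q Aq; apply: h; rewrite inE.
Qed.

Lemma Cplx2_compact_closed A : compact A -> closed A.
Proof. by apply: compact_closed; exact: norm_hausdorff. Qed.

End PlaneTopology.

(** * Series and powers *)

Section ComplexSeries.
Variable R : realType.
Implicit Types (u v : nat -> Cplx R) (s t : Cplx R).

Definition has_sum u s := forall e : R, 0 < e ->
  exists N, forall m, (N <= m)%N -> cabs (\sum_(i < m) u i - s) < e.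

Lemma has_sum_le u s t (V : R) n : has_sum u s ->
  (forall m, (n <= m)%N -> cabs (\sum_(i < m) u i - t) <= V) ->
  cabs (s - t) <= V.
Proof.
move=> hs h; apply/ler_addgt0Pr => e e0; have [N hN] := hs e e0.
have -> : s - t = (\sum_(i < maxn N n) u i - t) - (\sum_(i < maxn N n) u i - s).
  by ring.
apply: cabs_leB; first by apply: h; exact: leq_maxr.
by apply/ltW/hN; exact: leq_maxl.
Qed.

Lemma has_sum_uniq u s t : has_sum u s -> has_sum u t -> s = t.
Proof.
move=> hs ht; apply/eqP; rewrite -subr_eq0; apply/eqP/cabs_eq0/eqP.
rewrite eq_le cabs_ge0 andbT; apply/ler_addgt0Pr => e e0; rewrite add0r.
by have [N hN] := ht e e0; apply: (has_sum_le hs) => m /hN/ltW.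
Qed.

Lemma has_sumD u v s t : has_sum u s -> has_sum v t ->
  has_sum (fun i => u i + v i) (s + t).
Proof.
move=> hs ht e e0; have e2 : 0 < e / 2 by rewrite divr_gt0.
have [N hN] := hs _ e2; have [M hM] := ht _ e2.
exists (maxn N M) => m; rewrite geq_max => /andP[/hN a /hM b].
rewrite big_split /= (splitr e).
have -> : \sum_(i < m) u i + \sum_(i < m) v i - (s + t) =
  (\sum_(i < m) u i - s) + (\sum_(i < m) v i - t) by ring.
exact: cabs_ltD.
Qed.

Lemma has_sumZ u s (c : Cplx R) : has_sum u s -> has_sum (fun i => c * u i) (c * s).
Proof.
move=> hs e e0; have c0 : 0 < cabs c + 1 by rewrite ltr_wpDl// cabs_ge0.
have [N hN] := hs (e / (cabs c + 1)) (divr_gt0 e0 c0).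
exists N => m /hN h; rewrite -mulr_sumr -mulrBr cabsM.
move: h; rewrite ltr_pdivlMr//; have := cabs_ge0 (\sum_(i < m) u i - s); nra.
Qed.

Lemma dominated_has_sum u (V : R) :
  (forall n, \sum_(i < n) cabs (u i) <= V) -> exists s, has_sum u s.
Proof.
move=> hV.
have hr (w : nat -> R) : (forall i, `|w i| <= cabs (u i)) -> exists l : R,
    forall e, 0 < e -> exists N, forall m, (N <= m)%N -> `|\sum_(i < m) w i - l| < e.
  move=> hw; have : cvgn (series w).
    apply: normed_cvg; apply: nondecreasing_is_cvgn.
      apply/nondecreasing_seqP => n.
      rewrite /normed_series_of /=.
      rewrite (_ : (series _) n.+1 = series (fun k => `|w k|) n + `|w n|); first by rewrite lerDl.
      by rewrite /series /= big_nat_recr.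
    exists V => _ [n _ <-] /=; rewrite /series /= big_mkord.
    by apply: le_trans (hV n); apply: ler_sum => i _; exact: hw.
  move=> /cvgrPdist_lt h; exists (limn (series w)) => e e0.
  have [N _ hN] := h e e0; exists N => m /hN /=.
  by rewrite distrC /series /= big_mkord.
have [a ha] := hr (fun i => complex.Re (u i)) (fun i => Re_le_cabs _).
have [b hb] := hr (fun i => complex.Im (u i)) (fun i => Im_le_cabs _).
exists (Complex a b) => e e0; have e2 : 0 < e / 2 by rewrite divr_gt0.
have [N hN] := ha _ e2; have [M hM] := hb _ e2.
exists (maxn N M) => m; rewrite geq_max => /andP[/hN h1 /hM h2].
apply: le_lt_trans (cabs_le_ReIm _) _; rewrite !ReImE /= (splitr e).
have -> : complex.Re (\sum_(i < m) u i) = \sum_(i < m) complex.Re (u i).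
  by elim/big_ind2 : _ => // x y z w <- <-; rewrite ReD.
have -> : complex.Im (\sum_(i < m) u i) = \sum_(i < m) complex.Im (u i).
  by elim/big_ind2 : _ => // x y z w <- <-; rewrite ImD.
exact: ltrD.
Qed.

Definition csum u : Cplx R := xget 0 [set s | has_sum u s].

Lemma csumP u s : has_sum u s -> csum u = s.
Proof.
by move=> h; apply: (@has_sum_uniq u) => //; rewrite /csum; case: xgetP => [//|/(_ s)].
Qed.

End ComplexSeries.

(** * Taylor remainders and growth of powers *)

Section PowerEstimates.
Variable R : realType.
Implicit Types (x d : Cplx R) (q : R) (n : nat).

Lemma cabs_pow_le x q n : cabs x <= q -> cabs (x ^+ n) <= q ^+ n.
Proof. by move=> h; rewrite cabsX lerXn2r// ?nnegrE ?cabs_ge0// (le_trans (cabs_ge0 x)). Qed.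

(** The three Taylor estimates go by induction on the exponent: multiplying the previous remainder
    by [x + d] leaves over a single monomial of the same order in [d] as the remainder. The
    polynomial factors in [n] are crude; for [q < 1] they are absorbed by [cube_pow_small]. *)
Lemma pow_taylor1 x d q n : cabs x <= q -> cabs (x + d) <= q ->
  cabs ((x + d) ^+ n.+1 - x ^+ n.+1) <= n.+1%:R * q ^+ n * cabs d.
Proof.
move=> hx hy; have q0 := le_trans (cabs_ge0 _) hx.
elim: n => [|n ih]; first by rewrite !expr1 expr0 !mul1r addrC addKr.
have -> : (x + d) ^+ n.+2 - x ^+ n.+2 =
  (x + d) * ((x + d) ^+ n.+1 - x ^+ n.+1) + x ^+ n.+1 * d by rewrite !exprS; ring.
apply: le_trans (cabs_leD (cabs_leM hy ih) (cabs_leM (cabs_pow_le n.+1 hx) (lexx _))) _.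
by rewrite -[n.+2%:R]natr1 exprS le_eqVlt; apply/orP; left; apply/eqP; ring.
Qed.

Lemma pow_taylor2 x d q n : cabs x <= q -> cabs (x + d) <= q ->
  cabs ((x + d) ^+ n.+2 - x ^+ n.+2 - n.+2%:R * x ^+ n.+1 * d)
    <= n.+2%:R ^+ 2 * q ^+ n * cabs d ^+ 2.
Proof.
move=> hx hy; have q0 := le_trans (cabs_ge0 _) hx.
elim: n => [|n ih].
  have -> : (x + d) ^+ 2 - x ^+ 2 - 2%:R * x ^+ 1 * d = d ^+ 2 by ring.
  by rewrite expr0 mulr1 cabsX ler_peMl ?exprn_ge0 ?cabs_ge0//; lra.
have -> : (x + d) ^+ n.+3 - x ^+ n.+3 - n.+3%:R * x ^+ n.+2 * d =
  (x + d) * ((x + d) ^+ n.+2 - x ^+ n.+2 - n.+2%:R * x ^+ n.+1 * d) +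
  n.+2%:R * (x ^+ n.+1 * (d ^+ 2)).
  by rewrite -[n.+3%:R]natr1 !exprS; ring.
have hd : cabs (d ^+ 2) <= cabs d ^+ 2 by rewrite cabsX.
have hn : cabs (n.+2%:R : Cplx R) <= n.+2%:R by rewrite cabs_nat.
apply: le_trans (cabs_leD (cabs_leM hy ih)
  (cabs_leM hn (cabs_leM (cabs_pow_le n.+1 hx) hd))) _.
rewrite -[n.+3%:R]natr1 (exprS q).
have -> : q * (n.+2%:R ^+ 2 * q ^+ n * cabs d ^+ 2) +
  n.+2%:R * (q * q ^+ n * cabs d ^+ 2) =
  (n.+2%:R ^+ 2 + n.+2%:R) * (q * q ^+ n) * cabs d ^+ 2 by ring.
rewrite ler_wpM2r ?exprn_ge0 ?cabs_ge0// ler_wpM2r ?mulr_ge0 ?exprn_ge0//.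
have : 0 <= n.+2%:R :> R by []. nra.
Qed.

Lemma pow_taylor3 x d q n : cabs x <= q -> cabs (x + d) <= q ->
  cabs ((x + d) ^+ n.+3 - x ^+ n.+3 - n.+3%:R * x ^+ n.+2 * d
        - 'C(n.+3, 2)%:R * x ^+ n.+1 * d ^+ 2)
    <= n.+3%:R ^+ 3 * q ^+ n * cabs d ^+ 3.
Proof.
move=> hx hy; have q0 := le_trans (cabs_ge0 _) hx.
elim: n => [|n ih].
  have -> : (x + d) ^+ 3 - x ^+ 3 - 3%:R * x ^+ 2 * d
    - 'C(3, 2)%:R * x ^+ 1 * d ^+ 2 = d ^+ 3.
    by rewrite (_ : 'C(3, 2) = 3)//; ring.
  by rewrite expr0 mulr1 cabsX ler_peMl ?exprn_ge0 ?cabs_ge0//; lra.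
have hb : ('C(n.+4, 2) = 'C(n.+3, 2) + n.+3)%N by rewrite binS bin1 addnC.
have -> : (x + d) ^+ n.+4 - x ^+ n.+4 - n.+4%:R * x ^+ n.+3 * d
    - 'C(n.+4, 2)%:R * x ^+ n.+2 * d ^+ 2 =
  (x + d) * ((x + d) ^+ n.+3 - x ^+ n.+3 - n.+3%:R * x ^+ n.+2 * d
        - 'C(n.+3, 2)%:R * x ^+ n.+1 * d ^+ 2) +
  'C(n.+3, 2)%:R * (x ^+ n.+1 * (d ^+ 3)).
  by rewrite hb natrD -[n.+4%:R]natr1 !exprS; ring.
have hd : cabs (d ^+ 3) <= cabs d ^+ 3 by rewrite cabsX.
have hn : cabs ('C(n.+3, 2)%:R : Cplx R) <= n.+3%:R ^+ 2.
  rewrite cabs_nat -natrX ler_nat bin2 -divn2.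
  by apply: leq_trans (leq_div _ _) _; rewrite -mulnn leq_mul2l leq_pred orbT.
apply: le_trans (cabs_leD (cabs_leM hy ih)
  (cabs_leM hn (cabs_leM (cabs_pow_le n.+1 hx) hd))) _.
rewrite -[n.+4%:R]natr1 (exprS q).
have -> : q * (n.+3%:R ^+ 3 * q ^+ n * cabs d ^+ 3) +
  n.+3%:R ^+ 2 * (q * q ^+ n * cabs d ^+ 3) =
  (n.+3%:R ^+ 3 + n.+3%:R ^+ 2) * (q * q ^+ n) * cabs d ^+ 3 by ring.
rewrite ler_wpM2r ?exprn_ge0 ?cabs_ge0// ler_wpM2r ?mulr_ge0 ?exprn_ge0//.
have : 0 <= n.+3%:R :> R by []. nra.
Qed.

Lemma bernoulli_ineq (a : R) n : 0 <= a -> 1 + n%:R * a <= (1 + a) ^+ n.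
Proof.
move=> a0; elim: n => [|n ih]; first by rewrite mul0r addr0 expr0.
rewrite exprS -natr1; have : 0 <= n%:R :> R by []. nra.
Qed.

Lemma pow_large (g W : R) : 1 < g ->
  exists n0, forall n, (n0 <= n)%N -> W <= g ^+ n.
Proof.
move=> g1; exists (Num.truncn (`|W| / (g - 1))).+1 => n hn.
have ga : 0 < g - 1 by lra.
apply: le_trans (ler_norm W) _.
have : `|W| / (g - 1) < n%:R.
  by apply: lt_le_trans (truncnS_gt _) _; rewrite ler_nat.
rewrite ltr_pdivrMr// => h.
have := @bernoulli_ineq (g - 1) n (ltW ga).
by rewrite (_ : 1 + (g - 1) = g); [lra|ring].
Qed.

Lemma pow_small (q e : R) : 0 <= q < 1 -> 0 < e ->
  exists n0, forall n, (n0 <= n)%N -> q ^+ n < e.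
Proof.
move=> /andP[q0 q1] e0.
have [->|qn] := eqVneq q 0; first by exists 1%N => -[//|n _]; rewrite expr0n.
have qp : 0 < q by rewrite lt_neqAle eq_sym qn.
have [n0 h] := @pow_large q^-1 (e^-1 + 1) ltac:(by rewrite invf_gt1).
exists n0 => n /h; rewrite exprVn => h'.
have ei : 0 < e^-1 by rewrite invr_gt0.
have p0 : 0 < q ^+ n by rewrite exprn_gt0.
rewrite -(ltr_pM2r ei) mulfV ?gt_eqF//.
have := ler_wpM2l (ltW p0) h'; rewrite mulfV ?gt_eqF//; nra.
Qed.

(** With [s] the fourth root of [q], Bernoulli's inequality bounds [n.+3 * s ^+ n]. Its cube uses up
    three of the four factors [s ^+ n] of [q ^+ n], and the last one tends to [0]. *)
Lemma cube_pow_small (q K e : R) : 0 <= q < 1 -> 0 < e ->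
  exists n0, forall n, (n0 <= n)%N -> n.+3%:R ^+ 3 * q ^+ n * K <= e.
Proof.
move=> /andP[q0 q1] e0.
(* Enlarging [q] to at least 1/2 makes its roots invertible; for negative [K] the left side is not
   positive. *)
wlog qp : q q0 q1 / 0 < q.
  move=> H; have [n0 h] := H (Num.max q 2^-1) ltac:(by rewrite le_max q0)
    ltac:(by rewrite gt_max q1/= invf_lt1// ltr1n) ltac:(by rewrite lt_max invr_gt0 ltr0n orbT).
  have [K0|K0] := leP 0 K.
    exists n0 => n /h; apply: le_trans; rewrite ler_wpM2r// ler_wpM2l ?exprn_ge0//.
    by rewrite lerXn2r ?nnegrE// ?le_max ?q0// lexx.
  exists 0%N => n _; apply: le_trans (ltW e0).
  by rewrite nmulr_lle0// mulr_ge0 ?exprn_ge0.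
pose s := Num.sqrt (Num.sqrt q).
have sp : 0 < s by rewrite !sqrtr_gt0.
have s4 : q = s ^+ 4.
  by rewrite (_ : 4 = 2 * 2)%N// exprM !sqr_sqrtr ?sqrtr_ge0// ltW.
have s1 : s < 1.
  by rewrite -(@ltr_pXn2r _ 4)// ?nnegrE ?ltW// -s4 expr1n.
pose a := s^-1 - 1; have a0 : 0 < a by rewrite subr_gt0 invf_gt1.
pose B := a^-1 + 3; have B0 : 0 < B by rewrite addr_gt0// invr_gt0.
have hB n : n.+3%:R * s ^+ n <= B.
  have h := @bernoulli_ineq a n (ltW a0).
  have sn : 0 < s ^+ n by rewrite exprn_gt0.
  have hs : s ^+ n * (1 + a) ^+ n = 1.
    by rewrite -exprMn /a addrC subrK mulfV ?gt_eqF// expr1n.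
  have h1 : s ^+ n <= 1 by rewrite exprn_ile1// ltW.
  have h2 : n%:R * s ^+ n <= a^-1.
    by rewrite -div1r ler_pdivlMr//; nra.
  rewrite /B (_ : n.+3%:R = n%:R + 3); last by rewrite -natrD addn3.
  by rewrite mulrDl; apply: lerD => //; nra.
have eK : 0 < e / (B ^+ 3 * (`|K| + 1)).
  by rewrite divr_gt0// mulr_gt0 ?exprn_gt0// ltr_wpDl.
have [n0 h] := @pow_small s _ ltac:(by rewrite s1 ltW) eK.
have K1 : 0 < `|K| + 1 by rewrite ltr_wpDl.
exists n0 => n /h; rewrite ltr_pdivlMr ?mulr_gt0 ?exprn_gt0// => hn.
apply: le_trans (ltW hn).
have -> : n.+3%:R ^+ 3 * q ^+ n * K = s ^+ n * ((n.+3%:R * s ^+ n) ^+ 3 * K).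
  by rewrite s4 -exprM mulnC exprM; ring.
rewrite ler_wpM2l ?exprn_ge0 ?(ltW sp)//.
apply: (@le_trans _ _ ((n.+3%:R * s ^+ n) ^+ 3 * (`|K| + 1))).
  rewrite ler_wpM2l ?exprn_ge0 ?mulr_ge0 ?exprn_ge0 ?(ltW sp)//.
  by apply: le_trans (ler_norm K) _; rewrite lerDl.
rewrite ler_wpM2r ?(ltW K1)// lerXn2r ?nnegrE ?mulr_ge0 ?exprn_ge0 ?(ltW sp) ?(ltW B0)//.
Qed.

End PowerEstimates.

(** * Jets with uniform Taylor estimates *)

Section Jets.
Variable R : realType.
Implicit Types (x y : Cplx2 R) (K : set (Cplx2 R)) (c : R).

(* [j0] is a function and the other fields are its Taylor coefficients
   up to order 2; the factor 1/2 is included in [jzz] and [jww]. *)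
Record jet := Jet {
  j0 : Cplx2 R -> Cplx R;
  jz : Cplx2 R -> Cplx R;
  jw : Cplx2 R -> Cplx R;
  jzz : Cplx2 R -> Cplx R;
  jzw : Cplx2 R -> Cplx R;
  jww : Cplx2 R -> Cplx R }.
Implicit Types J : jet.

Definition jlin J x (h : Cplx2 R) := jz J x * h.1 + jw J x * h.2.
Definition jquad J x (h : Cplx2 R) :=
  jzz J x * (h.1 * h.1) + jzw J x * (h.1 * h.2) + jww J x * (h.2 * h.2).

(* The quantities whose smallness is required of a jet, in one family, so that
   sums and series of jets are treated uniformly; [i >= 10] gives the last one. *)
Definition jtest (i : nat) x y J : Cplx R :=
  match i with
  | 0%N => j0 J x | 1%N => jz J x | 2%N => jw J x
  | 3%N => jzz J x | 4%N => jzw J x | 5%N => jww J x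
  | 6%N => j0 J y - j0 J x | 7%N => jz J y - jz J x | 8%N => jw J y - jw J x
  | 9%N => j0 J y - j0 J x - jlin J x (y - x)
  | _ => j0 J y - j0 J x - jlin J x (y - x) - jquad J x (y - x)
  end.

Definition jweight (i : nat) (d : R) : R :=
  match i with
  | 0%N | 1%N | 2%N | 3%N | 4%N | 5%N => 1
  | 6%N | 7%N | 8%N => d
  | 9%N => d ^+ 2
  | _ => d ^+ 3
  end.

(** This replaces differentiability. It bounds finitely many expressions, linear in the jet, over
    all pairs of points of an arbitrary set, hence passes to sums, series and subsets by the
    triangle inequality alone. *)
Definition jbound J K c := forall i x y, K x -> K y ->
  cabs (jtest i x y J) <= c * jweight i (nrm (y - x)).

Definition jadd J J' := Jet
  (fun x => j0 J x + j0 J' x) (fun x => jz J x + jz J' x)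
  (fun x => jw J x + jw J' x) (fun x => jzz J x + jzz J' x)
  (fun x => jzw J x + jzw J' x) (fun x => jww J x + jww J' x).

Definition jaffine (a b d : Cplx R) := Jet
  (fun x => a * x.1 + b * x.2 + d) (fun=> a) (fun=> b)
  (fun=> 0) (fun=> 0) (fun=> 0).

Definition jpow (a b d : Cplx R) (n : nat) :=
  let A x := a * x.1 + b * x.2 + d in Jet
  (fun x => A x ^+ n.+3)
  (fun x => n.+3%:R * A x ^+ n.+2 * a)
  (fun x => n.+3%:R * A x ^+ n.+2 * b)
  (fun x => 'C(n.+3, 2)%:R * A x ^+ n.+1 * (a * a))
  (fun x => 'C(n.+3, 2)%:R * A x ^+ n.+1 * (2%:R * (a * b)))
  (fun x => 'C(n.+3, 2)%:R * A x ^+ n.+1 * (b * b)).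

Definition jseries (J : nat -> jet) := Jet
  (fun x => csum (fun k => j0 (J k) x)) (fun x => csum (fun k => jz (J k) x))
  (fun x => csum (fun k => jw (J k) x)) (fun x => csum (fun k => jzz (J k) x))
  (fun x => csum (fun k => jzw (J k) x)) (fun x => csum (fun k => jww (J k) x)).

Lemma jweight_ge0 i (d : R) : 0 <= d -> 0 <= jweight i d.
Proof. by move=> d0; do 10 (case: i => [|i] //=); rewrite ?exprn_ge0. Qed.

Lemma jtestD i x y J J' : jtest i x y (jadd J J') = jtest i x y J + jtest i x y J'.
Proof.
by do 10 (case: i => [|i] /=; first by rewrite /jlin /=; ring); rewrite /jlin /jquad /=; ring.
Qed.

Lemma jbound_sub J K K' c : K' `<=` K -> jbound J K c -> jbound J K' c.
Proof. by move=> s h i x y /s Kx /s Ky; exact: h. Qed.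

Lemma jbound_le J K c c' : c <= c' -> jbound J K c -> jbound J K c'.
Proof.
move=> s h i x y Kx Ky; apply: le_trans (h i x y Kx Ky) _.
by rewrite ler_wpM2r// jweight_ge0// nrm_ge0.
Qed.

Lemma jboundD J J' K c c' : jbound J K c -> jbound J' K c' ->
  jbound (jadd J J') K (c + c').
Proof.
by move=> h h' i x y Kx Ky; rewrite jtestD mulrDl; apply: cabs_leD; [exact: h|exact: h'].
Qed.

Lemma jaffine_bound a b d K (r : R) : (forall x, K x -> nrm x <= r) ->
  exists c, jbound (jaffine a b d) K c.
Proof.
move=> hr; pose m := cabs a + cabs b.
have hl (h : Cplx2 R) : cabs (a * h.1 + b * h.2) <= m * nrm h.
  rewrite /m mulrDl; apply: cabs_leD; rewrite cabsM ler_wpM2l ?cabs_ge0//.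
    exact: cabs1_le.
  exact: cabs2_le.
have m0 : 0 <= m by rewrite addr_ge0// cabs_ge0.
exists (m * (1 + `|r|) + cabs d) => i x y Kx Ky.
have d0 := cabs_ge0 d; have r0 := normr_ge0 r.
have hx : nrm x <= `|r| by apply: le_trans (hr _ Kx) (ler_norm _).
have a0 := cabs_ge0 a; have b0 := cabs_ge0 b; have nd := nrm_ge0 (y - x).
have mr : 0 <= m * `|r| by rewrite mulr_ge0.
have ham : cabs a <= m by rewrite /m; lra.
have hbm : cabs b <= m by rewrite /m; lra.
set c := m * (1 + `|r|) + cabs d.
have mc : m <= c by rewrite /c mulrDr mulr1; lra.
have c0 : 0 <= c by lra.
have z0 (t : R) : 0 <= t -> cabs (0 : Cplx R) <= c * t.
  by move=> t0; rewrite cabs0 mulr_ge0.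
case: i => [|i] /=.
  rewrite mulr1; apply: le_trans (cabs_leD (hl x) (lexx _)) _.
  rewrite lerD2r ler_wpM2l//; lra.
case: i => [|i] /=; first by rewrite mulr1; lra.
case: i => [|i] /=; first by rewrite mulr1; lra.
do 3 (case: i => [|i] /=; first exact: z0).
case: i => [|i] /=.
  have -> : a * y.1 + b * y.2 + d - (a * x.1 + b * x.2 + d) =
    a * (y - x).1 + b * (y - x).2 by rewrite /=; ring.
  by apply: le_trans (hl _) _; rewrite ler_wpM2r.
do 2 (case: i => [|i] /=; first by rewrite subrr; exact: z0).
have e : a * y.1 + b * y.2 + d - (a * x.1 + b * x.2 + d) -
    (a * (y.1 - x.1) + b * (y.2 - x.2)) = 0 by ring.
case: i => [|i] /=; rewrite /jlin /jquad /= e.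
  by apply: z0; rewrite exprn_ge0.
by rewrite !mul0r !addr0 subr0; apply: z0; rewrite exprn_ge0.
Qed.

(** [Q] dominates the powers of [q] from [n] to [n + 3], so the estimate serves both [q < 1], with
    [Q = q ^+ n], and [q >= 1], with [Q = q ^+ n.+3]. Likewise [m >= 1] lets one cube absorb all
    powers of the coefficients. *)
Lemma jpow_bound a b d n K (q Q m : R) : 0 <= q -> cabs a + cabs b <= m -> 1 <= m ->
  (forall x, K x -> cabs (a * x.1 + b * x.2 + d) <= q) ->
  (forall i, (i <= 3)%N -> q ^+ (n + i) <= Q) ->
  jbound (jpow a b d n) K (n.+3%:R ^+ 3 * Q * m ^+ 3).
Proof.
move=> q0 hm m1 hA hQ i x y Kx Ky.
have m0 : 0 <= m by lra.
set A := fun x : Cplx2 R => a * x.1 + b * x.2 + d.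
have hx : cabs (A x) <= q := hA x Kx.
pose L := a * (y - x).1 + b * (y - x).2.
have yE : A y = A x + L by rewrite /A /L /=; ring.
have hy : cabs (A x + L) <= q by rewrite -yE; exact: hA.
set D := nrm (y - x); have D0 : 0 <= D := nrm_ge0 _.
have hL : cabs L <= m * D.
  apply: (@le_trans _ _ ((cabs a + cabs b) * D)); last by rewrite ler_wpM2r.
  rewrite mulrDl; apply: cabs_leD; rewrite cabsM ler_wpM2l ?cabs_ge0//.
    exact: cabs1_le.
  exact: cabs2_le.
have a0 := cabs_ge0 a; have b0 := cabs_ge0 b.
have ha : cabs a <= m by lra.
have hb : cabs b <= m by lra.
set N : R := n.+3%:R.
have N1 : 1 <= N by rewrite /N ler1n.
have Q3 : q ^+ n.+3 <= Q by rewrite -addn3; exact: hQ.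
have Q2 : q ^+ n.+2 <= Q by rewrite -addn2; exact: hQ.
have Q1 : q ^+ n.+1 <= Q by rewrite -addn1; exact: hQ.
have Q0 : q ^+ n <= Q by rewrite -[n in leLHS]addn0; exact: hQ.
have Qp : 0 <= Q by apply: le_trans Q0; rewrite exprn_ge0.
have NN : 0 <= N by lra.
have cN : cabs (n.+3%:R : Cplx R) <= N by rewrite cabs_nat.
have hbin : ('C(n.+3, 2)%:R * 2 : R) <= N ^+ 2.
  rewrite -natrM /N -natrX ler_nat muln2 bin2.
  apply: (@leq_trans (n.+3 * n.+2)); last by rewrite -mulnn leq_mul2l leqnSn orbT.
  by rewrite -[leqRHS]odd_double_half leq_addl.
have cB : cabs ('C(n.+3, 2)%:R : Cplx R) <= N ^+ 2.
  rewrite cabs_nat; apply: le_trans hbin; rewrite ler_peMr//; lra.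
(* Each coefficient test is a product of a power of [N], a power of the affine form and a power of
   the coefficients, with the first and last exponents at most three. *)
have P k X Y Z : cabs (X : Cplx R) <= N ^+ k -> (k <= 3)%N ->
    cabs (Y : Cplx R) <= Q -> forall l, (l <= 3)%N -> cabs (Z : Cplx R) <= m ^+ l ->
    cabs (X * Y * Z) <= N ^+ 3 * Q * m ^+ 3.
  move=> hX k3 hY l l3 hZ; apply: le_trans (cabs_leM (cabs_leM hX hY) hZ) _.
  have := ler_weXn2l N1 k3; have := ler_weXn2l m1 l3 => hl hk.
  rewrite ler_pM ?mulr_ge0 ?exprn_ge0//; rewrite ler_wpM2r//.
have haa u v : cabs (u : Cplx R) <= m -> cabs (v : Cplx R) <= m -> cabs (u * v) <= m ^+ 2.
  by move=> h1 h2; rewrite expr2; exact: cabs_leM.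
have pw k : cabs (A x ^+ k) <= q ^+ k by exact: cabs_pow_le.
case: i => [|i] /=.
  rewrite mulr1; have := @P 0%N 1 (A x ^+ n.+3) 1.
  rewrite mul1r mulr1 cabs1 expr0; move=> /(_ (lexx _) isT (le_trans (pw _) Q3) 0%N isT); apply.
  by rewrite expr0.
case: i => [|i] /=.
  rewrite mulr1; apply: (@P 1%N _ _ _ _ isT _ 1%N) => //; exact: le_trans (pw _) Q2.
case: i => [|i] /=.
  rewrite mulr1; apply: (@P 1%N _ _ _ _ isT _ 1%N) => //; exact: le_trans (pw _) Q2.
case: i => [|i] /=.
  rewrite mulr1; apply: (@P 2 _ _ _ _ isT _ 2) => //; last exact: haa.
  exact: le_trans (pw _) Q1.
case: i => [|i] /=.
  rewrite mulr1.
  have -> : 'C(n.+3, 2)%:R * (a * x.1 + b * x.2 + d) ^+ n.+1 * (2 * (a * b)) =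
    ('C(n.+3, 2)%:R * 2%:R) * A x ^+ n.+1 * (a * b) by rewrite /A; ring.
  apply: (@P 2 _ _ _ _ isT _ 2) => //; last exact: haa.
    by rewrite -natrM cabs_nat natrM.
  exact: le_trans (pw _) Q1.
case: i => [|i] /=.
  rewrite mulr1; apply: (@P 2 _ _ _ _ isT _ 2) => //; last exact: haa.
  exact: le_trans (pw _) Q1.
rewrite -/(A x) -/(A y) yE.
have N3 k : (k <= 3)%N -> N ^+ k <= N ^+ 3 by exact: ler_weXn2l.
have m3 k : (k <= 3)%N -> m ^+ k <= m ^+ 3 by exact: ler_weXn2l.
have F k l j (T : R) : (k <= 3)%N -> (l <= 3)%N -> (j <= 3)%N ->
    T <= N ^+ k * q ^+ (n + j) * m ^+ l -> T <= N ^+ 3 * Q * m ^+ 3.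
  move=> k3 l3 j3 h; apply: le_trans h _.
  by rewrite !ler_pM ?mulr_ge0 ?exprn_ge0// ?N3 ?m3// hQ.
have G (S T : R) i' : S <= T * cabs L ^+ i' -> 0 <= T -> S <= (T * m ^+ i') * D ^+ i'.
  move=> h T0; apply: le_trans h _; rewrite -mulrA ler_wpM2l// -exprMn.
  by rewrite lerXn2r ?nnegrE ?cabs_ge0 ?mulr_ge0.
have q_ge k : 0 <= q ^+ k by rewrite exprn_ge0.
case: i => [|i] /=.
  have := @G _ _ 1%N (@pow_taylor1 R (A x) L q n.+2 hx hy); rewrite expr1 => g.
  apply: le_trans (g _) _; first by rewrite mulr_ge0.
  rewrite expr1 ler_wpM2r// (@F 1%N 1%N 2)//; rewrite !expr1 addn2//.
have D1 (u : Cplx R) : cabs u <= m ->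
    cabs (n.+3%:R * (A x + L) ^+ n.+2 * u - n.+3%:R * A x ^+ n.+2 * u) <=
    N ^+ 3 * Q * m ^+ 3 * D.
  move=> hu.
  have -> : n.+3%:R * (A x + L) ^+ n.+2 * u - n.+3%:R * A x ^+ n.+2 * u =
    n.+3%:R * u * ((A x + L) ^+ n.+2 - A x ^+ n.+2) by ring.
  apply: le_trans (cabs_leM (cabs_leM cN hu) (@pow_taylor1 R (A x) L q n.+1 hx hy)) _.
  apply: (@le_trans _ _ (N * m * (N * q ^+ n.+1 * (m * D)))).
    rewrite ler_wpM2l ?mulr_ge0// ler_pM ?mulr_ge0 ?cabs_ge0//.
    by rewrite ler_wpM2r// /N ler_nat.
  have -> : N * m * (N * q ^+ n.+1 * (m * D)) = N ^+ 2 * q ^+ (n + 1) * m ^+ 2 * D.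
    by rewrite addn1; ring.
  by rewrite ler_wpM2r// (@F 2 2 1%N).
case: i => [|i] /=; first exact: D1.
case: i => [|i] /=; first exact: D1.
have eL : n.+3%:R * A x ^+ n.+2 * a * (y - x).1 + n.+3%:R * A x ^+ n.+2 * b * (y - x).2
   = n.+3%:R * A x ^+ n.+2 * L by rewrite /L; ring.
case: i => [|i] /=; rewrite /jlin /= -/(A x) eL.
  have := @G _ _ 2 (@pow_taylor2 R (A x) L q n.+1 hx hy) => g.
  apply: le_trans (g _) _; first by rewrite mulr_ge0.
  rewrite ler_wpM2r ?exprn_ge0// (@F 2 2 1%N)//; rewrite addn1//.
have eQ : jquad (jpow a b d n) x (y - x) = 'C(n.+3, 2)%:R * A x ^+ n.+1 * L ^+ 2.
  by rewrite /jquad /= -/(A x) /L /=; ring.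
rewrite eQ; have := @G _ _ 3 (@pow_taylor3 R (A x) L q n hx hy) => g.
apply: le_trans (g _) _; first by rewrite mulr_ge0.
rewrite ler_wpM2r ?exprn_ge0// (@F 3 3 0%N)//; rewrite addn0//.
Qed.

(** Domination gives convergence of the six coefficient tests. The other tests are linear
    combinations of these with factors depending on [x] and [y] alone, so they converge to the tests
    of the series, and the bounds pass to the limit. *)
Lemma jseries_bound (J : nat -> jet) K (c : nat -> R) (V : R) :
  (forall k, jbound (J k) K (c k)) -> (forall n, \sum_(k < n) c k <= V) ->
  jbound (jseries J) K V /\
  forall x, K x -> has_sum (fun k => j0 (J k) x) (j0 (jseries J) x).
Proof.
move=> hJ hV.
have hs i x y : K x -> K y -> (i < 6)%N ->
    exists s, has_sum (fun k => jtest i x y (J k)) s.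
  move=> Kx Ky i6; apply: (@dominated_has_sum _ _ V) => n.
  apply: le_trans (hV n); apply: ler_sum => k _; apply: le_trans (hJ k i x y Kx Ky) _.
  by move: i6; do 6 (case: i => [|i] /=; first by rewrite mulr1).
have hs' i x : K x -> (i < 6)%N ->
    has_sum (fun k => jtest i x x (J k)) (jtest i x x (jseries J)).
  move=> Kx i6; have [s h] := hs i x x Kx Kx i6.
  suff -> : jtest i x x (jseries J) = s by [].
  by move: i6 h; do 6 (case: i => [|i] /=; first by move=> _ /csumP).
have sumB u v s t : has_sum u s -> has_sum v t ->
    has_sum (fun i => u i - v i) (s - t) :> Prop.
  move=> hu hv; have := has_sumD hu (has_sumZ (-1) hv).
  by rewrite mulN1r; congr has_sum; apply/funext => i; rewrite mulN1r.
have sumM u s (z : Cplx R) : has_sum u s -> has_sum (fun i => u i * z) (s * z).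
  move=> hu; have := has_sumZ z hu; rewrite mulrC.
  by congr has_sum; apply/funext => i; rewrite mulrC.
split; last by move=> x Kx; exact: (hs' 0%N).
have main i x y : K x -> K y ->
    has_sum (fun k => jtest i x y (J k)) (jtest i x y (jseries J)).
  move=> Kx Ky.
  case: i => [|i]; first exact: (hs' 0%N).
  case: i => [|i]; first exact: (hs' 1%N).
  case: i => [|i]; first exact: (hs' 2).
  case: i => [|i]; first exact: (hs' 3).
  case: i => [|i]; first exact: (hs' 4).
  case: i => [|i]; first exact: (hs' 5).
  case: i => [|i]; first by apply: (@sumB R); exact: (hs' 0%N).
  case: i => [|i]; first by apply: (@sumB R); exact: (hs' 1%N).
  case: i => [|i]; first by apply: (@sumB R); exact: (hs' 2).
  have h9 : has_sum (fun k => jtest 9 x y (J k)) (jtest 9 x y (jseries J)).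
    apply: (@sumB R); first by apply: (@sumB R); exact: (hs' 0%N).
    by apply: has_sumD; apply: (sumM); [exact: (hs' 1%N)|exact: (hs' 2)].
  case: i => [//|i]; apply: (@sumB R) => //.
  apply: has_sumD; last by apply: (sumM); exact: (hs' 5).
  by apply: has_sumD; apply: (sumM); [exact: (hs' 3)|exact: (hs' 4)].
move=> i x y Kx Ky; rewrite -[jtest _ _ _ _]subr0.
apply: (has_sum_le (n := 0%N) (main i x y Kx Ky)) => m _; rewrite subr0.
apply: (@le_trans _ _ (\sum_(k < m) cabs (jtest i x y (J k)))).
  elim: m => [|m ih]; first by rewrite !big_ord0 cabs0.
  by rewrite !big_ord_recr /=; apply: cabs_leD.
apply: (@le_trans _ _ ((\sum_(k < m) c k) * jweight i (nrm (y - x)))).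
  by rewrite mulr_suml; apply: ler_sum => k _; exact: hJ.
by rewrite ler_wpM2r// jweight_ge0// nrm_ge0.
Qed.

End Jets.

(** * Local graphs *)

Section Newton.
Variable R : realType.

(** Newton iteration with the fixed slope [b]: [G] is linear up to half that slope, so each step
    halves [cabs (G w)]. The steps add up to at most [2 * cabs (G w0) / cabs b], which the last
    hypothesis keeps within the disc of radius [r]. *)
Lemma newton_zero (G : Cplx R -> Cplx R) (b w0 : Cplx R) (r : R) :
  b != 0 ->
  (forall w w', cabs (w - w0) <= r -> cabs (w' - w0) <= r ->
    cabs (G w - G w' - b * (w - w')) <= cabs b / 2 * cabs (w - w')) ->
  cabs (G w0) <= cabs b * r / 2 ->
  exists2 w, cabs (w - w0) <= 2 * (cabs (G w0) / cabs b) & G w = 0.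
Proof.
move=> b0 hG hw0; have bp : 0 < cabs b by rewrite cabs_gt0.
pose N w := w - G w / b; pose W n := iter n N w0.
set e := cabs (G w0) / cabs b.
have e0 : 0 <= e by rewrite divr_ge0 ?cabs_ge0.
have er : 2 * e <= r.
  rewrite /e mulrA ler_pdivrMr//; nra.
have WS n : W n.+1 = W n - G (W n) / b by [].
have half k : 2 * e * (1 - 2^-1 ^+ k) <= 2 * e.
  have : 0 <= (2^-1 : R) ^+ k by rewrite exprn_ge0. nra.
have inv n : cabs (G (W n)) <= 2^-1 ^+ n * cabs (G w0) /\
    cabs (W n - w0) <= 2 * e * (1 - 2^-1 ^+ n).
  elim: n => [|n [ih1 ih2]].
    by rewrite expr0 mul1r /W /= subrr cabs0 subrr mulr0.
  have p1 : 0 <= (2^-1 : R) ^+ n by rewrite exprn_ge0.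
  have hu : cabs (W n.+1 - W n) <= 2^-1 ^+ n * e.
    rewrite WS addrC addKr cabsN cabsM cabsV// /e mulrA.
    by rewrite ler_wpM2r// invr_ge0 ltW.
  have hW : cabs (W n.+1 - w0) <= 2 * e * (1 - 2^-1 ^+ n.+1).
    have -> : W n.+1 - w0 = (W n.+1 - W n) + (W n - w0) by ring.
    by apply: le_trans (cabs_leD hu ih2) _; rewrite exprS; lra.
  split=> //.
  have h1 : cabs (W n.+1 - w0) <= r.
    by apply: le_trans hW _; apply: le_trans er.
  have h2 : cabs (W n - w0) <= r.
    by apply: le_trans ih2 _; apply: le_trans er.
  have := hG _ _ h1 h2.
  have -> : G (W n.+1) - G (W n) - b * (W n.+1 - W n) = G (W n.+1).
    by rewrite [in b * _]WS; field.
  move=> /le_trans; apply.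
  have : cabs b * cabs (W n.+1 - W n) <= cabs (G (W n)).
    by rewrite -cabsM (_ : b * _ = - G (W n)) ?cabsN//; rewrite WS; field.
  rewrite exprS; lra.
pose u n := W n.+1 - W n.
have hu n : cabs (u n) <= 2^-1 ^+ n * e.
  rewrite /u WS addrC addKr cabsN cabsM cabsV// /e mulrA.
  by rewrite ler_wpM2r ?invr_ge0 ?(ltW bp)//; have [] := inv n.
have sumu n : \sum_(i < n) u i = W n - w0.
  by rewrite -(big_mkord xpredT u) telescope_sumr.
have geo n : \sum_(i < n) (2^-1 ^+ i : R) * e <= 2 * e.
  have -> : \sum_(i < n) (2^-1 ^+ i : R) * e = 2 * e * (1 - 2^-1 ^+ n).
    elim: n => [|n ih]; first by rewrite big_ord0 expr0 subrr mulr0.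
    by rewrite big_ord_recr /= ih exprS; field.
  exact: half.
have [s hs] : exists s, has_sum u s.
  apply: (@dominated_has_sum _ _ (2 * e)) => n; apply: le_trans (geo n).
  by apply: ler_sum.
have We n : cabs (W n - w0) <= 2 * e.
  by have [_ h] := inv n; apply: le_trans h _.
have hse : cabs (s - 0) <= 2 * e.
  by apply: (has_sum_le (n := 0%N) hs) => m _; rewrite subr0 sumu.
exists (w0 + s); first by rewrite addrC addKr -[s]subr0.
apply: cabs_eq0; apply/eqP; rewrite eq_le cabs_ge0 andbT.
apply/ler_addgt0Pr => d d0; rewrite add0r.
have [M hM] := hs (d / (4 * cabs b)) ltac:(by rewrite divr_gt0// mulr_gt0).
have gw : 0 < cabs (G w0) + 1 by rewrite ltr_wpDl// cabs_ge0.
have [M' hM'] := @pow_small R 2^-1 (d / (2 * (cabs (G w0) + 1)))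
  ltac:(by rewrite invr_ge0 ler0n invf_lt1// ltr1n) ltac:(by rewrite divr_gt0// mulr_gt0).
set n := maxn M M'.
have := hM n (leq_maxl _ _); rewrite sumu.
rewrite ltr_pdivlMr ?mulr_gt0// => h1.
have := hM' n (leq_maxr _ _); rewrite ltr_pdivlMr ?mulr_gt0// => h2.
have [h3 _] := inv n.
have h4 : cabs (w0 + s - w0) <= r.
  by rewrite addrC addKr -[s]subr0; exact: le_trans er.
have h5 : cabs (W n - w0) <= r by exact: le_trans (We n) er.
have h6 := hG _ _ h4 h5.
have h7 : cabs (w0 + s - W n) = cabs (W n - w0 - s).
  by rewrite -cabsN; congr cabs; ring.
rewrite h7 in h6.
have p0 : 0 <= (2^-1 : R) ^+ n by rewrite exprn_ge0.
(* The limit is compared with a late iterate, where both the residue and the remaining distance are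
   small. *)
have -> : G (w0 + s) = (G (w0 + s) - G (W n) - b * (w0 + s - W n)) +
    (G (W n) + b * (w0 + s - W n)) by ring.
apply: le_trans (cabs_leD h6 (cabs_leD (lexx _) (lexx _))) _.
rewrite cabsM h7; lra.
Qed.

End Newton.

(** * Zero sets as graphs over a coordinate axis *)

Section LocalGraph.
Variable R : realType.
Implicit Types (p q : Cplx2 R) (z w : Cplx R) (b : bool).

(** [b] tells which coordinate is the parameter, so that graphs over either axis are treated at
    once. *)
Definition prj b p : Cplx R := if b then p.1 else p.2.
Definition mk b z w : Cplx2 R := if b then (z, w) else (w, z).
Definition coef b (J : jet R) p := if b then jz J p else jw J p.

Lemma prj_mk b z w : prj b (mk b z w) = z. Proof. by case: b. Qed.
Lemma prjN_mk b z w : prj (~~ b) (mk b z w) = w. Proof. by case: b. Qed.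
Lemma mk_prj b p : mk b (prj b p) (prj (~~ b) p) = p. Proof. by case: b; case: p. Qed.
Lemma mkB b z w z' w' : mk b z w - mk b z' w' = mk b (z - z') (w - w').
Proof. by case: b. Qed.
Lemma prjB b p q : prj b (p - q) = prj b p - prj b q. Proof. by case: b. Qed.
Lemma nrm_mk b z w : nrm (mk b z w) <= cabs z + cabs w.
Proof. by apply: le_trans (nrm_le _) _; case: b => //=; rewrite addrC. Qed.
Lemma cabs_prj b p : cabs (prj b p) <= nrm p.
Proof. by case: b; [exact: cabs1_le|exact: cabs2_le]. Qed.
Lemma jlin_coef b J p q : jlin J p q = coef b J p * prj b q + coef (~~ b) J p * prj (~~ b) q.
Proof. by rewrite /jlin; case: b => //=; rewrite addrC. Qed.

Definition graph_slope b J (g : Cplx R -> Cplx R) z : Cplx R :=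
  - (coef b J (mk b z (g z)) / coef (~~ b) J (mk b z (g z))).

(* Bounds are recorded with the graph because every regularity property of the
   surface is derived from them rather than from power series. *)
Record local_graph (J : jet R) (p : Cplx2 R) b (rho r c : R) (g : Cplx R -> Cplx R) : Prop :=
  LocalGraph {
    lg_rho : 0 < rho;
    lg_r : 0 < r;
    lg_c : 0 <= c;
    lg_in : forall z, cabs (z - prj b p) < rho -> cabs (g z - prj (~~ b) p) < r;
    lg_zero : forall z w, cabs (z - prj b p) < rho -> cabs (w - prj (~~ b) p) < r ->
      (j0 J (mk b z w) = 0 <-> w = g z);
    lg_coef : forall z, cabs (z - prj b p) < rho -> coef (~~ b) J (mk b z (g z)) != 0;
    lg_taylor : forall z z', cabs (z - prj b p) < rho -> cabs (z' - prj b p) < rho ->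
      cabs (g z' - g z - graph_slope b J g z * (z' - z)) <= c * cabs (z' - z) ^+ 2;
    lg_slope : forall z, cabs (z - prj b p) < rho -> cabs (graph_slope b J g z) <= c;
    lg_lip : forall z z', cabs (z - prj b p) < rho -> cabs (z' - prj b p) < rho ->
      cabs (g z' - g z) <= c * cabs (z' - z);
    lg_slope_lip : forall z z', cabs (z - prj b p) < rho -> cabs (z' - prj b p) < rho ->
      cabs (graph_slope b J g z' - graph_slope b J g z) <= c * cabs (z' - z) }.

Lemma coef_lip J K c b p q : jbound J K c -> K p -> K q ->
  cabs (coef b J q - coef b J p) <= c * nrm (q - p).
Proof. by move=> h Kp Kq; case: b; [exact: (h 7%N)|exact: (h 8%N)]. Qed.

Lemma coef_le J K c b p : jbound J K c -> K p -> cabs (coef b J p) <= c.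
Proof.
by move=> h Kp; case: b; [have := h 1%N p p Kp Kp|have := h 2%N p p Kp Kp]; rewrite /= mulr1.
Qed.

(** The implicit function theorem, read off the jet bound. On each slice with a fixed parameter,
    [newton_zero] applies with the slope at [p], and the same estimate gives uniqueness. The bounds
    on the graph follow by dividing tests taken along the zero set by the transversal coefficient,
    which keeps at least half of its modulus at [p]. The size [e] lets the bidisc be shrunk into a
    given open set. *)
Lemma implicit_graph J p b (s c e : R) : 0 < s -> 0 < e ->
  jbound J [set q | nrm (q - p) < s] c -> j0 J p = 0 -> coef (~~ b) J p != 0 ->
  exists rho r c' g, rho <= e /\ r <= e /\ local_graph J p b rho r c' g.
Proof.
move=> s0 e0 hJ jp hb; wlog c1 : c hJ / 1 <= c.
  move=> H; apply: (H (Num.max 1 c)); last by rewrite le_max lexx.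
  by apply: jbound_le hJ; rewrite le_max lexx orbT.
set beta := coef (~~ b) J p in hb *.
set b0 := cabs beta; have b00 : 0 < b0 by rewrite cabs_gt0.
set z0 := prj b p; set w0 := prj (~~ b) p.
set K := [set q | nrm (q - p) < s] in hJ.
have c0 : 0 < c by lra.
(* The bound [s / 3] puts the bidisc inside the ball where the jet is controlled; [b0 / (8 * c)]
   keeps the transversal coefficient within [b0 / 4] of [beta]. *)
pose r := Num.min (Num.min (s / 3) e) (b0 / (8 * c)).
have r0 : 0 < r by rewrite !lt_min e0 divr_gt0//= divr_gt0// mulr_gt0.
have rs : r <= s / 3 by rewrite !ge_min lexx.
have re : r <= e by rewrite !ge_min lexx orbT.
have rb : c * (2 * r) <= b0 / 4.
  have : r <= b0 / (8 * c) by rewrite !ge_min lexx orbT.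
  rewrite ler_pdivlMr ?mulr_gt0//; lra.
(* The initial error [c * rho] is half of what [newton_zero] accepts, so that the zero found lies
   strictly inside the disc of radius [r]. *)
pose rho := Num.min r (b0 * r / (4 * c)).
have rho0 : 0 < rho by rewrite lt_min r0 divr_gt0// mulr_gt0.
have rhor : rho <= r by rewrite ge_min lexx.
have rhob : c * rho <= b0 * r / 4.
  have : rho <= b0 * r / (4 * c) by rewrite ge_min lexx orbT.
  rewrite ler_pdivlMr ?mulr_gt0//; lra.
have pE : p = mk b z0 w0 by rewrite mk_prj.
have dist z w : nrm (mk b z w - p) <= cabs (z - z0) + cabs (w - w0).
  by rewrite pE mkB; exact: nrm_mk.
have inK z w : cabs (z - z0) < rho -> cabs (w - w0) <= r -> K (mk b z w).
  by move=> h1 h2; rewrite /K /=; apply: le_lt_trans (dist _ _) _; lra.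
have dw z w : cabs (z - z0) < rho -> cabs (w - w0) <= r ->
    cabs (coef (~~ b) J (mk b z w) - beta) <= b0 / 4.
  move=> h1 h2; have Kp : K p by rewrite /K /= subrr nrm0.
  apply: le_trans (coef_lip (~~ b) hJ Kp (inK _ _ h1 h2)) _; apply: le_trans rb.
  rewrite ler_wpM2l ?(ltW c0)//; apply: le_trans (dist _ _) _; lra.
have step z w w' : cabs (z - z0) < rho -> cabs (w - w0) <= r -> cabs (w' - w0) <= r ->
    cabs (j0 J (mk b z w) - j0 J (mk b z w') - beta * (w - w')) <= b0 / 2 * cabs (w - w').
  move=> hz hw hw'.
  have := hJ 9 _ _ (inK _ _ hz hw') (inK _ _ hz hw).
  rewrite [jtest _ _ _ _]/= [jweight _ _]/= (jlin_coef b) mkB subrr prj_mk prjN_mk mulr0 add0r.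
  have hn : nrm (mk b 0 (w - w')) <= cabs (w - w').
    by apply: le_trans (nrm_mk _ _ _) _; rewrite cabs0 add0r.
  move=> h1.
  have -> : j0 J (mk b z w) - j0 J (mk b z w') - beta * (w - w') =
    (j0 J (mk b z w) - j0 J (mk b z w') - coef (~~ b) J (mk b z w') * (w - w')) +
    (coef (~~ b) J (mk b z w') - beta) * (w - w') by ring.
  apply: le_trans (cabs_leD h1 (cabs_leM (dw _ _ hz hw') (lexx _))) _.
  have a0 := cabs_ge0 (w - w').
  have hd : cabs (w - w') <= 2 * r.
    have -> : w - w' = (w - w0) - (w' - w0) by ring.
    by apply: le_trans (cabs_leB hw hw') _; lra.
  have : c * nrm (mk b 0 (w - w')) ^+ 2 <= c * (2 * r * cabs (w - w')).
    rewrite ler_wpM2l ?(ltW c0)// expr2 ler_pM ?nrm_ge0//.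
    exact: le_trans hn hd.
  nra.
have j0z z : cabs (z - z0) < rho -> cabs (j0 J (mk b z w0)) <= c * cabs (z - z0).
  move=> hz; have Kp : K p by rewrite /K /= subrr nrm0.
  have Kz : K (mk b z w0) by apply: inK => //; rewrite subrr cabs0 ltW.
  have := hJ 6 _ _ Kp Kz; rewrite /= jp subr0 => /le_trans; apply.
  rewrite ler_wpM2l ?(ltW c0)//; apply: le_trans (dist _ _) _.
  by rewrite subrr cabs0 addr0.
have ex z : cabs (z - z0) < rho -> exists w, cabs (w - w0) < r /\ j0 J (mk b z w) = 0.
  move=> hz; have := @newton_zero R (fun w => j0 J (mk b z w)) beta w0 r hb.
  move=> /(_ (fun w w' => step z w w' hz)) [].
    apply: le_trans (j0z _ hz) _; rewrite -/b0.
    have : c * cabs (z - z0) <= c * rho by rewrite ler_wpM2l ?(ltW c0)// ltW.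
    have := mulr_gt0 b00 r0; lra.
  move=> w hw h; exists w; split=> //; apply: le_lt_trans hw _.
  rewrite -/b0 mulrA ltr_pdivrMr//.
  have := j0z z hz.
  have : c * cabs (z - z0) <= c * rho by rewrite ler_wpM2l ?(ltW c0)// ltW.
  have := mulr_gt0 b00 r0; lra.
pose g z := xget 0 [set w | cabs (w - w0) < r /\ j0 J (mk b z w) = 0].
have gP z : cabs (z - z0) < rho -> cabs (g z - w0) < r /\ j0 J (mk b z (g z)) = 0.
  by move=> /ex[w hw]; rewrite /g; case: xgetP => [? _ //|/(_ w)].
have gle z : cabs (z - z0) < rho -> cabs (g z - w0) <= r.
  by move=> /gP[/ltW].
have uniq z w w' : cabs (z - z0) < rho -> cabs (w - w0) <= r -> cabs (w' - w0) <= r ->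
   b0 / 2 * cabs (w - w') <= cabs (j0 J (mk b z w) - j0 J (mk b z w')).
  move=> hz hw hw'; have h := step z w w' hz hw hw'.
  have : cabs (beta * (w - w')) <= cabs (j0 J (mk b z w) - j0 J (mk b z w')) +
      b0 / 2 * cabs (w - w').
    have -> : beta * (w - w') = (j0 J (mk b z w) - j0 J (mk b z w')) -
      (j0 J (mk b z w) - j0 J (mk b z w') - beta * (w - w')) by ring.
    exact: cabs_leB.
  rewrite cabsM -/b0; lra.
pose L := 2 * c / b0; have L0 : 0 < L by rewrite divr_gt0// mulr_gt0.
have glip z z' : cabs (z - z0) < rho -> cabs (z' - z0) < rho ->
    cabs (g z' - g z) <= L * cabs (z' - z).
  move=> hz hz'; have := uniq z _ _ hz (gle _ hz') (gle _ hz).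
  rewrite (gP z hz).2 subr0 => h.
  have := hJ 6 _ _ (inK _ _ hz' (gle _ hz')) (inK _ _ hz (gle _ hz')).
  rewrite /= (gP z' hz').2 subr0 mkB subrr => h'.
  have h2 : nrm (mk b (z - z') 0) <= cabs (z' - z).
    by apply: le_trans (nrm_mk _ _ _) _; rewrite cabs0 addr0 cabsBC.
  have h3 : c * nrm (mk b (z - z') 0) <= c * cabs (z' - z) by rewrite ler_wpM2l ?(ltW c0).
  rewrite /L mulrAC ler_pdivlMr//; lra.
have dwge z : cabs (z - z0) < rho -> b0 / 2 <= cabs (coef (~~ b) J (mk b z (g z))).
  move=> hz; have := dw z _ hz (gle z hz); rewrite cabsBC => h.
  have := cabs_dist beta (beta - coef (~~ b) J (mk b z (g z))).
  have -> (X : Cplx R) : beta - (beta - X) = X by ring.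
  rewrite -/b0; lra.
have dwn0 z : cabs (z - z0) < rho -> coef (~~ b) J (mk b z (g z)) != 0.
  by move=> /dwge h; rewrite -cabs_gt0; apply: lt_le_trans h; rewrite divr_gt0.
have Pd z z' : cabs (z - z0) < rho -> cabs (z' - z0) < rho ->
    nrm (mk b z' (g z') - mk b z (g z)) <= (1 + L) * cabs (z' - z).
  move=> hz hz'; rewrite mkB; apply: le_trans (nrm_mk _ _ _) _.
  by rewrite mulrDl mul1r lerD2l; exact: glip.
have KP z : cabs (z - z0) < rho -> K (mk b z (g z)).
  by move=> hz; apply: inK => //; exact: gle.
pose C1 := c * (1 + L) ^+ 2 / (b0 / 2).
pose C2 := c / (b0 / 2).
pose C3 := (2 * c * c * (1 + L)) / (b0 / 2) ^+ 2.
have b2 : 0 < b0 / 2 by rewrite divr_gt0.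
have L1 : 0 < 1 + L by lra.
have C10 : 0 <= C1 by rewrite ltW// divr_gt0// mulr_gt0// exprn_gt0.
have C20 : 0 <= C2 by rewrite ltW// divr_gt0.
have C30 : 0 <= C3 by rewrite ltW// divr_gt0// ?exprn_gt0// !mulr_gt0.
exists rho, r, (C1 + C2 + C3 + L), g; split; first exact: le_trans re.
split=> //; split=> //.
- by rewrite !addr_ge0// ltW.
- by move=> z /gP[].
- move=> z w hz hw; split=> [h|->]; last by have [] := gP z hz.
  have := uniq z _ _ hz (ltW hw) (gle _ hz); rewrite h (gP z hz).2 subrr cabs0 => h'.
  apply/eqP; rewrite -subr_eq0; apply/eqP/cabs_eq0/eqP; rewrite eq_le cabs_ge0 andbT.
  by rewrite -(@pmulr_rle0 _ (b0 / 2)).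
- move=> z z' hz hz'; apply: (@le_trans _ _ (C1 * cabs (z' - z) ^+ 2)); last first.
    by rewrite ler_wpM2r ?exprn_ge0 ?cabs_ge0//; lra.
  have := hJ 9 _ _ (KP _ hz) (KP _ hz').
  rewrite [jtest _ _ _ _]/= [jweight _ _]/= (jlin_coef b) mkB prj_mk prjN_mk -mkB.
  rewrite (gP z hz).2 (gP z' hz').2 subrr sub0r cabsN => h.
  set dz := coef b J _ in h; set dv := coef (~~ b) J _ in h.
  have dv0 : dv != 0 := dwn0 z hz.
  have -> : g z' - g z - graph_slope b J g z * (z' - z) =
    (dz * (z' - z) + dv * (g z' - g z)) / dv.
    by rewrite /graph_slope -/dz -/dv; field.
  rewrite cabsM cabsV// /C1 mulrAC.
  apply: ler_pM; rewrite ?cabs_ge0 ?invr_ge0 ?cabs_ge0//.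
    apply: le_trans h _; rewrite -mulrA ler_wpM2l ?(ltW c0)// -exprMn.
    by rewrite lerXn2r ?nnegrE ?nrm_ge0 ?mulr_ge0 ?cabs_ge0 ?(ltW L1)//; exact: Pd.
  by rewrite lef_pV2 ?posrE ?cabs_gt0//; exact: dwge.
- move=> z hz; apply: (@le_trans _ _ C2); last by lra.
  rewrite /graph_slope cabsN cabsM cabsV ?dwn0//.
  apply: ler_pM; rewrite ?cabs_ge0 ?invr_ge0 ?cabs_ge0//.
    exact: (coef_le _ hJ (KP _ hz)).
  by rewrite lef_pV2 ?posrE ?cabs_gt0 ?dwn0//; exact: dwge.
- move=> z z' hz hz'; apply: le_trans (glip _ _ hz hz') _.
  by rewrite ler_wpM2r ?cabs_ge0//; lra.
- move=> z z' hz hz'; apply: (@le_trans _ _ (C3 * cabs (z' - z))); last first.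
    by rewrite ler_wpM2r ?cabs_ge0//; lra.
  rewrite /graph_slope.
  have hdz := coef_lip b hJ (KP _ hz) (KP _ hz').
  have hdv := coef_lip (~~ b) hJ (KP _ hz) (KP _ hz').
  have ldz := coef_le b hJ (KP _ hz); have ldv := coef_le (~~ b) hJ (KP _ hz).
  have nz := dwn0 z hz; have nz' := dwn0 z' hz'.
  have gz := dwge z hz; have gz' := dwge z' hz'.
  have hP := Pd _ _ hz hz'.
  move: hdz hdv ldz ldv nz nz' gz gz' hP.
  set P := mk b z _; set P' := mk b z' _ => hdz hdv ldz ldv nz nz' gz gz' hP.
  have -> : - (coef b J P' / coef (~~ b) J P') - - (coef b J P / coef (~~ b) J P) =
    (coef b J P * (coef (~~ b) J P' - coef (~~ b) J P) -
     coef (~~ b) J P * (coef b J P' - coef b J P)) / (coef (~~ b) J P * coef (~~ b) J P').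
    by field; rewrite nz nz'.
  rewrite cabsM cabsV ?mulf_neq0// cabsM /C3 mulrAC.
  apply: ler_pM; rewrite ?invr_ge0 ?mulr_ge0 ?cabs_ge0//.
    apply: le_trans (cabs_leB (cabs_leM ldz hdv) (cabs_leM ldv hdz)) _.
    have : c * c * nrm (P' - P) <= c * c * ((1 + L) * cabs (z' - z)).
      by rewrite ler_wpM2l ?mulr_ge0 ?(ltW c0).
    lra.
  rewrite lef_pV2 ?posrE ?mulr_gt0 ?cabs_gt0 ?exprn_gt0// expr2.
  by apply: ler_pM => //; exact: ltW.
Qed.

End LocalGraph.

(** * The zero surface *)

Section SubsetSpace.
Variables (R : realType) (S : set (Cplx2 R)).
Implicit Types (x y : S) (A : set S).

Lemma nbhs_subP x A : nbhs x A <->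
  exists2 e : R, 0 < e & forall y, nrm (val y - val x) < e -> A y.
Proof.
rewrite nbhsE; split.
  move=> [_ [[W oW <-] Wx] WA].
  have [e e0 he] := (proj1 (Cplx2_openP W) oW) (val x) Wx.
  by exists e => // y /he; exact: WA.
move=> [e e0 he]; exists (val @^-1` [set q | nrm (q - val x) < e]) => //.
  split; last by rewrite /= subrr nrm0.
  exists [set q | nrm (q - val x) < e] => //.
  apply/Cplx2_openP => p hp; exists (e - nrm (p - val x)); first by rewrite subr_gt0.
  by move=> q; rewrite ltrBrDr; apply: le_lt_trans; exact: nrm_triangle.
Qed.

Lemma open_subP A : open A <->
  forall x, A x -> exists2 e : R, 0 < e & forall y, nrm (val y - val x) < e -> A y.
Proof.
rewrite openE; split=> h x Ax; first by apply/nbhs_subP; exact: h.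
by apply/nbhs_subP; exact: h.
Qed.

Lemma val_sub_continuous : continuous (fun x : S => val x : Cplx2 R).
Proof.
move=> x W /nbhs_Cplx2P[e e0 he]; apply/nbhs_subP; exists e => // y; exact: he.
Qed.

Lemma hausdorff_sub : hausdorff_space S.
Proof.
move=> x y h; apply: val_inj; apply/eqP; rewrite -subr_eq0 -[_ == _]negbK -nrm_gt0.
apply/negP => d0; set d := nrm _ in d0.
have [||z [/= hx hy]] := h [set z | nrm (val z - val x) < d / 2]
  [set z | nrm (val z - val y) < d / 2].
- by apply/nbhs_subP; exists (d / 2) => //; rewrite divr_gt0.
- by apply/nbhs_subP; exists (d / 2) => //; rewrite divr_gt0.
have := nrm_triangle (val z) (val x) (val y); rewrite -/d nrmBC; lra.
Qed.

Lemma second_countable_sub : @second_countable S.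
Proof.
pose ctr (q : (rat * rat) * (rat * rat)) : Cplx2 R :=
  of_coords ((ratr q.1.1, ratr q.1.2), (ratr q.2.1, ratr q.2.2)).
pose U (i : ((rat * rat) * (rat * rat)) * nat) : set S :=
  [set x : S | nrm (val x - ctr i.1) < i.2.+1%:R^-1].
exists (range U); first exact: sub_countable (card_image_le U _) (countableP _).
split.
  move=> _ [i _ <-]; apply/open_subP => x hx.
  exists (i.2.+1%:R^-1 - nrm (val x - ctr i.1)); first by rewrite subr_gt0.
  move=> y; rewrite ltrBrDr; apply: le_lt_trans; exact: nrm_triangle.
move=> x A /nbhs_subP[e e0 he].
pose n := Num.truncn (2 / e).
have hn : n.+1%:R^-1 < e / 2 :> R.
  rewrite -[ltRHS]invrK invf_div ltf_pV2 ?posrE ?divr_gt0//.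
  exact: truncnS_gt.
have n0 : 0 < (n.+1%:R^-1 : R) / 4 by rewrite divr_gt0// invr_gt0.
have [dl dlE] : {dl : R | dl = n.+1%:R^-1} by exists n.+1%:R^-1.
rewrite -dlE in hn n0.
have rd (t : R) : exists q : rat, `|t - ratr q| < dl / 4.
  have lt : t - dl / 4 < t + dl / 4 by lra.
  have [q] := rat_in_itvoo lt.
  by rewrite in_itv /= => /andP[h1 h2]; exists q; rewrite ltr_norml; lra.
have [a ha] := rd (complex.Re (val x).1); have [b hb] := rd (complex.Im (val x).1).
have [c hc] := rd (complex.Re (val x).2); have [d hd] := rd (complex.Im (val x).2).
have hx : nrm (val x - ctr ((a, b), (c, d))) < dl.
  apply: le_lt_trans (nrm_le _) _.
  apply: le_lt_trans (lerD (cabs_le_ReIm _) (cabs_le_ReIm _)) _.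
  by rewrite /= !ReImE /=; lra.
exists (U (((a, b), (c, d)), n)); first by split; [exists (((a, b), (c, d)), n)|rewrite /U /= -dlE].

move=> y; rewrite /U /= -dlE => hy; apply: he.
have := nrm_triangle (ctr ((a, b), (c, d))) (val y) (val x).
by rewrite (nrmBC (ctr _)); move: hx hy => /=; lra.
Qed.

(** A clopen [D] in the subtype yields a subset of [S] cut out both by an open set of the plane, the
    union of the balls witnessing that [D] is open, and by a closed one, the complement of the
    analogous union for the complement of [D]. *)
Lemma connected_sub : connected S -> connected [set: S].
Proof.
move=> cS D [x0 Dx0] [C oC hC] [C' cC' hC'].
have DC : D = C by rewrite hC setTI.
have DC' : D = C' by rewrite hC' setTI.
move: oC cC'; rewrite -DC -DC' => {C C' DC DC' hC hC'} oD cD.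
have oD' : open (~` D) by rewrite openC.
have DE : [set p | exists2 y : S, D y & val y = p] = S.
  apply: cS.
  - by exists (val x0), x0.
  - pose W : set (Cplx2 R) := [set p | exists x e, [/\ 0 < e,
      D x, nrm (p - val x) < e & forall y : S, nrm (val y - val x) < e -> D y]].
    exists W.
      apply/Cplx2_openP => p [x [e [e0 Dx hp he]]].
      exists (e - nrm (p - val x)); first by rewrite subr_gt0.
      move=> q; rewrite ltrBrDr => hq; exists x, e; split => //.
      by apply: le_lt_trans hq; exact: nrm_triangle.
    apply/seteqP; split=> p.
      move=> [y Dy <-]; split; first exact: set_valP.
      have [e e0 he] := proj1 (open_subP _) oD y Dy.
      by exists y, e; split=> //; rewrite subrr nrm0.
    move=> [Sp [x [e [e0 Dx hp he]]]].
    by exists (exist _ p (mem_set Sp)) => //; exact: he.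
  - pose W : set (Cplx2 R) := [set p | exists x e, [/\ 0 < e,
      ~ D x, nrm (p - val x) < e & forall y : S, nrm (val y - val x) < e -> ~ D y]].
    exists (~` W).
      rewrite closedC; apply/Cplx2_openP => p [x [e [e0 Dx hp he]]].
      exists (e - nrm (p - val x)); first by rewrite subr_gt0.
      move=> q; rewrite ltrBrDr => hq; exists x, e; split => //.
      by apply: le_lt_trans hq; exact: nrm_triangle.
    apply/seteqP; split=> p.
      move=> [y Dy <-]; split; first exact: set_valP.
      by move=> [x [e [e0 Dx hp he]]]; exact: (he y hp).
    move=> [Sp nW]; exists (exist _ p (mem_set Sp)) => //.
    apply: contrapT => nD; apply: nW.
    have [e e0 he] := proj1 (open_subP _) oD' _ nD.
    by exists (exist _ p (mem_set Sp)), e; split=> //; rewrite subrr nrm0.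
apply/seteqP; split=> // y _.
have : [set p | exists2 y : S, D y & val y = p] (val y) by rewrite DE; exact: set_valP.
by move=> [y' Dy' /val_inj <-].
Qed.

Lemma compact_sub A : compact [set p | exists2 y : S, A y & val y = p] -> compact A.
Proof.
move=> cA F FF FA.
pose G : set_system (Cplx2 R) := (fun x : S => val x : Cplx2 R) @ F.
have [|p [[a Aa <-] hp]] := cA G _.
  by apply: (@filterS _ F _ A) => // y Ay; exists y.
exists a; split=> // C D FC /nbhs_subP[e e0 he].
have [||q [[y Cy <-] /= hq]] := hp [set p | exists2 y : S, C y & val y = p]
   [set q | nrm (q - val a) < e].
- by apply: (@filterS _ F _ C) => // y Cy; exists y.
- by apply/nbhs_Cplx2P; exists e.
by exists y; split=> //; exact: he.
Qed.

End SubsetSpace.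

(** * Complex derivatives from quadratic Taylor remainders *)

Section ComplexDerivative.
Variable R : realType.

Lemma norm_Cplx2_le (u : Cplx2 R) : `|u| <= (nrm u)%:C%C.
Proof.
rewrite prod_normE /Order.max; case: ifP => _.
  by rewrite (normCplxE u.2) lecR cabs2_le.
by rewrite (normCplxE u.1) lecR cabs1_le.
Qed.

Lemma derivable_of_taylor (V : normedModType R[i]) (f : Cplx R -> V) (z : Cplx R) (v : V)
  (d c : R) : 0 < d ->
  (forall z', cabs (z' - z) < d ->
    `|f z' - f z - (z' - z) *: v| <= (c * cabs (z' - z) ^+ 2)%:C%C) ->
  is_derive z (1 : Cplx R) f v.
Proof.
move=> d0 hf.
have hc : h^-1 *: (f (h *: (1 : Cplx R) + z) - f z) @[h --> (0 : Cplx R)^'] --> v.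
  apply/cvgrPdist_lt => e e0.
  have := e0; rewrite ltcE /= => /andP[/eqP ei er].
  have c0 : 0 < `|c| + 1 by rewrite ltr_wpDl.
  apply/nbhs_CplxP; exists (Num.min d (complex.Re e / (`|c| + 1))).
    by rewrite lt_min d0 divr_gt0.
  move=> h; rewrite subr0 lt_min => /andP[hd he] /= h0.
  have hz : h *: (1 : Cplx R) + z - z = h by rewrite addrK; exact: mulr1.
  have := hf (h *: (1 : Cplx R) + z); rewrite hz => /(_ hd) H.
  have -> : v - h^-1 *: (f (h *: (1 : Cplx R) + z) - f z) =
      - (h^-1 *: (f (h *: (1 : Cplx R) + z) - f z - h *: v)).
    have hk : (h : R[i])^-1 *: ((h : R[i]) *: v) = v.
      by rewrite scalerA mulVf ?scale1r.
    by rewrite [in RHS]scalerBr hk opprB.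
  rewrite normrN normrZ.
  have hp : 0 < cabs h by rewrite cabs_gt0.
  apply: (@le_lt_trans _ _ ((cabs h)^-1 * (c * cabs h ^+ 2))%:C%C).
    have hv : `|(h : R[i])^-1| = ((cabs h)^-1)%:C%C by rewrite -cabsV//; exact: normCplxE.
    rewrite [X in _ <= X]rmorphM; apply: ler_pM => //.
    by move: hv => /= ->.
  rewrite ltcE /= ei eqxx /=.
  have -> : (cabs h)^-1 * (c * cabs h ^+ 2) = c * cabs h.
    by field; rewrite gt_eqF.
  move: he; rewrite ltr_pdivlMr//; apply: le_lt_trans.
  by rewrite mulrC ler_wpM2l ?cabs_ge0// (le_trans (ler_norm c))// lerDl.
split; first by apply/cvg_ex; exists v.
exact: (cvg_lim (@norm_hausdorff _ _) hc).
Qed.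

Lemma differentiable_of_derive (V : normedModType R[i]) (f : Cplx R -> V) z v :
  is_derive z (1 : Cplx R) f v -> differentiable f z /\ forall h, 'd f z h = h *: v.
Proof.
move=> [df dfE]; have h : differentiable f z by apply/derivable1_diffP.
split=> // t; rewrite diff1E// derive1E; congr (_ *: _); exact: dfE.
Qed.

End ComplexDerivative.

(** * The Riemann surface structure on a component of the zero set *)

Section ZeroSurface.
Variables (R : realType) (B : set (Cplx2 R)) (J : jet R) (p0 : Cplx2 R).

Definition zset := [set p : Cplx2 R | B p /\ j0 J p = 0].
Definition zcomp := connected_component zset p0.

Definition locally_jbounded := forall p, B p -> exists s c, [/\ 0 < s,
  (forall q, nrm (q - p) < s -> B q) & jbound J [set q | nrm (q - p) < s] c].
Definition regular_zeros := forall p, B p -> j0 J p = 0 -> jz J p != 0 \/ jw J p != 0.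

Hypothesis hJ : locally_jbounded.
Hypothesis reg : regular_zeros.
Hypothesis zp0 : zset p0.

Record graph_data := GraphData {
  gd_b : bool; gd_rho : R; gd_r : R; gd_c : R; gd_g : Cplx R -> Cplx R }.

Definition graph_data_at (p : Cplx2 R) (d : graph_data) : Prop :=
  local_graph J p (gd_b d) (gd_rho d) (gd_r d) (gd_c d) (gd_g d) /\
  forall z w, cabs (z - prj (gd_b d) p) < gd_rho d ->
    cabs (w - prj (~~ gd_b d) p) < gd_r d -> B (mk (gd_b d) z w).

Lemma graph_data_ex p : zset p -> exists d, graph_data_at p d.
Proof.
move=> [Bp Jp]; have [s [c [s0 sB hc]]] := hJ Bp.
have [b hb] : exists b, coef (~~ b) J p != 0.
  by have [h|h] := reg Bp Jp; [exists false|exists true].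
have s2 : 0 < s / 2 by rewrite divr_gt0.
have [rho [r [c' [g [hrho [hr lg]]]]]] := implicit_graph s0 s2 hc Jp hb.
exists (GraphData b rho r c' g); split=> //= z w hz hw; apply: sB.
rewrite -[p](mk_prj b) mkB; apply: le_lt_trans (nrm_mk _ _ _) _; lra.
Qed.

Lemma zcomp_zset p : zcomp p -> zset p.
Proof. exact: connected_component_sub. Qed.

Lemma zcomp_p0 : zcomp p0.
Proof. exact: connected_component_refl. Qed.

Lemma zcomp_connected : connected zcomp.
Proof. exact: component_connected. Qed.

(** The piece of the graph over the segment from the centre to [z] is a connected subset of the zero
    set through [p]. *)
Lemma zcomp_graph_at p d z : zset p -> graph_data_at p d ->
  cabs (z - prj (gd_b d) p) < gd_rho d ->
  connected_component zset p (mk (gd_b d) z (gd_g d z)).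
Proof.
move=> zP [lg gB]; move: lg gB; case: d => b rho r c g /= lg gB hz.
set z0 := prj b p in lg gB hz *.
have bz (t : R) : t \in `[0, 1]%R -> cabs (z0 + t%:C%C * (z - z0) - z0) < rho.
  rewrite in_itv /= => /andP[t0 t1]; rewrite addrC addKr cabsM cabs_real ger0_norm//.
  by apply: le_lt_trans hz; rewrite ler_piMl// cabs_ge0.
pose f (t : R) := mk b (z0 + t%:C%C * (z - z0)) (g (z0 + t%:C%C * (z - z0))).
have gz0 : g z0 = prj (~~ b) p.
  apply/esym/(lg_zero lg); rewrite ?subrr ?cabs0 ?(lg_rho lg) ?(lg_r lg)//.
  by rewrite mk_prj; have [] := zP.
have cf : {within `[0, 1]%classic, continuous f}.
  apply/subspace_continuousP => t t01.
  move=> A /nbhs_Cplx2P[e e0 he].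
  have L0 : 0 < (1 + c) * (cabs (z - z0) + 1).
    by have c0 := lg_c lg; have d0 := cabs_ge0 (z - z0); apply: mulr_gt0; lra.
  change (nbhs t (fun u => `[0, 1]%classic u -> A (f u))).
  apply: (proj2 (nbhs_normP t _)).
  exists (e / ((1 + c) * (cabs (z - z0) + 1))); first by rewrite /= divr_gt0.
  move=> u /=; rewrite distrC => hut u01.
  apply: he; rewrite /f mkB; apply: le_lt_trans (nrm_mk _ _ _) _.
  apply: (@le_lt_trans _ _ ((1 + c) * cabs (z0 + u%:C%C * (z - z0) - (z0 + t%:C%C * (z - z0))))).
    by rewrite mulrDl mul1r lerD2l; apply: (lg_lip lg); exact: bz.
  have -> : z0 + u%:C%C * (z - z0) - (z0 + t%:C%C * (z - z0)) = (u - t)%:C%C * (z - z0).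
    by rewrite rmorphB; ring.
  rewrite cabsM cabs_real.
  move: hut.
  rewrite ltr_pdivlMr//; apply: le_lt_trans.
  have c0 := lg_c lg; rewrite mulrCA ler_wpM2l// ler_wpM2l ?addr_ge0// lerDl//.
pose V := f @` `[0, 1]%classic.
have cV : connected V.
  apply: connected_continuous_connected => //; exact: segment_connected.
apply: (@connected_component_max _ zset V p) => //.
- exists 0; first by rewrite /= in_itv /= lexx ler01.
  by rewrite /f mul0r addr0 gz0 mk_prj.
- move=> _ [t t01 <-]; have ht := bz t t01; split.
    by apply: gB => //; exact: (lg_in lg).
  by apply/(lg_zero lg) => //; exact: (lg_in lg).
- exists 1; first by rewrite /= in_itv /= lexx ler01.
  by rewrite /f mul1r addrC subrK.
Qed.

Lemma zcomp_graph p d z : zcomp p -> graph_data_at p d ->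
  cabs (z - prj (gd_b d) p) < gd_rho d -> zcomp (mk (gd_b d) z (gd_g d z)).
Proof.
move=> cp hd hz; have := zcomp_graph_at (zcomp_zset cp) hd hz.
by rewrite /zcomp (same_connected_component cp).
Qed.

Local Notation M := (set_type zcomp).
Implicit Types x y : M.

Definition zdata x : graph_data := projT1 (cid (graph_data_ex (zcomp_zset (set_valP x)))).

Lemma zdataP x : graph_data_at (val x) (zdata x).
Proof. exact: projT2 (cid (graph_data_ex (zcomp_zset (set_valP x)))). Qed.

(* [p0] is a junk value off [zcomp]. *)
Definition to_zcomp (p : Cplx2 R) : M :=
  match pselect (zcomp p) with
  | left h => exist _ p (mem_set h)
  | right _ => exist _ p0 (mem_set zcomp_p0)
  end.

Lemma to_zcompK p : zcomp p -> val (to_zcomp p) = p.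
Proof. by rewrite /to_zcomp; case: pselect. Qed.

Lemma val_to_zcomp x : to_zcomp (val x) = x.
Proof. by apply: val_inj; rewrite to_zcompK//; exact: set_valP. Qed.

Definition zb x := gd_b (zdata x).
Definition zrho x := gd_rho (zdata x).
Definition zgraph x z : Cplx2 R := mk (zb x) z (gd_g (zdata x) z).
Definition zslope x z : Cplx R := graph_slope (zb x) J (gd_g (zdata x)) z.
Definition zdisc x : set (Cplx R) := [set z | cabs (z - prj (zb x) (val x)) < zrho x].

(** The domain is the trace of the bidisc of the graph. The bound on the second coordinate excludes
    other sheets of the surface over the same disc, on which the projection would take the same
    values. *)
Definition zchart x : chart R M := Chart
  [set y : M | zdisc x (prj (zb x) (val y)) /\
    cabs (prj (~~ zb x) (val y) - prj (~~ zb x) (val x)) < gd_r (zdata x)]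
  (fun y => prj (zb x) (val y)) (fun z => to_zcomp (zgraph x z)).

Lemma zrho_gt0 x : 0 < zrho x.
Proof. exact: lg_rho (zdataP x).1. Qed.

Lemma zc_ge0 x : 0 <= gd_c (zdata x).
Proof. exact: lg_c (zdataP x).1. Qed.

Lemma zdisc_center x : zdisc x (prj (zb x) (val x)).
Proof. by rewrite /zdisc /= subrr cabs0 zrho_gt0. Qed.

Lemma zgraph_zcomp x z : zdisc x z -> zcomp (zgraph x z).
Proof. by apply: zcomp_graph (zdataP x); exact: set_valP. Qed.

Lemma zgraphK x y : chart_dom (zchart x) y -> zgraph x (prj (zb x) (val y)) = val y.
Proof.
move=> [h1 h2]; have [lg _] := zdataP x.
have [h _] := lg_zero lg h1 h2; rewrite /zgraph -h ?mk_prj//.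
by have [_] := zcomp_zset (set_valP y).
Qed.

Lemma val_zchart_inv x z : zdisc x z -> val (chart_inv (zchart x) z) = zgraph x z.
Proof. by move=> hz; rewrite /= to_zcompK//; exact: zgraph_zcomp. Qed.

Lemma zchart_inv_dom x z : zdisc x z -> chart_dom (zchart x) (chart_inv (zchart x) z).
Proof.
move=> hz; rewrite /chart_dom [zchart x]/zchart; have e := val_zchart_inv hz.
rewrite /= in e; rewrite /= e /zgraph prj_mk prjN_mk; split=> //.
exact: (lg_in (zdataP x).1).
Qed.

Lemma zchart_img x : chart_img (zchart x) = zdisc x.
Proof.
apply/seteqP; split=> z; first by move=> [y [hy _] <-].
move=> hz; exists (chart_inv (zchart x) z); first exact: zchart_inv_dom.
have e := val_zchart_inv hz; rewrite /= in e.
by rewrite /= e /zgraph prj_mk.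
Qed.

Lemma zdisc_open x z : zdisc x z ->
  exists2 d, 0 < d & forall z', cabs (z' - z) < d -> zdisc x z'.
Proof.
move=> hz; exists (zrho x - cabs (z - prj (zb x) (val x))); first by rewrite subr_gt0.
move=> z'; rewrite ltrBrDr /zdisc /=; apply: le_lt_trans.
have -> : z' - prj (zb x) (val x) = (z' - z) + (z - prj (zb x) (val x)) by ring.
exact: cabsD.
Qed.

Lemma zgraph_lip x z z' : zdisc x z -> zdisc x z' ->
  nrm (zgraph x z' - zgraph x z) <= (1 + gd_c (zdata x)) * cabs (z' - z).
Proof.
move=> hz hz'; rewrite mkB; apply: le_trans (nrm_mk _ _ _) _.
by rewrite mulrDl mul1r lerD2l; exact: (lg_lip (zdataP x).1).
Qed.

Lemma zgraph_taylor x z z' : zdisc x z -> zdisc x z' ->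
  nrm (zgraph x z' - zgraph x z - mk (zb x) (z' - z) (zslope x z * (z' - z)))
  <= gd_c (zdata x) * cabs (z' - z) ^+ 2.
Proof.
move=> hz hz'; rewrite !mkB subrr; apply: le_trans (nrm_mk _ _ _) _.
by rewrite cabs0 add0r; exact: (lg_taylor (zdataP x).1).
Qed.

Lemma zchart_is_chart x : is_chart (zchart x).
Proof.
split.
- apply/open_subP => y [h1 h2].
  have [d d0 hd] := zdisc_open h1.
  exists (Num.min d (gd_r (zdata x) - cabs (prj (~~ zb x) (val y) - prj (~~ zb x) (val x)))).
    by rewrite lt_min d0 subr_gt0.
  move=> y'; rewrite lt_min => /andP[a b]; split.
    by apply: hd; apply: le_lt_trans a; rewrite -prjB; exact: cabs_prj.
  move: b; rewrite ltrBrDr; apply: le_lt_trans.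
  have -> : prj (~~ zb x) (val y') - prj (~~ zb x) (val x) =
    (prj (~~ zb x) (val y') - prj (~~ zb x) (val y)) +
    (prj (~~ zb x) (val y) - prj (~~ zb x) (val x)) by ring.
  by apply: cabs_leD => //; rewrite -prjB; exact: cabs_prj.
- rewrite zchart_img openE => z hz; have [d d0 hd] := zdisc_open hz.
  by apply/nbhs_CplxP; exists d.
- by move=> y hy; rewrite /= zgraphK// val_to_zcomp.
- apply: continuous_subspaceT => y A /nbhs_CplxP[e e0 he].
  apply/nbhs_subP; exists e => // y' hy'; apply: he => /=.
  by apply: le_lt_trans hy'; rewrite -prjB; exact: cabs_prj.
- rewrite zchart_img; apply: continuous_in_subspaceT => z; rewrite inE => hz.
  move=> A /nbhs_subP[e e0 he]; have [d d0 hd] := zdisc_open hz.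
  have c0 := zc_ge0 x; have c1 : 0 < 1 + gd_c (zdata x) by lra.
  apply/nbhs_CplxP; exists (Num.min d (e / (1 + gd_c (zdata x)))).
    by rewrite lt_min d0 divr_gt0.
  move=> z'; rewrite lt_min => /andP[/hd hz' h]; apply: he.
  have := val_zchart_inv hz; have := val_zchart_inv hz'; rewrite /= => -> ->.
  apply: le_lt_trans (zgraph_lip hz hz') _.
  by move: h; rewrite ltr_pdivlMr// mulrC.
Qed.

Lemma zlocal_derive x z : zdisc x z ->
  is_derive z (1 : Cplx R) (fun z => val (chart_inv (zchart x) z) : Cplx2 R)
    (mk (zb x) 1 (zslope x z)).
Proof.
move=> hz; have [d d0 hd] := zdisc_open hz.
apply: (@derivable_of_taylor _ _ _ _ _ d (gd_c (zdata x)) d0) => z' /hd hz'.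
have := val_zchart_inv hz; have := val_zchart_inv hz'; rewrite /= => -> ->.
apply: le_trans (norm_Cplx2_le _) _; rewrite lecR.
apply: le_trans (zgraph_taylor hz hz'); rewrite le_eqVlt; apply/orP; left.
apply/eqP; congr (nrm (_ - _)); rewrite [zslope x z * _]mulrC /mk.
by case: (zb x); congr pair; exact: mulr1.
Qed.

Lemma zprj_derive x b z : zdisc x z ->
  is_derive z (1 : Cplx R) (fun z => prj b (val (chart_inv (zchart x) z)) : Cplx R)
    (prj b (mk (zb x) 1 (zslope x z))).
Proof.
move=> hz; have [d d0 hd] := zdisc_open hz.
apply: (@derivable_of_taylor _ _ _ _ _ d (gd_c (zdata x)) d0) => z' /hd hz'.
have := val_zchart_inv hz; have := val_zchart_inv hz'; rewrite /= => -> ->.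
rewrite (normCplxE (_ : Cplx R)) lecR.
apply: le_trans (zgraph_taylor hz hz'); apply: le_trans (cabs_prj b _).
rewrite le_eqVlt; apply/orP; left; apply/eqP; congr cabs.
rewrite !prjB; congr (_ - _); rewrite [zslope x z * _]mulrC.
by case: b; rewrite /mk; case: (zb x) => //=; exact: mulr1.
Qed.

(** A transition map is a coordinate projection of an inverse chart, and this is differentiable on
    the whole disc. *)
Lemma ztransition x y z :
  (chart_map (zchart x) @` (chart_dom (zchart x) `&` chart_dom (zchart y))) z ->
  differentiable (chart_map (zchart y) \o chart_inv (zchart x)) z.
Proof.
move=> [u [hu _] uz].
have hz : zdisc x z by rewrite -uz; case: hu.
exact: (differentiable_of_derive (zprj_derive (zb y) hz)).1.
Qed.

Definition zsurface : riemann_surface R := @RiemannSurface R M zchart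
  (ex_intro _ (to_zcomp p0) I)
  (connected_sub zcomp_connected)
  (@hausdorff_sub R zcomp)
  (@second_countable_sub R zcomp)
  zchart_is_chart
  (fun x => conj (zdisc_center x)
     (eq_ind_r (fun t => t < _) (lg_r (zdataP x).1) (etrans (congr1 (@cabs R) (subrr _)) (@cabs0 R))))
  ztransition.

Definition zincl : zsurface -> Cplx2 R := fun x => val (x : M).

Lemma zincl_derive (x : zsurface) z : zdisc x z ->
  differentiable (local_expr zincl x) z /\
  forall h, 'd (local_expr zincl x) z h = mk (zb x) h (zslope x z * h).
Proof.
move=> hz; have [h1 h2] := differentiable_of_derive (zlocal_derive hz).
split=> // h; rewrite h2 mulrC /mk.
by case: (zb x); congr pair; exact: mulr1.
Qed.

Lemma zincl_tangent (x : zsurface) h :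
  tangent_map zincl x h = mk (zb x) h (zslope x (prj (zb x) (zincl x)) * h).
Proof. exact: (zincl_derive (zdisc_center x)).2. Qed.

Lemma zincl_immersion : holomorphic_immersion zincl.
Proof.
split.
  move=> x z; rewrite [chart_img _]zchart_img => hz; exact: (zincl_derive hz).1.
(* The parameter coordinate of the image of a tangent vector is the vector itself. *)
move=> x u v; rewrite !zincl_tangent => /(congr1 (prj (zb x))).
by rewrite !prj_mk.
Qed.

Lemma zincl_embedding : holomorphic_embedding zincl.
Proof.
split; first exact: zincl_immersion.
split; first exact: val_sub_continuous.
exists to_zcomp; first exact: val_to_zcomp.
have rE : range zincl = zcomp.
  apply/seteqP; split=> p; first by move=> [x _ <-]; exact: set_valP.
  by move=> cp; exists (to_zcomp p) => //; exact: to_zcompK.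
rewrite rE; apply/subspace_continuousP => p cp.
move=> A /nbhs_subP[e e0 he]; rewrite to_zcompK// in he.
apply/nbhs_Cplx2P; exists e => // q hq cq; apply: he.
by rewrite to_zcompK.
Qed.

Lemma zincl_range : range zincl `<=` B.
Proof. by move=> _ [x _ <-]; have [] := zcomp_zset (set_valP x). Qed.

(* Components of [zset] are relatively closed in [B], since the local graphs
   are connected. *)
Lemma zcomp_closed p : B p ->
  (forall e : R, 0 < e -> exists2 q, zcomp q & nrm (q - p) < e) -> zcomp p.
Proof.
move=> Bp h; have [s [c [s0 sB hc]]] := hJ Bp.
have Jp : j0 J p = 0.
  apply: cabs_eq0; apply/eqP; rewrite eq_le cabs_ge0 andbT.
  apply/ler_addgt0Pr => e e0; rewrite add0r.
  have c0 : 0 < `|c| + 1 by rewrite ltr_wpDl.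
  have [|q cq] := h (Num.min s (e / (`|c| + 1))); first by rewrite lt_min s0 divr_gt0.
  rewrite lt_min => /andP[qs]; rewrite ltr_pdivlMr// => qe.
  have := hc 6 p q; rewrite /= subrr nrm0 => /(_ s0 qs).
  have [_ ->] := zcomp_zset cq; rewrite sub0r cabsN => /le_trans; apply.
  apply: le_trans (ltW qe); rewrite mulrC ler_wpM2l ?nrm_ge0//.
  by rewrite (le_trans (ler_norm c))// lerDl.
have zp : zset p by [].
have [d hd] := graph_data_ex zp.
have lg := hd.1.
have [|q cq] := h (Num.min (gd_rho d) (gd_r d)).
  by rewrite lt_min (lg_rho lg) (lg_r lg).
rewrite lt_min => /andP[h1 h2].
have h1' : cabs (prj (gd_b d) q - prj (gd_b d) p) < gd_rho d.
  by apply: le_lt_trans h1; rewrite -prjB; exact: cabs_prj.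
have h2' : cabs (prj (~~ gd_b d) q - prj (~~ gd_b d) p) < gd_r d.
  by apply: le_lt_trans h2; rewrite -prjB; exact: cabs_prj.
have qE : mk (gd_b d) (prj (gd_b d) q) (gd_g d (prj (gd_b d) q)) = q.
  have [k _] := lg_zero lg h1' h2'; rewrite -k ?mk_prj//.
  by have [] := zcomp_zset cq.
have cpq : connected_component zset p q.
  have := @zcomp_graph_at p d (prj (gd_b d) q) zp hd h1'; rewrite qE; exact.
rewrite /zcomp (same_connected_component cq).
exact: connected_component_sym.
Qed.

(** A limit of points of the component lying in [K] is again in [K], hence in [B], where the
    component is closed. So its trace on [K] is closed and bounded. *)
Lemma zincl_proper : proper_into zincl B.
Proof.
move=> K KB cK; apply: compact_sub.
have [r hr] := compact_bounded cK; have clK := Cplx2_compact_closed cK.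
apply: (@closed_bounded_compact _ _ r); last by move=> p [y Ky <-]; exact: hr.
apply/Cplx2_closedP => p hp.
have Kp : K p.
  apply: (proj1 (Cplx2_closedP K) clK) => e /hp[_ [y Ky <-] he].
  by exists (val y).
have cp : zcomp p.
  apply: zcomp_closed => [|e /hp[_ [y Ky <-] he]]; first exact: KB.
  by exists (val y) => //; exact: set_valP.
by exists (to_zcomp p); rewrite /= ?/zincl to_zcompK.
Qed.

End ZeroSurface.

(** * Completeness *)

Section RealDerivative.
Variable R : realType.
Implicit Types (f : R -> R) (t : R).

Lemma continuous_realP f t : {for t, continuous f} <->
  forall e, 0 < e -> exists2 d, 0 < d & forall s, `|s - t| < d -> `|f s - f t| < e.
Proof.
split=> [/cvgrPdist_lt h e e0|h].
  have /nbhs_normP[d d0 hd] := h e e0.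
  by exists d => // s hs; rewrite distrC; apply: hd; rewrite /= distrC.
apply/cvgrPdist_lt => e e0; have [d d0 hd] := h e e0.
apply: (proj2 (nbhs_normP t _)); exists d => // s /=; rewrite distrC => /hd.
by rewrite distrC.
Qed.

Lemma derivable_linear_approx f t : derivable f t 1 ->
  forall e, 0 < e -> exists2 d, 0 < d &
    forall h, `|h| < d -> `|f (t + h) - f t - h * derive1 f t| <= e * `|h|.
Proof.
move=> df e e0.
have : h^-1 *: (f (h *: (1 : R) + t) - f t) @[h --> (0 : R)^'] --> derive1 f t.
  by rewrite derive1E; exact: df.
move=> /cvgrPdist_lt /(_ e e0) /nbhs_normP [d d0 hd]; exists d => // h hh.
have [->|h0] := eqVneq h 0.
  by rewrite addr0 subrr mul0r subr0 normr0 mulr0.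
have := hd h; rewrite /= sub0r normrN => /(_ hh h0) /ltW.
have -> : h *: (1 : R) + t = t + h by rewrite addrC; congr (_ + _); exact: mulr1.
have -> : f (t + h) - f t - h * derive1 f t =
  - (h * (derive1 f t - h^-1 *: (f (t + h) - f t))).
  by rewrite /GRing.scale /=; field.
by rewrite normrN normrM [e * _]mulrC => hle; rewrite ler_wpM2l.
Qed.

Lemma is_derive_linear_approx f t a :
  (forall e, 0 < e -> exists2 d, 0 < d &
    forall h, `|h| < d -> `|f (t + h) - f t - h * a| <= e * `|h|) ->
  is_derive t (1 : R) f a.
Proof.
move=> H.
have hc : h^-1 *: (f (h *: (1 : R) + t) - f t) @[h --> (0 : R)^'] --> a.
  apply/cvgrPdist_lt => e e0; have [d d0 hd] := H (e / 2) ltac:(by rewrite divr_gt0).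
  suff : nbhs (0 : R) (fun h => h != 0 ->
    `|a - h^-1 *: (f (h *: (1 : R) + t) - f t)| < e) by [].
  apply/nbhs_normP; exists d => // h /=; rewrite sub0r normrN => hh h0.
  have -> : h *: (1 : R) + t = t + h by rewrite addrC; congr (_ + _); exact: mulr1.
  have -> : a - h^-1 *: (f (t + h) - f t) = - (h^-1 * (f (t + h) - f t - h * a)).
    by rewrite /GRing.scale /=; field.
  rewrite normrN normrM normfV mulrC.
  have hp : 0 < `|h| by rewrite normr_gt0.
  rewrite ltr_pdivrMr//; apply: le_lt_trans (hd _ hh) _; rewrite ltr_pM2r//; lra.
split; first by apply/cvg_ex; exists a.
exact: (cvg_lim (@norm_hausdorff _ _) hc).
Qed.

End RealDerivative.

(** * Velocities and lengths of curves in the plane *)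

Section Curves.
Variable R : realType.
Implicit Types (s V : R -> Cplx2 R) (t : R) (p q : Cplx2 R).

Definition has_velocity s t (v : Cplx2 R) := forall e : R, 0 < e ->
  exists2 d, 0 < d & forall h, `|h| < d -> nrm (s (t + h) - s t - rscale h v) <= e * `|h|.

Definition curve_continuous s := forall t (e : R), 0 < e ->
  exists2 d, 0 < d & forall u, `|u - t| < d -> nrm (s u - s t) < e.

Lemma velocity_uniq s t v v' : has_velocity s t v -> has_velocity s t v' -> v = v'.
Proof.
move=> hv hv'; apply/eqP; rewrite -subr_eq0; apply/eqP/nrm_eq0/eqP.
rewrite eq_le nrm_ge0 andbT; apply/ler_addgt0Pr => e e0; rewrite add0r.
have e2 : 0 < e / 2 by rewrite divr_gt0.
have [d d0 hd] := hv _ e2; have [d' d0' hd'] := hv' _ e2.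
pose h := Num.min d d' / 2.
have m0 : 0 < Num.min d d' by rewrite lt_min d0.
have h0 : 0 < h by rewrite divr_gt0.
have hm : h < Num.min d d' by rewrite /h; lra.
move: hm; rewrite lt_min -{1}(gtr0_norm h0) -{2}(gtr0_norm h0) => /andP[/hd a /hd' b].
have := nrm_triangle 0 (s (t + h) - s t - rscale h v') (s (t + h) - s t - rscale h v).
rewrite subr0 sub0r nrmN.
have -> : s (t + h) - s t - rscale h v' - (s (t + h) - s t - rscale h v) = rscale h (v - v').
  have -> : rscale h (v - v') = rscale h v - rscale h v'.
    by congr pair => /=; ring.
  by rewrite opprB addrC addrA subrK.
rewrite nrmZ => k; have kk : `|h| * nrm (v - v') <= `|h| * e by lra.
by rewrite ler_pM2l ?normr_gt0 ?gt_eqF in kk.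
Qed.

(** The interval leaves room around [[0, 1]], so that two-sided derivatives are available at its
    endpoints. *)
Lemma antiderivative (f : R -> R) : continuous f ->
  exists F : R -> R, forall x : R, -2 < x < 3 -> is_derive x (1 : R) F (f x).
Proof.
move=> cf; pose F x := (\int[lebesgue_measure]_(t in `[(-2 : R), x]) f t)%R.
exists F => x /andP[x2 x3].
have : (lebesgue_measure).-integrable `[(-2 : R), 3] (EFin \o f).
  by apply: continuous_compact_integrable; [exact: segment_compact|exact: continuous_subspaceT].
move=> /(@continuous_FTC1_closed R f (-2) x 3 x3) /= /(_ x2 (cf x)) [h1 h2].
by split; [exact: h1|rewrite -derive1E; exact: h2].
Qed.

(** [F] is a primitive of the speed. For [e = s b - s a] the function [nrm e * F - dot s e] is
    nondecreasing by Cauchy-Schwarz; comparing its values at [a] and [b] bounds the chord without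
    integrating vectors. *)
Lemma curve_bound s V : (forall t, has_velocity s t (V t)) -> curve_continuous V ->
  exists F : R -> R,
  [/\ forall a b, 0 <= a -> a <= b -> b <= 1 -> nrm (s b - s a) <= F b - F a,
      (\int[lebesgue_measure]_(t in `[0%R, 1%R]) (nrm (V t))%:E = (F 1 - F 0)%:E)%E &
      forall K : R, (forall t, 0 <= t <= 1 -> nrm (V t) <= K) -> F 1 - F 0 <= K].
Proof.
move=> hs cV.
have cn : continuous (fun t => nrm (V t)).
  move=> t; apply/continuous_realP => e e0; have [d d0 hd] := cV t e e0.
  by exists d => // u /hd; apply: le_lt_trans; exact: nrm_lipschitz.
have [F hF] := antiderivative cn; exists F.
have F_cont x : -2 < x < 3 -> {for x, continuous F}.
  move=> /hF[dF _]; apply: differentiable_continuous; exact/derivable1_diffP.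
have mono (phi : R -> R) (dphi : R -> R) (K : R) :
    (forall t, is_derive t (1 : R) phi (dphi t)) ->
    forall a b, 0 <= a -> a <= b -> b <= 1 ->
    (forall t, 0 <= t <= 1 -> dphi t <= K * nrm (V t)) -> phi b - phi a <= K * (F b - F a).
  move=> hphi a b a0 ab b1 hle.
  pose G t := K * F t - phi t.
  have hG t : -2 < t < 3 -> is_derive t (1 : R) G (K * nrm (V t) - dphi t).
    by move=> /hF h; have h' := hphi t; apply: is_deriveB; exact: is_deriveZ.
  have sub t : t \in `]a, b[%R -> -2 < t < 3 /\ 0 <= t <= 1.
    by rewrite in_itv /= => /andP[]; split; lra.
  have := @ger0_derive1_ndecr R G a b.
  have h1 x : x \in `]a, b[%R -> derivable G x 1.
    by move=> /sub[/hG[]].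
  have h2 x : x \in `]a, b[%R -> 0 <= derive1 G x.
    move=> /sub[/hG[_ hx] /hle hx']; rewrite derive1E hx; lra.
  have h3 : {within `[a, b], continuous G}.
    apply: continuous_in_subspaceT => x; rewrite inE /= in_itv /= => /andP[xa xb].
    have /hG[dG _] : -2 < x < 3 by lra.
    apply: differentiable_continuous; exact/derivable1_diffP.
  move=> /(_ h1 h2 h3 a b (lexx _) ab (lexx _)); rewrite /G; lra.
have hdot (e : Cplx2 R) t : is_derive t (1 : R) (fun x => euclidean_metric (s x) e)
    (euclidean_metric (V t) e).
  apply: is_derive_linear_approx => eps eps0.
  have n0 : 0 < nrm e + 1 by rewrite ltr_wpDl// nrm_ge0.
  have [d d0 hd] := hs t (eps / (nrm e + 1)) (divr_gt0 eps0 n0).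
  exists d => // h hh; rewrite -dotZl -!dotBl.
  set u := _ - rscale h (V t).
  have : `|euclidean_metric u e| <= nrm u * nrm e.
    by rewrite ler_norml dot_le dot_ge.
  move=> /le_trans; apply; apply: (@le_trans _ _ (nrm u * (nrm e + 1))).
    by rewrite ler_wpM2l ?nrm_ge0// lerDl.
  by rewrite -ler_pdivlMr// mulrAC; exact: hd.
split.
- move=> a b a0 ab b1; set e := s b - s a.
  have [->|e0] := eqVneq e 0.
    rewrite nrm0.
    have := mono (fun x => euclidean_metric (s x) 0) _ 1 (hdot 0) a b a0 ab b1.
    rewrite !(dotC _ 0) !dot0l subrr mul1r; apply => t _.
    by rewrite dotC dot0l mul1r nrm_ge0.
  have ep : 0 < nrm e by rewrite nrm_gt0.
  have := mono (fun x => euclidean_metric (s x) e) _ (nrm e) (hdot e) a b a0 ab b1.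
  rewrite -dotBl -/e -nrm_sqr expr2 ler_pM2l//; apply => t _.
  by rewrite mulrC; exact: dot_le.
- rewrite (@continuous_FTC2 R _ F 0 1 ltr01)//.
  + exact: continuous_subspaceT.
  + split.
    * by move=> x; rewrite in_itv /= => /andP[x0 x1]; have /hF[] : -2 < x < 3 by lra.
    * by apply: cvg_at_right_filter; apply: F_cont; lra.
    * by apply: cvg_at_left_filter; apply: F_cont; lra.
  + move=> x; rewrite in_itv /= => /andP[x0 x1]; rewrite derive1E.
    by have /hF[_ ->] : -2 < x < 3 by lra.
- move=> K hK; have K0 : 0 <= K by apply: le_trans (hK 0 _); rewrite ?nrm_ge0// lexx ler01.
  have [dG] : exists2 G : R -> R, (forall t, -2 < t < 3 -> is_derive t (1 : R) G (K - nrm (V t))) &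
      G = (fun t => K * t - F t).
    exists (fun t => K * t - F t) => // t /hF h; apply: is_deriveB.
    by have := is_deriveZ K (is_derive_id t (1 : R)); rewrite /GRing.scale /= mulr1.
  move=> hG GE.
  have h1 x : x \in `]0, 1[%R -> derivable dG x 1.
    by rewrite in_itv /= => /andP[x0 x1]; have /hG[] : -2 < x < 3 by lra.
  have h2 x : x \in `]0, 1[%R -> 0 <= derive1 dG x.
    rewrite in_itv /= => /andP[x0 x1]; rewrite derive1E.
    have /hG[_ ->] : -2 < x < 3 by lra.
    by rewrite subr_ge0 hK//; lra.
  have h3 : {within `[0, 1], continuous dG}.
    apply: continuous_in_subspaceT => x; rewrite inE /= in_itv /= => /andP[xa xb].
    have /hG[dG' _] : -2 < x < 3 by lra.
    apply: differentiable_continuous; exact/derivable1_diffP.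
  have := ger0_derive1_ndecr h1 h2 h3 (lexx _) ler01 (lexx _).
  rewrite GE; lra.
Qed.

(** The increments of [l] dominate the chords, so [L] bounds the length from above.
    Differentiability is not asked for: corners of piecewise curves do no harm, and length estimates
    only ever compare chords. *)
Definition rect_curve (A : set (Cplx2 R)) p q (L : R) := exists n s l,
  [/\ 0 <= n, s 0 = p, s n = q, l n - l 0 = L & curve_continuous s] /\
  (forall a b, 0 <= a -> a <= b -> b <= n -> nrm (s b - s a) <= l b - l a) /\
  (forall t, 0 <= t <= n -> A (s t)).

Lemma rect_curve_const (A : set (Cplx2 R)) p : A p -> rect_curve A p p 0.
Proof.
move=> Ap; exists 0, (fun=> p), (fun=> 0); split; [split=> //; first by rewrite subrr|split=> //].
  by move=> t e e0; exists 1 => // u _; rewrite subrr nrm0.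
by move=> a b _ _ _; rewrite !subrr nrm0.
Qed.

Lemma rect_curve_cons (A : set (Cplx2 R)) (g : R -> Cplx2 R) (F : R -> R) q L :
  curve_continuous g -> (forall t, A (g t)) ->
  (forall a b, 0 <= a -> a <= b -> b <= 1 -> nrm (g b - g a) <= F b - F a) ->
  rect_curve A (g 1) q L -> rect_curve A (g 0) q (F 1 - F 0 + L).
Proof.
move=> cg Ag hg [n [s [l [[n0 s0 sn ln cs] [hl As]]]]].
exists (1 + n), (fun t => if t <= 1 then g t else s (t - 1)),
  (fun t => if t <= 1 then F t else F 1 + (l (t - 1) - l 0)).
split; first split.
- lra.
- by rewrite ler01.
- case: ifP => h; last by rewrite addrAC subrr add0r.
  have nn : n = 0 by lra.
  by rewrite -sn nn addr0 s0.
- have e1 : 1 + n - 1 = n by ring.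
  rewrite ler01; case: ifP => h; last by rewrite e1 -ln; ring.
  have nn : n = 0 by lra.
  by move: ln; rewrite nn subrr addr0 => <-; rewrite addr0.
- move=> t e e0; have [t1|t1|t1] := ltrgtP t 1.
  + have [d d0 hd] := cg t e e0; exists (Num.min d (1 - t)).
      by rewrite lt_min d0 subr_gt0.
    move=> u; rewrite lt_min => /andP[/hd hu]; rewrite ltr_norml => /andP[_ u1].
    by have -> : u <= 1 by lra.
  + have [d d0 hd] := cs (t - 1) e e0; exists (Num.min d (t - 1)).
      by rewrite lt_min d0 subr_gt0.
    move=> u; rewrite lt_min => /andP[hu]; rewrite ltr_norml => /andP[u1 _].
    have -> : (u <= 1) = false by apply/negbTE; rewrite -ltNge; lra.
    by apply: hd; rewrite (_ : u - 1 - (t - 1) = u - t)//; ring.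
  + subst t; have [d d0 hd] := cg 1 e e0; have [d' d0' hd'] := cs 0 e e0.
    exists (Num.min d d'); first by rewrite lt_min d0.
    move=> u; rewrite lt_min => /andP[/hd h1 h2]; case: ifP => // _.
    by rewrite -s0; apply: hd'; rewrite subr0.
split; last first.
  by move=> t /andP[t0 tn]; case: ifP => t1 //; apply: As; lra.
move=> a b a0 ab bn; case: ifP => b1; case: ifP => a1.
- exact: hg.
- by have := le_trans ab b1; rewrite a1.
- apply: le_trans (nrm_triangle (g 1) _ _) _; rewrite addrC.
  have h1 := hg a 1 a0 a1 (lexx _).
  have h2 := hl 0 (b - 1) (lexx _); rewrite s0 nrmBC in h2.
  have := nrmBC (g 1) (s (b - 1)).
  have : 0 <= b - 1 by move: b1; move/negbT; rewrite -ltNge; lra.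
  by move=> /h2 /(_ ltac:(lra)); rewrite [nrm (g 1 - _)]nrmBC; lra.
- have := hl (a - 1) (b - 1); move: a1 b1 => /negbT; rewrite -ltNge => a1 /negbT; rewrite -ltNge => b1.
  move=> /(_ ltac:(lra) ltac:(lra) ltac:(lra)); lra.
Qed.

End Curves.

Section RiemannianDistance.
Variables (R : realType) (M : riemann_surface R) (g : M -> Cplx R -> Cplx R -> R).

Lemma piecewise_C1_path_trans p q r l l' : piecewise_C1_path g p q l ->
  piecewise_C1_path g q r l' -> piecewise_C1_path g p r (l + l')%E.
Proof.
elim=> [p1 h|gam q1 l1 cg h1 ih h]; first by rewrite add0e.
by rewrite -addeA; apply: path_cons => //; exact: ih.
Qed.

Lemma riemannian_dist_lt_trans q p r (a b : R) :
  (riemannian_dist g p q < a%:E)%E -> (riemannian_dist g q r < b%:E)%E ->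
  (riemannian_dist g p r < (a + b)%:E)%E.
Proof.
move=> /ereal_inf_lt[l1 /= h1 l1a] /ereal_inf_lt[l2 /= h2 l2b].
have h := piecewise_C1_path_trans h1 h2.
apply: (@le_lt_trans _ _ (l1 + l2)%E); first exact: ereal_inf_lbound.
by rewrite EFinD lteD.
Qed.

End RiemannianDistance.

(** * Completeness of the pull-back metric *)

Section Complete.
Variables (R : realType) (B : set (Cplx2 R)) (J : jet R) (p0 : Cplx2 R).
Hypothesis hJ : locally_jbounded B J.
Hypothesis reg : regular_zeros B J.
Hypothesis zp0 : zset B J p0.

Local Notation M := (zsurface hJ reg zp0).
Local Notation Y := (@zincl R B J p0 hJ reg zp0).
Local Notation zdisc := (zdisc hJ reg).
Local Notation zgraph := (zgraph hJ reg).
Local Notation zslope := (zslope hJ reg).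
Local Notation zb := (zb hJ reg).
Local Notation zchart := (zchart hJ reg zp0).

(** The chain rule. The error is the Taylor remainder of the graph, quadratic in the increment of
    [c], plus the tangent map applied to the linearization error of [c]; each is allotted half of
    [e * |h|]. *)
Lemma has_velocity_zgraph (x : M) (c : R -> Cplx R) (t : R) (cd : Cplx R) :
  (exists2 d, 0 < d & forall h, `|h| < d -> zdisc x (c (t + h))) ->
  (forall e, 0 < e -> exists2 d, 0 < d &
    forall h, `|h| < d -> cabs (c (t + h) - c t - h%:C%C * cd) <= e * `|h|) ->
  has_velocity (fun u => zgraph x (c u)) t (mk (zb x) cd (zslope x (c t) * cd)).
Proof.
move=> [d d0 hd] hc e e0.
set k := gd_c (zdata hJ reg x); have k0 : 0 <= k := zc_ge0 hJ reg x.
have hct : zdisc x (c t) by rewrite -[t]addr0; apply: hd; rewrite normr0.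
have sk : cabs (zslope x (c t)) <= k.
  exact: (lg_slope (zdataP hJ reg x).1).
pose m := cabs cd + 1; have m0 : 0 < m by rewrite ltr_wpDl// cabs_ge0.
pose e1 := Num.min 1 (e / (2 * (1 + k))).
have k1 : 0 < 1 + k by lra.
have e10 : 0 < e1 by rewrite lt_min ltr01 divr_gt0// mulr_gt0.
have [d1 d10 hd1] := hc e1 e10.
pose d2 := e / (2 * (k + 1) * m ^+ 2).
have d20 : 0 < d2 by rewrite divr_gt0// !mulr_gt0 ?exprn_gt0//; lra.
exists (Num.min (Num.min d d1) d2); first by rewrite !lt_min d0 d10.
move=> h; rewrite !lt_min => /andP[/andP[/hd hz /hd1 hl] h2].
have h0 := normr_ge0 h.
have hdc : cabs (c (t + h) - c t) <= m * `|h|.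
  have -> : c (t + h) - c t = (c (t + h) - c t - h%:C%C * cd) + h%:C%C * cd by ring.
  apply: le_trans (cabs_leD hl (lexx _)) _; rewrite cabsM cabs_real.
  have : e1 <= 1 by rewrite ge_min lexx.
  rewrite /m; nra.
set dl := c (t + h) - c t in hl hdc.
have -> : zgraph x (c (t + h)) - zgraph x (c t) - rscale h (mk (zb x) cd (zslope x (c t) * cd)) =
  (zgraph x (c (t + h)) - zgraph x (c t) - mk (zb x) dl (zslope x (c t) * dl)) +
  mk (zb x) (dl - h%:C%C * cd) (zslope x (c t) * (dl - h%:C%C * cd)).
  have -> : rscale h (mk (zb x) cd (zslope x (c t) * cd)) =
     mk (zb x) dl (zslope x (c t) * dl) -
     mk (zb x) (dl - h%:C%C * cd) (zslope x (c t) * (dl - h%:C%C * cd)).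
    rewrite mkB /rscale /mk.
    by case: (zb x); congr pair; rewrite /=; ring.
  by rewrite opprB addrA addrAC.
apply: le_trans (nrmD _ _) _.
have t1 := zgraph_taylor hct hz; rewrite -/dl -/k in t1.
have t2 : nrm (mk (zb x) (dl - h%:C%C * cd) (zslope x (c t) * (dl - h%:C%C * cd))) <=
    (1 + k) * (e1 * `|h|).
  apply: le_trans (nrm_mk _ _ _) _; rewrite mulrDl mul1r; apply: lerD => //.
  exact: cabs_leM.
apply: le_trans (lerD t1 t2) _.
have u1 : (1 + k) * (e1 * `|h|) <= e / 2 * `|h|.
  rewrite mulrA ler_wpM2r//.
  have : e1 <= e / (2 * (1 + k)) by rewrite ge_min lexx orbT.
  rewrite ler_pdivlMr ?mulr_gt0//; lra.
have u2 : k * cabs dl ^+ 2 <= e / 2 * `|h|.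
  apply: (@le_trans _ _ (k * (m * `|h|) ^+ 2)).
    by rewrite ler_wpM2l// lerXn2r ?nnegrE ?cabs_ge0// mulr_ge0// ltW.
  move: h2; rewrite ltr_pdivlMr ?mulr_gt0 ?exprn_gt0//; last lra.
  move=> /ltW h2.
  have -> : k * (m * `|h|) ^+ 2 = (k * m ^+ 2 * `|h|) * `|h| by ring.
  rewrite ler_wpM2r//.
  have : 0 <= m ^+ 2 * `|h| by rewrite mulr_ge0// exprn_ge0// ltW.
  nra.
lra.
Qed.

Lemma curve_continuous_zgraph (x : M) (c cd : R -> Cplx R) (t : R) :
  (exists2 d, 0 < d & forall u, `|u - t| < d -> zdisc x (c u)) ->
  (forall e, 0 < e -> exists2 d, 0 < d & forall u, `|u - t| < d -> cabs (c u - c t) < e) ->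
  (forall e, 0 < e -> exists2 d, 0 < d & forall u, `|u - t| < d -> cabs (cd u - cd t) < e) ->
  forall e, 0 < e -> exists2 d, 0 < d & forall u, `|u - t| < d ->
    nrm (mk (zb x) (cd u) (zslope x (c u) * cd u) -
         mk (zb x) (cd t) (zslope x (c t) * cd t)) < e.
Proof.
move=> [d d0 hd] hc hcd e e0.
set k := gd_c (zdata hJ reg x); have k0 : 0 <= k := zc_ge0 hJ reg x.
have ht : zdisc x (c t) by apply: hd; rewrite subrr normr0.
have cd0 := cabs_ge0 (cd t).
have [d1 d10 h1] := hcd (e / (2 * (1 + k))) ltac:(by rewrite divr_gt0// mulr_gt0//; lra).
have [d2 d20 h2] := hc (e / (2 * (1 + k) * (1 + cabs (cd t))))
  ltac:(by rewrite divr_gt0// !mulr_gt0//; lra).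
exists (Num.min (Num.min d d1) d2); first by rewrite !lt_min d0 d10.
move=> u; rewrite !lt_min => /andP[/andP[/hd hu /h1]]; rewrite ltr_pdivlMr ?mulr_gt0//; last lra.
move=> a /h2; rewrite ltr_pdivlMr ?mulr_gt0//; try lra; move=> b.
rewrite mkB; apply: le_lt_trans (nrm_mk _ _ _) _.
have -> : zslope x (c u) * cd u - zslope x (c t) * cd t =
  zslope x (c u) * (cd u - cd t) + (zslope x (c u) - zslope x (c t)) * cd t by ring.
have s1 : cabs (zslope x (c u)) <= k by exact: (lg_slope (zdataP hJ reg x).1).
have s2 : cabs (zslope x (c u) - zslope x (c t)) <= k * cabs (c u - c t).
  exact: (lg_slope_lip (zdataP hJ reg x).1).
have s3 := cabs_leD (cabs_leM s1 (lexx (cabs (cd u - cd t)))) (cabs_leM s2 (lexx (cabs (cd t)))).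
apply: le_lt_trans (lerD (lexx _) s3) _.
have a0 := cabs_ge0 (cd u - cd t); have b0 := cabs_ge0 (c u - c t).
have : k * cabs (c u - c t) * cabs (cd t) <= cabs (c u - c t) * (1 + k) * (1 + cabs (cd t)).
  have : 0 <= cabs (c u - c t) * (1 + k + cabs (cd t)) by rewrite mulr_ge0//; lra.
  nra.
lra.
Qed.

Section C1Curve.
Variable gam : R -> M.
Hypothesis cg : C1_curve gam.

Let s (t : R) : Cplx2 R := Y (gam t).
Let V (t : R) : Cplx2 R := tangent_map Y (gam t) (velocity gam t).
Let c (x : M) (t : R) : Cplx R := prj (zb x) (s t).
Let cd (x : M) (t : R) : Cplx R :=
  Complex (derive1 (re_chart gam x) t) (derive1 (im_chart gam x) t).

Let near_dom (x : M) t : chart_dom (zchart x) (gam t) ->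
  exists2 d, 0 < d & forall u, `|u - t| < d -> chart_dom (zchart x) (gam u).
Proof.
move=> hx; have oD : open (chart_dom (zchart x)) by have [] := zchart_is_chart hJ reg zp0 x.
have : nbhs (gam t) (chart_dom (zchart x)) by move: oD; rewrite openE; exact.
move=> /(cg.1 t) /nbhs_normP[d d0 hd]; exists d => // u hu; apply: hd.
by rewrite /= distrC.
Qed.

Lemma C1_curve_continuous : curve_continuous s.
Proof.
move=> t e e0.
have : nbhs (gam t) [set y : M | nrm (Y y - Y (gam t)) < e].
  by apply/nbhs_subP; exists e.
move=> /(cg.1 t) /nbhs_normP[d d0 hd]; exists d => // u hu; apply: hd.
by rewrite /= distrC.
Qed.

Let c_linear x t : chart_dom (zchart x) (gam t) ->
  forall e, 0 < e -> exists2 d, 0 < d &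
    forall h, `|h| < d -> cabs (c x (t + h) - c x t - h%:C%C * cd x t) <= e * `|h|.
Proof.
move=> hx e e0; have [dr di _ _] := cg.2 x t hx.
have e2 : 0 < e / 2 by rewrite divr_gt0.
have [d1 d10 h1] := derivable_linear_approx dr e2.
have [d2 d20 h2] := derivable_linear_approx di e2.
exists (Num.min d1 d2); first by rewrite lt_min d10.
move=> h; rewrite lt_min => /andP[/h1 a /h2 b].
apply: le_trans (cabs_le_ReIm _) _; rewrite !ReImE /= !mul0r subr0 addr0.
by apply: le_trans (lerD a b) _; rewrite -mulrDl -splitr.
Qed.

Let velocity_at x t : chart_dom (zchart x) (gam t) ->
  has_velocity s t (mk (zb x) (cd x t) (zslope x (c x t) * cd x t)).
Proof.
move=> hx; have [d d0 hd] := near_dom hx.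
have hv := @has_velocity_zgraph x (c x) t (cd x t) _ (c_linear hx).
move=> e e0; have [|d' d0' hd'] := hv _ e e0.
  exists d => // h hh; have := hd (t + h); rewrite addrC addKr => /(_ hh) [].
  by rewrite /c /s.
exists (Num.min d d'); first by rewrite lt_min d0.
move=> h; rewrite lt_min => /andP[h1 /hd'].
have h1' : `|t + h - t| < d by rewrite addrC addKr.
by rewrite /c /s !zgraphK//; exact: hd.
Qed.

Lemma C1_curve_velocity t : has_velocity s t (V t).
Proof.
rewrite /V zincl_tangent; apply: (velocity_at (x := gam t)).
by split; [exact: zdisc_center|rewrite subrr cabs0; exact: (lg_r (zdataP hJ reg _).1)].
Qed.

(** [V u] is defined through the chart at [gam u], which changes with [u]. Uniqueness of velocities
    rewrites it, for [u] near [t], in the single chart at [gam t]. *)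
Lemma C1_curve_velocity_continuous : curve_continuous V.
Proof.
move=> t e e0; pose x := gam t.
have hx : chart_dom (zchart x) (gam t).
  by split; [exact: zdisc_center|rewrite subrr cabs0; exact: (lg_r (zdataP hJ reg _).1)].
have [d d0 hd] := near_dom hx.
have VE u : chart_dom (zchart x) (gam u) ->
    V u = mk (zb x) (cd x u) (zslope x (c x u) * cd x u).
  by move=> hu; apply: velocity_uniq (C1_curve_velocity u) (velocity_at hu).
have [_ _ cr ci] := cg.2 x t hx.
have [|||d' d0' hd'] := @curve_continuous_zgraph x (c x) (cd x) t _ _ _ e e0.
- by exists d => // u /hd[].
- move=> e' e0'; have [d1 d10 h1] := C1_curve_continuous t e0'.
  by exists d1 => // u /h1; apply: le_lt_trans; rewrite /c -prjB; exact: cabs_prj.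
- move=> e' e0'; have e2 : 0 < e' / 2 by rewrite divr_gt0.
  have [d1 d10 h1] := proj1 (continuous_realP _ _) cr _ e2.
  have [d2 d20 h2] := proj1 (continuous_realP _ _) ci _ e2.
  exists (Num.min d1 d2); first by rewrite lt_min d10.
  move=> u; rewrite lt_min => /andP[/h1 a /h2 b].
  apply: le_lt_trans (cabs_le_ReIm _) _; rewrite !ReImE /=.
  by rewrite [ltRHS]splitr; apply: ltrD.
exists (Num.min d d'); first by rewrite lt_min d0.
by move=> u; rewrite lt_min => /andP[/hd hu /hd']; rewrite (VE u hu) (VE t hx).
Qed.

Lemma C1_curve_length : exists F : R -> R,
  [/\ forall a b, 0 <= a -> a <= b -> b <= 1 -> nrm (s b - s a) <= F b - F a,
      curve_length (pullback_metric Y) gam = (F 1 - F 0)%:E &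
      forall K : R, (forall t, 0 <= t <= 1 -> nrm (V t) <= K) -> F 1 - F 0 <= K].
Proof. exact: curve_bound C1_curve_velocity C1_curve_velocity_continuous. Qed.

End C1Curve.

Lemma path_rect_curve (p q : M) l : piecewise_C1_path (pullback_metric Y) p q l ->
  exists2 L, l = L%:E & rect_curve (zset B J) (Y p) (Y q) L.
Proof.
have zY (x : M) : zset B J (Y x) by apply: (@zcomp_zset _ _ _ p0); exact: set_valP.
elim=> [p1|gam q1 l1 cg _ [L -> hL]].
  by exists 0 => //; exact: rect_curve_const.
have [F [hF -> _]] := C1_curve_length cg.
exists (F 1 - F 0 + L); first by rewrite EFinD.
by apply: (rect_curve_cons (g := fun t => Y (gam t))) => //; exact: C1_curve_continuous.
Qed.

(** The graph over the segment between the parameters of [y] and [x] joins these points, with length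
    at most a constant, depending on [x], times their Euclidean distance. This is what turns
    Euclidean convergence on the surface into convergence for the metric. *)
Lemma riemannian_dist_small (x : M) e : 0 < e -> exists2 d, 0 < d &
  forall y : M, nrm (Y y - Y x) < d ->
    (riemannian_dist (pullback_metric Y) y x < e%:E)%E.
Proof.
move=> e0; set b := zb x; set k := gd_c (zdata hJ reg x).
have k0 : 0 <= k := zc_ge0 hJ reg x.
have s1 : 0 < sin 1 :> R.
  by rewrite sin_gt0_pi// ltr01/=; apply: lt_le_trans (pi_ge2 R); rewrite ltr1n.
(* Normalizes the sine so that time 1 is exactly the centre of the chart. *)
pose K := (sin 1)^-1 : R; have K0 : 0 < K by rewrite invr_gt0.
set rho := zrho hJ reg x; have rho0 : 0 < rho := zrho_gt0 hJ reg x.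
set r := gd_r (zdata hJ reg x); have r0 : 0 < r := lg_r (zdataP hJ reg x).1.
(* At all times the parameter stays within [(1 + K)] times the initial distance of the centre. The
   second bound puts [y] in the chart domain; the third makes the length, at most [(1 + k) * K]
   times that distance, less than [e / 2]. *)
pose d := Num.min (Num.min (rho / (1 + K)) r) (e / ((1 + k) * K * 2)).
have d0 : 0 < d by rewrite !lt_min r0 !divr_gt0// ?mulr_gt0//; lra.
exists d => // y hy.
have hyd : nrm (Y y - Y x) < rho / (1 + K) by apply: lt_le_trans hy _; rewrite !ge_min lexx.
have hyr : nrm (Y y - Y x) < r by apply: lt_le_trans hy _; rewrite !ge_min lexx orbT.
have hye : nrm (Y y - Y x) < e / ((1 + k) * K * 2).
  by apply: lt_le_trans hy _; rewrite !ge_min lexx orbT.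
set z0 := prj b (Y x); set z1 := prj b (Y y).
have h10 : cabs (z1 - z0) <= nrm (Y y - Y x) by rewrite -prjB; exact: cabs_prj.
have hz : cabs (z1 - z0) < rho / (1 + K) by exact: le_lt_trans hyd.
have hz' : cabs (z1 - z0) * (1 + K) < rho by rewrite -ltr_pdivlMr//; lra.
have ab0 := cabs_ge0 (z1 - z0).
pose a : Cplx R := (z0 - z1) * K%:C%C.
have aE : cabs a = cabs (z1 - z0) * K by rewrite cabsM cabs_real gtr0_norm// cabsBC.
have sinle (t : R) : `|sin t| <= 1 by rewrite ler_norml sin_geN1 sin_le1.
have cosle (t : R) : `|cos t| <= 1 by rewrite ler_norml cos_geN1 cos_le1.
(* A segment reparametrized by the sine, hence a C^1 curve defined on all of [R]
   which stays in the chart. *)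
pose c (t : R) := z1 + (sin t)%:C%C * a.
pose cd (t : R) : Cplx R := (cos t)%:C%C * a.
have cdisc t : zdisc x (c t).
  apply: le_lt_trans hz'; rewrite /c -/b -/z0.
  have -> : z1 + (sin t)%:C%C * a - z0 = (z1 - z0) + (sin t)%:C%C * a by ring.
  apply: le_trans (cabs_leD (lexx _) (lexx _)) _; rewrite mulrDr mulr1 lerD2l.
  by rewrite cabsM cabs_real aE -[leRHS]mul1r ler_wpM2r// mulr_ge0// ltW.
have ycont : zset B J (Y y) by apply: (@zcomp_zset _ _ _ p0); exact: set_valP.
have ydom : chart_dom (zchart x) y.
  split; first by apply: (@le_lt_trans _ _ (cabs (z1 - z0) * (1 + K))) hz';
    rewrite mulrDr mulr1 lerDl mulr_ge0// ltW.
  by apply: le_lt_trans hyr; rewrite -prjB; exact: cabs_prj.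
pose gam (t : R) : M := chart_inv (zchart x) (c t).
have gamE t : Y (gam t) = zgraph x (c t) by exact: val_zchart_inv.
have gam0 : gam 0 = y.
  apply: val_inj; rewrite -[LHS]/(Y (gam 0)) gamE /c sin0 mul0r addr0.
  exact: zgraphK ydom.
have gam1 : gam 1 = x.
  have xdom : chart_dom (zchart x) x.
    by split; [exact: zdisc_center|rewrite subrr cabs0; exact: (lg_r (zdataP hJ reg _).1)].
  apply: val_inj; rewrite -[LHS]/(Y (gam 1)) gamE.
  have -> : c 1 = z0.
    rewrite /c /a mulrCA -rmorphM mulfV ?gt_eqF// rmorph1; ring.
  exact: zgraphK xdom.
have c_lin t e' : 0 < e' -> exists2 d, 0 < d &
    forall h, `|h| < d -> cabs (c (t + h) - c t - h%:C%C * cd t) <= e' * `|h|.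
  move=> e0'; have a1 : 0 < cabs a + 1 by rewrite ltr_wpDl// cabs_ge0.
  have ds : derivable sin t (1 : R) by exact: derivable_sin.
  have [d1 d10 h1] := derivable_linear_approx ds (divr_gt0 e0' a1).
  exists d1 => // h /h1; rewrite derive1E derive_val => hh.
  have -> : c (t + h) - c t - h%:C%C * cd t = (sin (t + h) - sin t - h * cos t)%:C%C * a.
    by rewrite /c /cd !rmorphB rmorphM; ring.
  rewrite cabsM cabs_real; apply: (@le_trans _ _ (e' / (cabs a + 1) * `|h| * (cabs a + 1))).
    by apply: ler_pM => //; rewrite ?cabs_ge0// lerDl.
  by rewrite mulrAC divfK ?gt_eqF.
have cont (f : R -> R) : continuous f -> forall t e', 0 < e' -> exists2 d, 0 < d &
    forall u, `|u - t| < d -> cabs ((f u)%:C%C * a - (f t)%:C%C * a) < e'.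
  move=> cf t e' e0'; have a1 : 0 < cabs a + 1 by rewrite ltr_wpDl// cabs_ge0.
  have [d1 d10 h1] := proj1 (continuous_realP f t) (cf t) _ (divr_gt0 e0' a1).
  exists d1 => // u /h1; rewrite ltr_pdivlMr// => hu.
  rewrite -mulrBl -rmorphB cabsM cabs_real; apply: le_lt_trans hu.
  by rewrite ler_wpM2l// lerDl.
have cc t e' : 0 < e' -> exists2 d, 0 < d & forall u, `|u - t| < d -> cabs (c u - c t) < e'.
  move=> e0'; have [d1 d10 h1] := cont sin (@continuous_sin R) t e' e0'.
  by exists d1 => // u /h1; rewrite /c opprD addrACA subrr add0r.
have ccd t e' : 0 < e' -> exists2 d, 0 < d & forall u, `|u - t| < d -> cabs (cd u - cd t) < e'.
  exact: (cont cos (@continuous_cos R)).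
pose W (t : R) := mk b (cd t) (zslope x (c t) * cd t).
have velW t : has_velocity (fun u => Y (gam u)) t (W t).
  rewrite (_ : (fun u => Y (gam u)) = fun u => zgraph x (c u)); last exact/funext.
  apply: has_velocity_zgraph; first by exists 1.
  exact: c_lin.
have contW : curve_continuous W.
  by move=> t; apply: curve_continuous_zgraph; [exists 1|exact: cc|exact: ccd].
have conts : curve_continuous (fun u => Y (gam u)).
  move=> t e' e0'; have k1 : 0 < 1 + k by lra.
  have [d1 d10 h1] := cc t _ (divr_gt0 e0' k1).
  exists d1 => // u /h1; rewrite ltr_pdivlMr// mulrC => hu.
  by rewrite !gamE; apply: le_lt_trans hu; exact: zgraph_lip.
have cg : C1_curve gam.
  split.
    move=> t A /nbhs_subP[e' e0' he']; have [d1 d10 h1] := conts t e' e0'.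
    apply: (proj2 (nbhs_normP t _)); exists d1 => // u /=; rewrite distrC => /h1 hu.
    exact: he'.
  move=> p t _; set b' := zb p.
  have hre u : is_derive u (1 : R) (re_chart gam p) (complex.Re (prj b' (W u))).
    apply: is_derive_linear_approx => e' e0'; have [d1 d10 h1] := velW u e' e0'.
    exists d1 => // h /h1; apply: le_trans.
    have -> : re_chart gam p (u + h) - re_chart gam p u - h * complex.Re (prj b' (W u)) =
      complex.Re (prj b' (Y (gam (u + h)) - Y (gam u) - rscale h (W u))).
      have -> : prj b' (Y (gam (u + h)) - Y (gam u) - rscale h (W u)) =
        prj b' (Y (gam (u + h))) - prj b' (Y (gam u)) - h%:C%C * prj b' (W u).
        by rewrite !prjB; congr (_ - _); case: (b').
      by rewrite !ReImE /= mul0r subr0.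
    by apply: le_trans (Re_le_cabs _) _; exact: cabs_prj.
  have him u : is_derive u (1 : R) (im_chart gam p) (complex.Im (prj b' (W u))).
    apply: is_derive_linear_approx => e' e0'; have [d1 d10 h1] := velW u e' e0'.
    exists d1 => // h /h1; apply: le_trans.
    have -> : im_chart gam p (u + h) - im_chart gam p u - h * complex.Im (prj b' (W u)) =
      complex.Im (prj b' (Y (gam (u + h)) - Y (gam u) - rscale h (W u))).
      have -> : prj b' (Y (gam (u + h)) - Y (gam u) - rscale h (W u)) =
        prj b' (Y (gam (u + h))) - prj b' (Y (gam u)) - h%:C%C * prj b' (W u).
        by rewrite !prjB; congr (_ - _); case: (b').
      by rewrite !ReImE /= mul0r addr0.
    by apply: le_trans (Im_le_cabs _) _; exact: cabs_prj.
  have reE : derive1 (re_chart gam p) = fun u => complex.Re (prj b' (W u)).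
    by apply/funext => u; rewrite derive1E; have [] := hre u.
  have imE : derive1 (im_chart gam p) = fun u => complex.Im (prj b' (W u)).
    by apply/funext => u; rewrite derive1E; have [] := him u.
  split; [by have [] := hre t|by have [] := him t|rewrite reE|rewrite imE];
    apply/continuous_realP => e' e0'; have [d1 d10 h1] := contW t e' e0';
    exists d1 => // u /h1; apply: le_lt_trans.
    rewrite -ReN -ReD -prjB; apply: le_trans (Re_le_cabs _) _; exact: cabs_prj.
  rewrite -ImN -ImD -prjB; apply: le_trans (Im_le_cabs _) _; exact: cabs_prj.
have [F [_ FE hK]] := C1_curve_length cg.
have hp : piecewise_C1_path (pullback_metric Y) y x
    (curve_length (pullback_metric Y) gam + 0)%E.
  by rewrite -{1}gam0 -gam1; apply: path_cons => //; exact: path_const.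
apply: (@le_lt_trans _ _ (curve_length (pullback_metric Y) gam + 0)%E).
  exact: ereal_inf_lbound.
rewrite adde0 FE lte_fin.
apply: (@le_lt_trans _ _ ((1 + k) * (cabs (z1 - z0) * K))).
  apply: hK => t _.
  rewrite (velocity_uniq (C1_curve_velocity cg t) (velW t)).
  apply: le_trans (nrm_mk _ _ _) _.
  have hcd : cabs (cd t) <= cabs (z1 - z0) * K.
    by rewrite /cd cabsM cabs_real aE -[leRHS]mul1r ler_wpM2r// mulr_ge0// ltW.
  have sl : cabs (zslope x (c t)) <= k.
    exact: (lg_slope (zdataP hJ reg x).1 (cdisc t)).
  by rewrite mulrDl mul1r; apply: lerD => //; exact: cabs_leM.
have : cabs (z1 - z0) < e / ((1 + k) * K * 2) by exact: le_lt_trans hye.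
have kK : 0 < (1 + k) * K by apply: mulr_gt0; lra.
rewrite ltr_pdivlMr ?mulr_gt0//; lra.
Qed.

(** The tail of a Cauchy sequence is joined to one of its terms by curves shorter than 1, hence lies
    in a compact [K] of [B]. Properness gives a cluster point on the surface, and a Cauchy sequence
    converges to its cluster point once Euclidean closeness implies closeness for the metric. *)
Lemma zincl_complete :
  (forall p, zset B J p -> exists K : set (Cplx2 R), [/\ K `<=` B, compact K &
     forall q L, rect_curve (zset B J) p q L -> L < 1 -> K q]) ->
  complete_immersion Y.
Proof.
move=> hK; split; first exact: zincl_immersion.
move=> u hu; have [N hN] := hu 1 ltr01.
have zY (x : M) : zset B J (Y x) by apply: (@zcomp_zset _ _ _ p0); exact: set_valP.
have [K [KB cK hKq]] := hK _ (zY (u N)).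
have uK n : (N <= n)%N -> K (Y (u n)).
  move=> Nn; have /ereal_inf_lt[l /= /path_rect_curve[L -> hL]] := hN N n (leqnn _) Nn.
  by rewrite lte_fin; exact: hKq hL.
have cA : compact (Y @^-1` K) by exact: zincl_proper.
have [|p [_ hp]] := cA (u @ \oo) _.
  by exists N => // n; exact: uK.
exists p => e e0; have e2 : 0 < e / 2 by rewrite divr_gt0.
have [N' hN'] := hu _ e2; exists N' => n hn.
have [d d0 hd] := riemannian_dist_small p e2.
have [||q [[m hm <-] qd]] := hp (u @` [set m | (N' <= m)%N]) [set y : M | nrm (Y y - Y p) < d].
- by exists N' => // m hm; exists m.
- by apply/nbhs_subP; exists d.
rewrite [e]splitr; apply: (@riemannian_dist_lt_trans _ _ _ (u m)).
  exact: hN'.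
exact: hd.
Qed.

End Complete.

(** * Noncompactness *)

Section NonCompact.
Variables (R : realType) (B : set (Cplx2 R)) (J : jet R) (p0 : Cplx2 R).
Hypothesis hJ : locally_jbounded B J.
Hypothesis reg : regular_zeros B J.
Hypothesis zp0 : zset B J p0.

(** Test 10 between [p] and a point of the graph involves no values, since [J] vanishes at both.
    Writing the height as [u = a * t + e] with [e] quadratic in [t] turns the quadratic part into
    [Q * t ^+ 2] up to third order. The transversal coefficient stays in front of the height, so
    that nothing is divided. *)
Lemma graph_second_order (p : Cplx2 R) b (rho r k s c : R) g :
  0 < s -> jbound J [set q | nrm (q - p) < s] c -> j0 J p = 0 ->
  local_graph J p b rho r k g ->
  exists2 d, 0 < d & exists C Q, [/\ 0 <= C, d <= rho & forall t : Cplx R, cabs t < d ->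
    cabs (coef (~~ b) J p * (g (prj b p + t) - prj (~~ b) p) + coef b J p * t + Q * t ^+ 2)
      <= C * cabs t ^+ 3].
Proof.
move=> s0 hc Jp lg; have k0 := lg_c lg; have rho0 := lg_rho lg.
set z0 := prj b p; set w0 := prj (~~ b) p; set K := [set q | _] in hc.
have Kp : K p by rewrite /K /= subrr nrm0.
have c0 : 0 <= c by have := hc 0%N p p Kp Kp; rewrite /= mulr1; exact: le_trans (cabs_ge0 _).
have hz0 : cabs (z0 - prj b p) < rho by rewrite subrr cabs0.
have gz0 : g z0 = w0.
  by apply/esym/(lg_zero lg); rewrite ?subrr ?cabs0 ?mk_prj//; exact: lg_r lg.
set a := graph_slope b J g z0.
have ha : cabs a <= k := lg_slope lg hz0.
pose al := if b then jzz J p else jww J p.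
pose be := jzw J p.
pose ga := if b then jww J p else jzz J p.
have [hal hbe hga] : [/\ cabs al <= c, cabs be <= c & cabs ga <= c].
  have h3 := hc 3 p p Kp Kp; have h4 := hc 4 p p Kp Kp; have h5 := hc 5 p p Kp Kp.
  by move: h3 h4 h5; rewrite /= mulr1 /al /be /ga; case: (b).
have quadE t u : jquad J p (mk b t u) = al * t ^+ 2 + be * (t * u) + ga * u ^+ 2.
  by rewrite /jquad /al /be /ga /mk; case: (b) => /=; ring.
(* The quadratic form of the jet evaluated on the tangent vector with slope [a]. *)
pose Q := al + be * a + ga * a ^+ 2.
pose d := Num.min (Num.min rho 1) (s / (1 + k)).
have k1 : 0 < 1 + k by lra.
have d0 : 0 < d by rewrite !lt_min rho0 ltr01 divr_gt0.
exists d => //.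
exists (c * (1 + k) ^+ 3 + c * k + 2 * c * k ^+ 2 + c * k ^+ 2), Q; split.
- by rewrite !addr_ge0// !mulr_ge0// ?exprn_ge0//; lra.
- by rewrite !ge_min lexx.
move=> t td.
have t0 := cabs_ge0 t.
have trho : cabs t < rho by apply: lt_le_trans td _; rewrite !ge_min lexx.
have t1 : cabs t < 1 by apply: lt_le_trans td _; rewrite !ge_min lexx orbT.
have ts : cabs t < s / (1 + k) by apply: lt_le_trans td _; rewrite !ge_min lexx orbT.
have ht : cabs (z0 + t - prj b p) < rho by rewrite -/z0 addrC addKr.
set u := g (z0 + t) - w0.
have hu : cabs u <= k * cabs t.
  by have := lg_lip lg hz0 ht; rewrite gz0 -/u (_ : z0 + t - z0 = t)//; ring.
pose e := u - a * t.
have he : cabs e <= k * cabs t ^+ 2.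
  have := lg_taylor lg hz0 ht; rewrite gz0 -/a -/u (_ : z0 + t - z0 = t)//; ring.
pose q := mk b (z0 + t) (g (z0 + t)).
have qp : q - p = mk b t u.
  have -> : q - p = mk b (z0 + t) (g (z0 + t)) - mk b z0 w0 by rewrite mk_prj.
  by rewrite mkB; congr mk; rewrite ?/u; ring.
have hq : nrm (q - p) <= (1 + k) * cabs t.
  by rewrite qp; apply: le_trans (nrm_mk _ _ _) _; rewrite mulrDl mul1r lerD2l.
have Kq : K q.
  by rewrite /K /=; apply: le_lt_trans hq _; rewrite mulrC -ltr_pdivlMr.
have Jq : j0 J q = 0.
  by apply/(lg_zero lg) => //; exact: (lg_in lg).
have := hc 10%N p q Kp Kq.
rewrite [jtest _ _ _ _]/= [jweight _ _]/= Jp Jq subrr sub0r (jlin_coef b) qp prj_mk prjN_mk quadE.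
rewrite -qp => h10.
have h10' : c * nrm (q - p) ^+ 3 <= c * ((1 + k) * cabs t) ^+ 3.
  by rewrite ler_wpM2l// lerXn2r ?nnegrE ?nrm_ge0 ?mulr_ge0//; lra.
have -> : coef (~~ b) J p * u + coef b J p * t + Q * t ^+ 2 =
  - (- (coef b J p * t + coef (~~ b) J p * u) -
     (al * t ^+ 2 + be * (t * u) + ga * u ^+ 2))
  - (be * (t * e) + (2%:R * ga * (a * (t * e)) + ga * e ^+ 2)).
  by rewrite (_ : u = a * t + e) /Q; [ring|rewrite /e; ring].
have te : cabs (t * e) <= k * cabs t ^+ 3.
  rewrite cabsM; have := ler_wpM2l t0 he; rewrite (_ : cabs t ^+ 3 = cabs t * cabs t ^+ 2); last by ring.
  by rewrite mulrCA.
have f1 : cabs (be * (t * e)) <= c * (k * cabs t ^+ 3) by exact: cabs_leM.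
have f2 : cabs (2%:R * ga * (a * (t * e))) <= 2 * c * (k * (k * cabs t ^+ 3)).
  by apply: cabs_leM; apply: cabs_leM => //; rewrite cabs_nat.
have f3 : cabs (ga * e ^+ 2) <= c * (k ^+ 2 * cabs t ^+ 3).
  apply: cabs_leM => //; rewrite cabsX.
  apply: (@le_trans _ _ ((k * cabs t ^+ 2) ^+ 2)).
    by rewrite lerXn2r ?nnegrE ?cabs_ge0// mulr_ge0// exprn_ge0.
  rewrite exprMn ler_wpM2l ?exprn_ge0// -exprM.
  by rewrite (_ : 2 * 2 = 3.+1)%N// exprS ler_piMl ?exprn_ge0// ltW.
apply: le_trans (cabs_leB _ (cabs_leD f1 (cabs_leD f2 f3))) _.
  by rewrite cabsN; exact: le_trans h10 h10'.
rewrite exprMn; lra.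
Qed.

(* If the surface were compact, [|p|^2] would have a maximum on it; averaging
   over the parameters [r, -r, ir, -ir] around it violates subharmonicity. *)
Lemma zsurface_open : open_riemann_surface (zsurface hJ reg zp0).
Proof.
move=> cM; pose M := zsurface hJ reg zp0.
have M0 : [set: M] !=set0 by exists (to_zcomp zp0 p0).
have cv : {within [set: M], continuous (fun x : M => nrm (zincl x))}.
  apply: continuous_subspaceT => x.
  apply: (@continuous_comp _ _ _ (fun x : M => zincl x) (@nrm R)).
    exact: val_sub_continuous.
  exact: nrm_continuous.
have [x _ hx] := compact_EVT_max M0 cM cv.
have {}hx q : zcomp B J p0 q -> nrm q <= nrm (zincl x).
  move=> cq; have := hx (to_zcomp zp0 q); rewrite /zincl to_zcompK// => -> //.
  by rewrite inE.
set p := zincl x in hx; have cp : zcomp B J p0 p by exact: set_valP.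
have [Bp Jp] := zcomp_zset cp.
have [s [c [s0 _ hc]]] := hJ Bp.
have [d hd] := graph_data_ex hJ reg (zcomp_zset cp); have lg := hd.1.
set b := gd_b d in lg.
have [dl dl0 [C [Q [C0 dlr hC]]]] := graph_second_order s0 hc Jp lg.
set z0 := prj b p in hC; set w0 := prj (~~ b) p in hC.
set D := coef (~~ b) J p in hC; set g := gd_g d in hC.
have hz0 : cabs (z0 - prj b p) < gd_rho d by rewrite subrr cabs0 (lg_rho lg).
have gz0 : gd_g d z0 = w0.
  by apply/esym/(lg_zero lg); rewrite ?subrr ?cabs0 ?mk_prj ?(lg_rho lg) ?(lg_r lg).
have D0 : 0 < cabs D.
  by rewrite cabs_gt0 /D; have := lg_coef lg hz0; rewrite gz0 mk_prj.
have w00 := cabs_ge0 w0.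
pose u t := g (z0 + t) - w0.
have hmax t : cabs t < dl -> cabs (z0 + t) ^+ 2 + cabs (w0 + u t) ^+ 2 <= cabs z0 ^+ 2 + cabs w0 ^+ 2.
  move=> tdl.
  have ht : cabs (z0 + t - prj b p) < gd_rho d.
    by rewrite -/z0 addrC addKr; exact: lt_le_trans dlr.
  have := hx _ (zcomp_graph cp hd ht); rewrite -/b -/g => h.
  have h2 : nrm (mk b (z0 + t) (g (z0 + t))) ^+ 2 <= nrm p ^+ 2.
    by rewrite lerXn2r ?nnegrE ?nrm_ge0.
  move: h2; rewrite !nrm_sqrE /u (_ : w0 + (g (z0 + t) - w0) = g (z0 + t)); last by ring.
  by rewrite /z0 /w0 /mk /prj; case: (b) => /=; lra.
(* Makes the third-order error lose against the quadratic gain: the final bounds give [8 * (C + 1) *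
   (cabs w0 + 1) <= 4 * C * cabs w0], which is absurd. *)
pose r := Num.min (dl / 2) (cabs D / (8 * (C + 1) * (cabs w0 + 1))).
have r0 : 0 < r by rewrite lt_min !divr_gt0// !mulr_gt0//; lra.
have rdl : r < dl by apply: (@le_lt_trans _ _ (dl / 2)); [rewrite ge_min lexx|lra].
have rD : 8 * (C + 1) * (cabs w0 + 1) * r <= cabs D.
  have : r <= cabs D / (8 * (C + 1) * (cabs w0 + 1)) by rewrite ge_min lexx orbT.
  rewrite ler_pdivlMr; first lra.
  by rewrite !mulr_gt0//; lra.
pose t1 : Cplx R := Complex r 0; pose t2 : Cplx R := Complex (- r) 0.
pose t3 : Cplx R := Complex 0 r; pose t4 : Cplx R := Complex 0 (- r).
have n1 : cabs t1 = r by rewrite /cabs /t1 /= expr0n addr0 sqrtr_sqr gtr0_norm.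
have n2 : cabs t2 = r by rewrite /cabs /t2 /= expr0n addr0 sqrrN sqrtr_sqr gtr0_norm.
have n3 : cabs t3 = r by rewrite /cabs /t3 /= expr0n add0r sqrtr_sqr gtr0_norm.
have n4 : cabs t4 = r by rewrite /cabs /t4 /= expr0n add0r sqrrN sqrtr_sqr gtr0_norm.
have {}hC t : cabs t < dl -> cabs (D * u t + coef b J p * t + Q * t ^+ 2) <= C * cabs t ^+ 3.
  exact: hC.
clearbody u.
have c1 := hC t1; have c2 := hC t2; have c3 := hC t3; have c4 := hC t4.
rewrite n1 in c1; rewrite n2 in c2; rewrite n3 in c3; rewrite n4 in c4.
have := cabs_leD (cabs_leD (cabs_leD (c1 rdl) (c2 rdl)) (c3 rdl)) (c4 rdl).
(* The four parameters and their squares sum to zero, so [cabs D * cabs S <= 4 * C * r ^+ 3]. Adding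
   the four maximality inequalities cancels the terms linear in the parameters and leaves
   [r ^+ 2 <= cabs w0 * cabs S]. *)
set S := u t1 + u t2 + u t3 + u t4.
have s1 : t1 + t2 + t3 + t4 = 0 by apply: complex_ext; rewrite !ReImE /=; ring.
have s2 : t1 ^+ 2 + t2 ^+ 2 + t3 ^+ 2 + t4 ^+ 2 = 0.
  by apply: complex_ext; rewrite !expr2 !ReImE /=; ring.
have -> : D * u t1 + coef b J p * t1 + Q * t1 ^+ 2 + (D * u t2 + coef b J p * t2 + Q * t2 ^+ 2)
   + (D * u t3 + coef b J p * t3 + Q * t3 ^+ 2) + (D * u t4 + coef b J p * t4 + Q * t4 ^+ 2)
   = D * S + coef b J p * (t1 + t2 + t3 + t4) + Q * (t1 ^+ 2 + t2 ^+ 2 + t3 ^+ 2 + t4 ^+ 2).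
  by rewrite /S; ring.
rewrite s1 s2 !mulr0 !addr0 cabsM => hS.
have m1 := hmax t1; have m2 := hmax t2; have m3 := hmax t3; have m4 := hmax t4.
rewrite n1 in m1; rewrite n2 in m2; rewrite n3 in m3; rewrite n4 in m4.
move: (m1 rdl) (m2 rdl) (m3 rdl) (m4 rdl).
rewrite !cabs_sqr !ReImE /= => {m1 m2 m3 m4} m1 m2 m3 m4.
have hm : 4 * r ^+ 2 <= - 2 * (complex.Re w0 * complex.Re S + complex.Im w0 * complex.Im S).
  rewrite /S !ReImE.
  have sq t : 0 <= complex.Re (u t) ^+ 2 + complex.Im (u t) ^+ 2 by rewrite addr_ge0// sqr_ge0.
  have := sq t1; have := sq t2; have := sq t3; have := sq t4; lra.
have hws : - (complex.Re w0 * complex.Re S + complex.Im w0 * complex.Im S) <= 2 * (cabs w0 * cabs S).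
  have a1 : - (complex.Re w0 * complex.Re S) <= cabs w0 * cabs S.
    apply: le_trans (ler_norm _) _; rewrite normrN normrM.
    by apply: ler_pM => //; exact: Re_le_cabs.
  have a2 : - (complex.Im w0 * complex.Im S) <= cabs w0 * cabs S.
    apply: le_trans (ler_norm _) _; rewrite normrN normrM.
    by apply: ler_pM => //; exact: Im_le_cabs.
  lra.
have S0 := cabs_ge0 S.
have h4 : r ^+ 2 <= cabs w0 * cabs S by lra.
have h5 : cabs D * r ^+ 2 <= cabs w0 * (4 * C * r ^+ 3).
  apply: (@le_trans _ _ (cabs D * (cabs w0 * cabs S))); first by rewrite ler_wpM2l// ltW.
  by rewrite mulrCA ler_wpM2l//; lra.
have h6 : 8 * (C + 1) * (cabs w0 + 1) * r * r ^+ 2 <= cabs w0 * (4 * C * r ^+ 3).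
  apply: le_trans h5; rewrite ler_wpM2r// sqr_ge0//.
have r3 : 0 < r ^+ 3 by rewrite exprn_gt0.
have : 8 * (C + 1) * (cabs w0 + 1) * r ^+ 3 <= cabs w0 * (4 * C) * r ^+ 3.
  by move: h6; rewrite !exprS expr0; lra.
rewrite ler_pM2r//; nra.
Qed.

End NonCompact.

(** * The labyrinth *)

Section Convexity.
Variable R : realType.
Implicit Types (C : set (Cplx2 R)) (x y p q : Cplx2 R).
Local Notation dot := (@euclidean_metric R).

Definition rconvex C := forall x y t, C x -> C y -> 0 <= t <= 1 -> C (x + rscale t (y - x)).

(* [g x] plays the role of the gradient of [u] at [x]. *)
Definition uniformly_convex (u : Cplx2 R -> R) (g : Cplx2 R -> Cplx2 R) (a b : R) :=
  forall x y, u x + dot (g x) (y - x) + a * nrm (y - x) ^+ 2 <= u y /\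
              u y <= u x + dot (g x) (y - x) + b * nrm (y - x) ^+ 2.

Lemma uniformly_convex_continuous u g a b : 0 <= a -> 0 <= b ->
  uniformly_convex u g a b -> continuous u.
Proof.
move=> a0 b0 h p; apply/Cplx2_continuousP => e e0.
have k0 : 0 < nrm (g p) + b + 1 by rewrite ltr_wpDl// addr_ge0// nrm_ge0.
exists (Num.min 1 (e / (nrm (g p) + b + 1))); first by rewrite lt_min ltr01 divr_gt0.
move=> q; rewrite lt_min => /andP[q1]; rewrite ltr_pdivlMr// => qe.
have [h1 h2] := h p q; have n0 := nrm_ge0 (q - p); have g0 := nrm_ge0 (g p).
have d1 := dot_le (g p) (q - p); have d2 := dot_ge (g p) (q - p).
have s0 : 0 <= a * nrm (q - p) ^+ 2 by rewrite mulr_ge0// sqr_ge0.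
have s1 : b * nrm (q - p) ^+ 2 <= b * nrm (q - p).
  by rewrite ler_wpM2l// expr2 ler_piMl// ltW.
have s2 : 0 <= b * nrm (q - p) by rewrite mulr_ge0.
by rewrite ltr_norml; apply/andP; split; nra.
Qed.

Lemma projection_exists C x : C !=set0 -> compact C ->
  exists2 c, C c & forall c', C c' -> nrm (x - c) <= nrm (x - c').
Proof.
move=> C0 cC; have cf : {within C, continuous (fun c => nrm (x - c))}.
  apply: continuous_subspaceT; apply: (@lipschitz_Cplx2_continuous _ _ 1) => p q.
  rewrite mul1r; apply: le_trans (nrm_lipschitz _ _) _.
  by rewrite opprB addrC addrA subrK nrmBC.
have [c cC' hc] := compact_EVT_min C0 cC cf.
exists c => [|c' Cc']; first by rewrite inE in cC'.
by apply: hc; rewrite inE.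
Qed.

Lemma projection_variational C x c : rconvex C -> C c ->
  (forall c', C c' -> nrm (x - c) <= nrm (x - c')) ->
  forall c', C c' -> dot (x - c) (c' - c) <= 0.
Proof.
move=> cvC Cc hc c' Cc'; apply/ler_addgt0Pr => e e0; rewrite add0r.
pose k := nrm (c' - c) ^+ 2; have k0 : 0 <= k by rewrite sqr_ge0.
pose t := Num.min 1 (e / (k + 1)).
have k1 : 0 < k + 1 by rewrite ltr_wpDl.
have t0 : 0 < t by rewrite lt_min ltr01 divr_gt0.
have t1 : t <= 1 by rewrite ge_min lexx.
have tk : t * (k + 1) <= e by rewrite -ler_pdivlMr// ge_min lexx orbT.
have t01 : 0 <= t <= 1 by rewrite ltW.
have := hc _ (cvC c c' t Cc Cc' t01).
rewrite -ler_sqr ?nnegrE ?nrm_ge0//.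
have -> : x - (c + rscale t (c' - c)) = (x - c) - rscale t (c' - c) by rewrite opprD addrA.
rewrite !nrm_sqr !(dotBl (x - c) (rscale t _)) !(dotBr (x - c) (rscale t _)) !dotZl !dotZr.
rewrite (dotC (c' - c) (x - c)) -[dot (c' - c) (c' - c)]nrm_sqr -/k.
set D := dot (x - c) (c' - c) => h.
have : t * (2 * D) <= t * (t * k) by lra.
rewrite ler_pM2l//; nra.
Qed.

(** The squared distance to [C] has gradient [2 (x - P x)], with [P] the projection. The upper bound
    holds because [P x] competes with [P y] for the point [y]; the lower one is the variational
    inequality for [P x] tested at [P y]. *)
Lemma sqdist_convex C : C !=set0 -> compact C -> rconvex C ->
  exists v g, [/\ uniformly_convex v g 0 1, (forall x, C x -> v x = 0) &
    forall x, exists2 c, C c & v x = nrm (x - c) ^+ 2].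
Proof.
move=> C0 cC cvC.
have [P hP] : exists P, forall x, C (P x) /\ forall c', C c' -> nrm (x - P x) <= nrm (x - c').
  have h x := projection_exists x C0 cC.
  pose P x := projT1 (cid2 (h x)).
  by exists P => x; rewrite /P; case: cid2.
exists (fun x => nrm (x - P x) ^+ 2), (fun x => rscale 2 (x - P x)); split.
- move=> x y; have [Cx hx] := hP x; have [Cy hy] := hP y; split.
    have := projection_variational cvC Cx hx Cy.
    rewrite mul0r addr0 dotZl !nrm_sqr.
    have -> : y - P y = (x - P x) + ((y - x) - (P y - P x)).
      by apply/eqP; rewrite -subr_eq0; apply/eqP; rewrite !opprD !opprK; case: x y (P x) (P y) {hx hy Cx Cy} => ? ? [? ?] [? ?] [? ?]; congr pair => /=; ring.
    set A := x - P x; set D := y - x; set E := P y - P x.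
    rewrite !(dotDl A) !(dotDr A) (dotBr D E A) (dotC (D - E) A) (dotBr D E A).
    by have := dot_ge0 (D - E); lra.
  have := hy _ Cx; rewrite -ler_sqr ?nnegrE ?nrm_ge0// => /le_trans; apply.
  rewrite mul1r dotZl !nrm_sqr (_ : y - P x = (x - P x) + (y - x)); last first.
    by rewrite [RHS]addrC addrA subrK.
  move: (x - P x) (y - x) => A D.
  by rewrite dotDl !dotDr (dotC D A); lra.
- move=> x Cx; have [_ /(_ _ Cx)] := hP x; rewrite subrr nrm0 => h.
  have -> : nrm (x - P x) = 0 by apply/eqP; rewrite eq_le h nrm_ge0.
  by rewrite expr0n.
- by move=> x; have [h _] := hP x; exists (P x).
Qed.

Lemma curve_ivt (s : R -> Cplx2 R) (f : Cplx2 R -> R) (a b v : R) :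
  curve_continuous s -> continuous f -> a <= b -> f (s a) <= v -> v <= f (s b) ->
  exists t, [/\ a <= t, t <= b & f (s t) = v].
Proof.
move=> cs cf ab fa fb.
have cc : {within `[a, b], continuous (fun t => f (s t))}.
  apply: continuous_subspaceT => t; apply/continuous_realP => e e0.
  have [d d0 hd] := proj1 (Cplx2_continuousP f (s t)) (cf (s t)) e e0.
  by have [d' d0' hd'] := cs t d d0; exists d' => // u /hd'/hd.
have [|t] := IVT ab cc (v := v).
  by rewrite ge_min fa/= le_max fb orbT.
by rewrite in_itv /= => /andP[at' tb] h; exists t.
Qed.

End Convexity.

Section OrderedSeq.
Variables (T : eqType) (r : T -> T -> Prop).

(** The relation is a proposition because the one used quantifies over all points of a wall. *)
Fixpoint pairwise_prop (s : seq T) : Prop :=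
  if s is x :: s' then (forall y, y \in s' -> r x y) /\ pairwise_prop s' else True.

Lemma pairwise_prop_cat s1 s2 : pairwise_prop s1 -> pairwise_prop s2 ->
  (forall x y, x \in s1 -> y \in s2 -> r x y) -> pairwise_prop (s1 ++ s2).
Proof.
elim: s1 => //= x s1 ih [h1 h2] hs2 h; split.
  by move=> y; rewrite mem_cat => /orP[/h1//|]; apply: h; rewrite mem_head.
by apply: ih => // a b ha; apply: h; rewrite in_cons ha orbT.
Qed.

Lemma pairwise_prop_uniq s : uniq s ->
  (forall x y, x \in s -> y \in s -> x != y -> r x y) -> pairwise_prop s.
Proof.
elim: s => //= x s ih /andP[xs us] h; split.
  move=> y ys; apply: h; rewrite ?mem_head ?in_cons ?ys ?orbT//.
  by apply: contraNneq xs => ->.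
by apply: ih => // a b ha hb; apply: h; rewrite in_cons ?ha ?hb orbT.
Qed.

End OrderedSeq.

Section Digits.

Definition same_digits (M j k1 k2 k3 k4 : nat) :=
  [&& k1 == j %[mod M], k2 == j %/ M %[mod M],
      k3 == j %/ M %/ M %[mod M] & k4 == j %/ M %/ M %/ M %[mod M]].

(* Every quadruple of residues occurs among any [M ^ 4] consecutive layers. *)
Lemma same_digits_ex M k1 k2 k3 k4 q : (0 < M)%N ->
  exists j, [/\ (q * M ^ 4 <= j)%N, (j < q.+1 * M ^ 4)%N & same_digits M j k1 k2 k3 k4].
Proof.
move=> M0; pose a1 := (k1 %% M)%N; pose a2 := (k2 %% M)%N.
pose a3 := (k3 %% M)%N; pose a4 := (k4 %% M)%N.
have [l1 l2 l3 l4] : [/\ a1 < M, a2 < M, a3 < M & a4 < M]%N by rewrite !ltn_mod.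
(* The witness has the lowest base [M] digits [a1], [a2], [a3], [a4], and [q] above them. *)
pose b3 := (q * M + a4)%N; pose b2 := (b3 * M + a3)%N; pose b1 := (b2 * M + a2)%N.
exists (b1 * M + a1)%N.
have e1 : ((b1 * M + a1) %/ M = b1)%N by rewrite divnMDl// divn_small// addn0.
have e2 : (b1 %/ M = b2)%N by rewrite divnMDl// divn_small// addn0.
have e3 : (b2 %/ M = b3)%N by rewrite divnMDl// divn_small// addn0.
have E : (M ^ 4 = M * M * M * M)%N by rewrite !expnS expn0 muln1 !mulnA.
split.
- have lo X Y a : (X <= Y)%N -> (X * M <= Y * M + a)%N.
    by move=> h; apply: leq_trans (leq_addr _ _); rewrite leq_mul2r h orbT.
  by rewrite E !mulnA; do 4 apply: (lo).
- have up X Y a : (X < Y)%N -> (a < M)%N -> (X * M + a < Y * M)%N.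
    move=> h aM; apply: (@leq_trans (X.+1 * M)); last by rewrite leq_mul2r h orbT.
    by rewrite mulSn addnC ltn_add2r.
  by rewrite E !mulnA; do 4 (apply: (up) => //).
- rewrite /same_digits e1 e2 e3 /b1 /b2 /b3.
  by rewrite !modnMDl !modn_mod !eqxx.
Qed.

End Digits.

(** * Layers of discs tangent to level sets of a uniformly convex function *)

Section Labyrinth.
Variable R : realType.
Implicit Types (x y p q : Cplx2 R) (o : (Cplx2 R * Cplx2 R)%type).
Local Notation dot := (@euclidean_metric R).

(* An obstacle [(x, g)] stands for the closed disc of centre [x] and radius [d]
   in the real hyperplane through [x] orthogonal to [g]. *)
Definition wall (d : R) o : set (Cplx2 R) :=
  [set y | dot o.2 (y - o.1) = 0 /\ nrm (y - o.1) <= d].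

Definition below o y := dot o.2 (y - o.1) < 0.

Definition walls (d : R) (obs : seq (Cplx2 R * Cplx2 R)) : set (Cplx2 R) :=
  [set y | exists2 o, o \in obs & wall d o y].

Definition ordered_walls (d : R) := pairwise_prop (fun o o' => forall y, wall d o y -> below o' y).

Definition rcoord (i : 'I_4) x : R :=
  match val i with
  | 0%N => complex.Re x.1 | 1%N => complex.Im x.1
  | 2%N => complex.Re x.2 | _ => complex.Im x.2 end.

Lemma rcoord_le i x : `|rcoord i x| <= nrm x.
Proof.
rewrite /rcoord; case: i => -[|[|[|[|//]]]] /= _.
- exact: le_trans (Re_le_cabs _) (cabs1_le _).
- exact: le_trans (Im_le_cabs _) (cabs1_le _).
- exact: le_trans (Re_le_cabs _) (cabs2_le _).
- exact: le_trans (Im_le_cabs _) (cabs2_le _).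
Qed.

Lemma rcoordB i x y : rcoord i (x - y) = rcoord i x - rcoord i y.
Proof. by rewrite /rcoord; case: i => -[|[|[|[|//]]]] /= _; rewrite !ReImE. Qed.

Lemma nrm_rcoord x (h : R) : (forall i, `|rcoord i x| <= h) -> nrm x <= 2 * h.
Proof.
move=> H; have h0 : 0 <= h by apply: le_trans (H ord0).
rewrite -ler_sqr ?nnegrE ?nrm_ge0 ?mulr_ge0// nrm_sqr /euclidean_metric.
have sq (a : R) : `|a| <= h -> a * a <= h ^+ 2.
  move=> ah; rewrite -expr2 -(@real_normK _ a) ?num_real//.
  by rewrite lerXn2r ?nnegrE.
have := sq _ (H (@Ordinal 4 0 isT)); have := sq _ (H (@Ordinal 4 1 isT)).
have := sq _ (H (@Ordinal 4 2 isT)); have := sq _ (H (@Ordinal 4 3 isT)).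
rewrite /rcoord /=; lra.
Qed.

Variables (u : Cplx2 R -> R) (gr : Cplx2 R -> Cplx2 R) (a b : R) (s0 s1 R1 : R).
Hypothesis a0 : 0 < a.
Hypothesis b0 : 0 < b.
Hypothesis uconv : uniformly_convex u gr a b.
Hypothesis s01 : s0 < s1.
Hypothesis ubound : forall x, u x <= s1 -> nrm x <= R1.

Let ucont : continuous u := uniformly_convex_continuous (ltW a0) (ltW b0) uconv.

Section Grid.
Variables (M n J : nat) (h : R).
Hypothesis M12 : (12 < M)%N.
Hypothesis MB : 64 * b < a * (M - 12)%:R ^+ 2.
Hypothesis h0 : 0 < h.
Hypothesis nB : 2 * R1 / h < n%:R.

(** Two points near one cell differ by at most [4 * h] in each of four coordinates, hence by
    [8 * h]: a wall of this radius blocks the cell. It rises at most [b * d ^+ 2 = 64 * b * h ^+ 2]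
    above its level, so the spacing [66 * b * h ^+ 2] and the offset [b * h ^+ 2] leave a margin on
    both sides of each layer. *)
Let d := 8 * h.
Let tau := 66 * b * h ^+ 2.
Let lev (j : nat) := s0 + j%:R * tau + b * h ^+ 2.
Hypothesis top : s0 + J%:R * tau <= s1.

Definition grid := {ffun 'I_4 -> 'I_n}.

(** The tolerance is twice the side of a cell, so that the cell of a point captures the whole ball
    of radius [h] about it. *)
Definition near_cell (k : grid) y := forall i, `|rcoord i y + R1 - (k i)%:R * h| <= 2 * h.

Definition cell_color (j : nat) (k : grid) :=
  same_digits M j (k (@Ordinal 4 0 isT)) (k (@Ordinal 4 1 isT))
    (k (@Ordinal 4 2 isT)) (k (@Ordinal 4 3 isT)).

Definition cell_meets j k := exists y, near_cell k y /\ u y = lev j.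

Definition cell_point j k : Cplx2 R := xget 0 [set y | near_cell k y /\ u y = lev j].

Lemma cell_pointP j k : cell_meets j k -> near_cell k (cell_point j k) /\ u (cell_point j k) = lev j.
Proof. by move=> [y hy]; rewrite /cell_point; case: xgetP => [? _ //|/(_ y)]. Qed.

(* The layer at level [lev j] only blocks the grid cells whose coordinates
   modulo [M] are the digits of [j], so that its walls are far apart. *)
Definition layer j : seq (Cplx2 R * Cplx2 R) :=
  undup [seq (cell_point j k, gr (cell_point j k)) |
    k <- [seq k <- enum {: grid} | cell_color j k && `[< cell_meets j k >]]].

Lemma layerP j o : o \in layer j -> exists k, [/\ cell_color j k, cell_meets j k &
  o = (cell_point j k, gr (cell_point j k))].
Proof.
rewrite mem_undup => /mapP[k]; rewrite mem_filter => /andP[/andP[ck /asboolP mk] _] ->.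
by exists k.
Qed.

Lemma mem_layer j k : cell_color j k -> cell_meets j k ->
  (cell_point j k, gr (cell_point j k)) \in layer j.
Proof.
move=> ck mk; rewrite mem_undup; apply/mapP; exists k => //.
by rewrite mem_filter ck mem_enum andbT; apply/asboolP.
Qed.

Lemma cell_diam k y y' : near_cell k y -> near_cell k y' -> nrm (y - y') <= d.
Proof.
move=> hy hy'; rewrite /d (_ : 8 * h = 2 * (4 * h)); last by ring.
apply: nrm_rcoord => i; rewrite rcoordB.
have := hy i; have := hy' i; rewrite !ler_norml => /andP[? ?] /andP[? ?].
by apply/andP; split; lra.
Qed.

Lemma layer_level j o : o \in layer j -> o.2 = gr o.1 /\ u o.1 = lev j.
Proof. by move=> /layerP[k [_ /cell_pointP[_ h2] ->]]. Qed.

Lemma wall_level j o y : o \in layer j -> wall d o y -> u y <= lev j + 64 * b * h ^+ 2.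
Proof.
move=> /layer_level[g2 ul] [h1 h2]; have [_] := uconv o.1 y.
rewrite -g2 h1 addr0 ul => /le_trans; apply; rewrite lerD2l.
have : nrm (y - o.1) ^+ 2 <= d ^+ 2.
  by rewrite lerXn2r ?nnegrE ?nrm_ge0// /d mulr_ge0// ltW.
rewrite /d => hh; have := ler_wpM2l (ltW b0) hh; lra.
Qed.

Lemma below_level j o y : o \in layer j -> u y < lev j -> below o y.
Proof.
move=> /layer_level[g2 ul] uy; have [+ _] := uconv o.1 y.
have : 0 <= a * nrm (y - o.1) ^+ 2 by rewrite mulr_ge0 ?sqr_ge0// ltW.
by rewrite /below -g2 ul; lra.
Qed.

Let bh0 : 0 < b * h ^+ 2.
Proof. by rewrite mulr_gt0// exprn_gt0. Qed.

Lemma lev_lt j j' : (j < j')%N -> lev j + 64 * b * h ^+ 2 < lev j'.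
Proof.
move=> jj'; have : j%:R + 1 <= j'%:R :> R by rewrite natr1 ler_nat.
rewrite /lev /tau => hj.
have bh := bh0; have := ler_wpM2r (ltW bh) hj; lra.
Qed.

Lemma same_digit_far k1 k2 c : (k1 = c %[mod M])%N -> (k2 = c %[mod M])%N -> k1 != k2 ->
  (k1 + M <= k2)%N \/ (k2 + M <= k1)%N.
Proof.
move=> e1 e2 ne.
have e : (k1 = k2 %[mod M])%N by rewrite e1 e2.
have main i j : (i = j %[mod M])%N -> (i < j)%N -> (i + M <= j)%N.
  move=> exy xy; have : (M %| j - i)%N by rewrite -eqn_mod_dvd ?(ltnW xy)// eq_sym; apply/eqP.
  by move=> /(dvdn_leq _); rewrite subn_gt0 => /(_ xy); lia.
by move: ne; rewrite neq_ltn => /orP[] lt; [left|right]; apply: main.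
Qed.

(** Grid indices used in one layer are congruent modulo [M], so distinct ones are [M] cells apart in
    some coordinate. Losing [4 * h] for the position of the centres near their cells and [8 * h] for
    the radius leaves [(M - 12) * h]. At that distance [u] exceeds its tangent affine function at
    the other centre by more than a wall can rise, so the point is below the other hyperplane. *)
Lemma layer_far j o o' y : o \in layer j -> o' \in layer j -> o != o' ->
  wall d o y -> below o' y.
Proof.
move=> oj oj' ne wy.
have [k [ck mk oE]] := layerP oj; have [k' [ck' mk' oE']] := layerP oj'.
have kk : k != k' by apply: contraNneq ne => e; rewrite oE oE' e.
have [i ki] : exists i, k i != k' i.
  apply/existsP; rewrite -negb_forall; apply: contra kk => /forallP e.
  by apply/eqP/ffunP => i; apply/eqP.
have far : (k i + M <= k' i)%N \/ (k' i + M <= k i)%N.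
  have [c e1 e2] : exists2 c, (k i = c %[mod M])%N & (k' i = c %[mod M])%N.
    move: ck ck' => /and4P[/eqP c1 /eqP c2 /eqP c3 /eqP c4] /and4P[/eqP c1' /eqP c2' /eqP c3' /eqP c4'].
    case: i {ki} => -[|[|[|[|//]]]] im.
    - by exists j; rewrite (_ : Ordinal im = @Ordinal 4 0 isT)//; exact/val_inj.
    - by exists (j %/ M)%N; rewrite (_ : Ordinal im = @Ordinal 4 1 isT)//; exact/val_inj.
    - by exists (j %/ M %/ M)%N; rewrite (_ : Ordinal im = @Ordinal 4 2 isT)//; exact/val_inj.
    - by exists (j %/ M %/ M %/ M)%N; rewrite (_ : Ordinal im = @Ordinal 4 3 isT)//; exact/val_inj.
  exact: same_digit_far e1 e2 ki.
have [h1 _] := cell_pointP mk; have [h1' _] := cell_pointP mk'.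
have dist : (M - 12)%:R * h <= nrm (y - o'.1).
  have : (M%:R - 4) * h <= nrm (o.1 - o'.1).
    apply: le_trans (rcoord_le i _); rewrite rcoordB oE oE' /=.
    have := h1 i; have := h1' i; rewrite !ler_norml => /andP[u1 u2] /andP[u3 u4].
    case: far; rewrite -(ler_nat R) natrD => fi; have := ler_wpM2r (ltW h0) fi.
      by move=> hh; rewrite ler_normr; apply/orP; right; lra.
    by move=> hh; rewrite ler_normr; apply/orP; left; lra.
  have [_ w2] := wy; have := nrm_triangle y o.1 o'.1; rewrite (nrmBC o.1 y).
  rewrite natrB; last exact: ltnW.
  by move: w2; rewrite /d; lra.
have wl := wall_level oj wy; have [g2 ul] := layer_level oj'.
have [+ _] := uconv o'.1 y; rewrite -g2 ul /below.
have : 64 * b * h ^+ 2 < a * nrm (y - o'.1) ^+ 2.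
  apply: (@lt_le_trans _ _ (a * ((M - 12)%:R * h) ^+ 2)).
    have h2 : 0 < h ^+ 2 by rewrite exprn_gt0.
    by have := MB; rewrite -(ltr_pM2r h2); lra.
  rewrite ler_wpM2l ?(ltW a0)// lerXn2r ?nnegrE ?nrm_ge0//.
  by rewrite mulr_ge0// ltW.
lra.
Qed.

Fixpoint grid_walls j := if j is j'.+1 then grid_walls j' ++ layer j' else [::].

Lemma grid_wallsP j o : o \in grid_walls j -> exists2 j', (j' < j)%N & o \in layer j'.
Proof.
elim: j => //= j ih; rewrite mem_cat => /orP[/ih[j' jj' h1]|h1].
  by exists j' => //; exact: ltnW.
by exists j.
Qed.

Lemma mem_grid_walls j j' o : (j' < j)%N -> o \in layer j' -> o \in grid_walls j.
Proof.
elim: j => //= j ih; rewrite ltnS leq_eqVlt mem_cat => /orP[/eqP ->|/ih hh] ho.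
  by rewrite ho orbT.
by rewrite hh.
Qed.

(** Within a layer distinct walls are below one another in both directions, so any enumeration
    works; across layers, a wall does not rise to the next level, and what is under a level is below
    the hyperplanes tangent to it. *)
Lemma grid_walls_ordered j : ordered_walls d (grid_walls j).
Proof.
elim: j => //= j ih; apply: pairwise_prop_cat => //.
  apply: pairwise_prop_uniq; first exact: undup_uniq.
  by move=> o o' h1 h2 ne y; exact: layer_far h1 h2 ne.
move=> o o' /grid_wallsP[j' jj' h1] h2 y wy.
by apply: (below_level h2); apply: le_lt_trans (wall_level h1 wy) (lev_lt jj').
Qed.

Lemma grid_walls_below o y : o \in grid_walls J -> u y <= s0 -> below o y.
Proof.
move=> /grid_wallsP[j _ hj] uy; apply: (below_level hj).
apply: le_lt_trans uy _; rewrite /lev /tau.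
have : 0 <= j%:R * (66 * b * h ^+ 2) by rewrite -mulrA !mulr_ge0// ltW.
have bh := bh0; lra.
Qed.

Lemma grid_walls_level o y : o \in grid_walls J -> wall d o y -> u y <= s1.
Proof.
move=> /grid_wallsP[j jJ hj] wy; apply: le_trans (wall_level hj wy) _.
apply: le_trans top; have := lev_lt jJ; rewrite /lev.
have : j%:R + 1 <= J%:R :> R by rewrite natr1 ler_nat.
have bh := bh0; move=> hh; have := ler_wpM2r (ltW bh) hh; rewrite /tau; lra.
Qed.

Lemma cell_of x : u x <= s1 -> exists k : grid, forall y, nrm (y - x) < h -> near_cell k y.
Proof.
move=> ux; have xR := ubound ux.
have R10 : 0 <= R1 by apply: le_trans xR; exact: nrm_ge0.
have cx i : - R1 <= rcoord i x <= R1 by rewrite -ler_norml; exact: le_trans (rcoord_le _ _) xR.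
have idx i : (Num.truncn ((rcoord i x + R1) / h) < n)%N.
  rewrite -(ltr_nat R); apply: le_lt_trans nB.
  have := cx i => /andP[cx1 cx2].
  have hh : 0 <= (rcoord i x + R1) / h by apply: divr_ge0; [lra|exact: ltW].
  have /andP[+ _] := truncn_itv hh; move=> /le_trans; apply.
  by rewrite ler_pM2r ?invr_gt0//; lra.
exists [ffun i => Ordinal (idx i)] => y hy i; rewrite ffunE /=.
have := cx i => /andP[cx1 cx2].
have hh : 0 <= (rcoord i x + R1) / h by apply: divr_ge0; [lra|exact: ltW].
have := truncn_itv hh; set m := Num.truncn _ => /andP[m1 m2].
rewrite ler_pdivlMr// in m1; rewrite ltr_pdivrMr// -natr1 in m2.
have := le_lt_trans (rcoord_le i (y - x)) hy; rewrite rcoordB ltr_norml => /andP[y1 y2].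
by rewrite ler_norml; apply/andP; split; lra.
Qed.

(* A curve shorter than [h] stays near one grid cell, which is blocked by one of
   any [M ^ 4] consecutive layers. *)
Lemma crossing_group (g : nat) (s : R -> Cplx2 R) (l : R -> R) (t0 t1 : R) :
  (g.+1 * M ^ 4 <= J)%N -> curve_continuous s -> t0 <= t1 ->
  (forall c e, t0 <= c -> c <= e -> e <= t1 -> nrm (s e - s c) <= l e - l c) ->
  (forall t, t0 <= t <= t1 -> ~ walls d (grid_walls J) (s t)) ->
  u (s t0) <= s0 + (g * M ^ 4)%:R * tau -> u (s t1) = s0 + (g.+1 * M ^ 4)%:R * tau ->
  h <= l t1 - l t0.
Proof.
move=> gJ cs t01 hl av u0 u1; rewrite leNgt; apply/negP => lt.
have tau0 : 0 < tau by rewrite /tau -mulrA mulr_gt0.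
have close t : t0 <= t -> t <= t1 -> nrm (s t - s t1) < h.
  move=> h1 h2; rewrite nrmBC; apply: le_lt_trans (hl _ _ h1 h2 (lexx _)) _.
  have := hl _ _ (lexx _) h1 h2; have := nrm_ge0 (s t - s t0); lra.
have us1 : u (s t1) <= s1.
  by rewrite u1; apply: le_trans top; rewrite lerD2l ler_wpM2r ?(ltW tau0)// ler_nat.
have [k hk] := cell_of us1.
have [j [j1 j2 ck]] := @same_digits_ex M (k (@Ordinal 4 0 isT)) (k (@Ordinal 4 1 isT))
  (k (@Ordinal 4 2 isT)) (k (@Ordinal 4 3 isT)) g (leq_trans (ltn0Sn _) M12).
have lj1 : u (s t0) < lev j.
  apply: le_lt_trans u0 _; rewrite /lev.
  have : (g * M ^ 4)%:R * tau <= j%:R * tau by rewrite ler_wpM2r ?(ltW tau0)// ler_nat.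
  have bh := bh0; lra.
have lj2 : lev j + 64 * b * h ^+ 2 < u (s t1).
  rewrite u1; have : j.+1%:R * tau <= (g.+1 * M ^ 4)%:R * tau.
    by rewrite ler_wpM2r ?(ltW tau0)// ler_nat.
  rewrite -natr1 mulrDl mul1r /lev /tau; have bh := bh0; lra.
have b64 : 0 < 64 * b * h ^+ 2 by rewrite -mulrA mulr_gt0.
have [t [tt0 tt1 ut]] := curve_ivt (v := lev j) cs ucont t01 (ltW lj1) ltac:(lra).
have mk : cell_meets j k by exists (s t); split=> //; apply: hk; exact: close.
have [nx ux] := cell_pointP mk; set x := cell_point j k in nx ux.
have ol := mem_layer ck mk; rewrite -/x in ol.
have oJ : (x, gr x) \in grid_walls J.
  by apply: mem_grid_walls ol; exact: leq_trans j2 gJ.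
(* The affine form of the hyperplane of the wall. It is negative at the start, which is under the
   level, and nonnegative at the end, which is higher than the wall can rise; so the curve crosses
   the hyperplane, within [d] of the centre. *)
pose f y := dot (gr x) (y - x).
have cf : continuous f.
  apply: (@lipschitz_Cplx2_continuous _ _ (nrm (gr x))) => p q.
  rewrite /f -dotBr opprB addrA subrK.
  by rewrite ler_norml dot_le dot_ge.
have nn t' : t0 <= t' -> t' <= t1 -> nrm (s t' - x) <= d.
  by move=> h1 h2; apply: cell_diam => //; apply: hk; exact: close.
have f0 : f (s t0) <= 0 by apply: ltW; exact: (below_level ol lj1).
have f1 : 0 <= f (s t1).
  have [_] := uconv x (s t1); rewrite -/(f (s t1)) ux.
  have : nrm (s t1 - x) ^+ 2 <= d ^+ 2.
    by rewrite lerXn2r ?nnegrE ?nrm_ge0 ?nn// /d mulr_ge0// ltW.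
  rewrite /d => hh; have := ler_wpM2l (ltW b0) hh; lra.
have [t' [a1 a2 ft']] := curve_ivt cs cf t01 f0 f1.
apply: (av t'); first by rewrite a1.
by exists (x, gr x) => //; split => //; exact: nn.
Qed.

(** The curve is cut at a time when it is on the level that ends the preceding groups; the last
    group costs [h] more. *)
Lemma crossing_groups (G : nat) (s : R -> Cplx2 R) (l : R -> R) (t1 : R) :
  (G * M ^ 4 <= J)%N -> curve_continuous s -> 0 <= t1 ->
  (forall c e, 0 <= c -> c <= e -> e <= t1 -> nrm (s e - s c) <= l e - l c) ->
  (forall t, 0 <= t <= t1 -> ~ walls d (grid_walls J) (s t)) ->
  u (s 0) <= s0 -> s0 + (G * M ^ 4)%:R * tau <= u (s t1) ->
  G%:R * h <= l t1 - l 0.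
Proof.
have tau0 : 0 < tau by rewrite /tau -mulrA mulr_gt0.
elim: G t1 => [|G ih] t1 GJ cs t10 hl av u0 u1.
  by rewrite mul0r; apply: le_trans (nrm_ge0 _) (hl _ _ (lexx _) t10 (lexx _)).
have pos k : 0 <= k%:R * tau by rewrite mulr_ge0// ltW.
have [|t [ta tb ut]] := curve_ivt (v := s0 + (G.+1 * M ^ 4)%:R * tau) cs ucont t10 _ u1.
  by apply: le_trans u0 _; rewrite lerDl.
have [||t' [ta' tb' ut']] := curve_ivt (v := s0 + (G * M ^ 4)%:R * tau) cs ucont ta.
- by apply: le_trans u0 _; rewrite lerDl.
- by rewrite ut lerD2l ler_wpM2r ?(ltW tau0)// ler_nat leq_mul2r leqnSn orbT.
have i1 : G%:R * h <= l t' - l 0.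
  apply: ih => //; last by rewrite ut'.
  - by apply: leq_trans GJ; rewrite leq_mul2r leqnSn orbT.
  - by move=> c e c0 ce et; apply: hl => //; lra.
  - by move=> e /andP[e0 et]; apply: av; lra.
have i2 : h <= l t - l t'.
  apply: (@crossing_group G s) => //; rewrite ?ut'//.
  - by move=> c e c0 ce et; apply: hl => //; lra.
  - by move=> e /andP[e0 et]; apply: av; lra.
have := hl t t1 ta tb (lexx _); have := nrm_ge0 (s t1 - s t).
rewrite -natr1 mulrDl mul1r; lra.
Qed.

End Grid.

(** A group of [M ^ 4] layers has height of order [h ^+ 2] and costs length [h], while [M] depends
    only on [a] and [b]. With [G] about [1 / h] groups the cost is at least 1 and the total height
    is of order [h], which fits between any two levels when [h] is small. *)
Lemma labyrinth : exists d obs, 0 < d /\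
  [/\ forall o y, o \in obs -> u y <= s0 -> below o y,
      ordered_walls d obs,
      forall o y, o \in obs -> wall d o y -> u y <= s1 &
      forall p q L, u p <= s0 -> s1 <= u q ->
        rect_curve (~` walls d obs) p q L -> 1 <= L].
Proof.
pose m := (Num.truncn (64 * b / a)).+1.
(* 12 is the loss computed in [layer_far]; [m > 64 * b / a] and [m >= 1] give
   [m ^ 2 > 64 * b / a]. *)
pose M := (12 + m)%N.
have M12 : (12 < M)%N by rewrite /M /m; lia.
have MB : 64 * b < a * (M - 12)%:R ^+ 2.
  have : 64 * b / a < m%:R by exact: truncnS_gt.
  rewrite ltr_pdivrMr// => hm; rewrite /M addKn.
  have m1 : 1 <= m%:R :> R by rewrite ler1n.
  have : m%:R <= m%:R ^+ 2 :> R by rewrite expr2 ler_peMr//; lra.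
  move=> /(ler_wpM2l (ltW a0)); lra.
pose m4 : R := (M ^ 4)%:R.
have m40 : 0 < m4 by rewrite ltr0n expn_gt0.
(* Since [G * h ^+ 2 <= 2 * h], the layers take height at most [132 * b * m4 * h]. *)
pose h := Num.min 1 ((s1 - s0) / (132 * b * m4)).
have bm : 0 < 132 * b * m4 by rewrite !mulr_gt0.
have h0 : 0 < h by rewrite lt_min ltr01 divr_gt0// subr_gt0.
have h1 : h <= 1 by rewrite ge_min lexx.
have hs : h * (132 * b * m4) <= s1 - s0 by rewrite -ler_pdivlMr// ge_min lexx orbT.
pose n := (Num.truncn (2 * R1 / h)).+1.
have nB : 2 * R1 / h < n%:R by exact: truncnS_gt.
pose G := (Num.truncn h^-1).+1.
have G1 : 1 <= G%:R * h.
  by rewrite -ler_pdivrMr// div1r ltW//; exact: truncnS_gt.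
have G2 : G%:R <= h^-1 + 1.
  have hi : 0 <= h^-1 by rewrite invr_ge0 ltW.
  by rewrite /G -natr1 lerD2r; have /andP[] := truncn_itv hi.
pose J := (G * M ^ 4)%N.
have top : s0 + J%:R * (66 * b * h ^+ 2) <= s1.
  rewrite /J natrM -/m4.
  have e1 : G%:R * h ^+ 2 <= 2 * h.
    apply: (@le_trans _ _ ((h^-1 + 1) * h ^+ 2)); first by rewrite ler_wpM2r ?sqr_ge0.
    have -> : (h^-1 + 1) * h ^+ 2 = h + h ^+ 2 by field; rewrite gt_eqF.
    nra.
  have : 0 <= 66 * b * m4 by rewrite !mulr_ge0// ltW.
  move=> bm0; have := ler_wpM2l bm0 e1; lra.
have JG : (G * M ^ 4 <= J)%N by [].
clearbody J n G h M.
exists (8 * h), (grid_walls M n h J); split; first by rewrite mulr_gt0.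
split.
- by move=> o y; exact: grid_walls_below.
- exact: (grid_walls_ordered M12 MB h0 nB top).
- by move=> o y; exact: grid_walls_level.
move=> p q L up uq [t1 [s [l [[t10 sp sq lL cs] [hl av]]]]].
apply: le_trans G1 _; rewrite -lL.
apply: (crossing_groups M12 h0 nB top JG cs t10 hl av).
- by rewrite sp.
- rewrite sq; apply: le_trans uq; apply: le_trans top; rewrite lerD2l.
  by rewrite ler_wpM2r ?ler_nat// !mulr_ge0// ?exprn_ge0// ltW.
Qed.

End Labyrinth.

(** Completeness of the space of parameters, for Baire's theorem. *)
HB.instance Definition _ (R : realType) (m n : nat) := Complete.on 'M[R]_(m, n).

(** * Generic perturbations *)

Section Generic.
Variable R : realType.
Implicit Types (p q : Cplx2 R) (D : set (Cplx2 R)).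

(* The image of a bounded part of R^4 under a Lipschitz map to R^6 is nowhere
   dense: about m^4 cells of side 1/m cannot meet all of N^6 >> m^4 balls. *)
Lemma lipschitz_image_avoid D (Phi : Cplx2 R -> 'rV[R]_6) (r L : R) :
  0 < r -> 0 < L -> (forall p, D p -> nrm p <= r) ->
  (forall p q j, D p -> D q -> `|Phi p ord0 j - Phi q ord0 j| <= L * nrm (p - q)) ->
  forall (c : 'rV[R]_6) e, 0 < e -> exists c' : 'rV[R]_6,
    (forall j, `|c' ord0 j - c ord0 j| <= e) /\
    exists2 r', 0 < r' & forall p, D p -> exists j, r' < `|Phi p ord0 j - c' ord0 j|.
Proof.
move=> r0 L0 hr hL c e e0.
(* The candidates have spacing [4 * rho = A * e / m], so [N] of them per axis fit in length [e]
   because [m > N * A]. As [m] is at most [N * A + 1], the number of cells is at most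
   [(N * (A + 2)) ^ 4], which is less than [N ^ 6] because [N > (A + 2) ^ 2]. *)
pose A := 32 * L * r / e; have A0 : 0 < A by rewrite divr_gt0// !mulr_gt0.
pose N := (Num.truncn ((A + 2) ^+ 2)).+1.
have N1 : (A + 2) ^+ 2 < N%:R by exact: truncnS_gt.
have Np : 1 <= N%:R :> R by rewrite ler1n.
pose m := (Num.truncn (N%:R * A)).+1.
have m1 : N%:R * A < m%:R by exact: truncnS_gt.
have m0 : 0 < m%:R :> R by rewrite ltr0n.
have m2 : m%:R <= N%:R * A + 1.
  have NA : 0 <= N%:R * A by rewrite mulr_ge0// ltW.
  by rewrite /m -natr1 lerD2r; have /andP[] := truncn_itv NA.
pose hh := 2 * r / m%:R; have hh0 : 0 < hh by rewrite divr_gt0// mulr_gt0.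
pose rho := 4 * L * hh; have rho0 : 0 < rho by do 2 (apply: mulr_gt0 => //).
have Ns : N%:R * (4 * rho) <= e.
  have -> : N%:R * (4 * rho) = N%:R * A * e / m%:R.
    by rewrite /rho /hh /A; field; rewrite !gt_eqF.
  by rewrite ler_pdivrMr// mulrC ler_wpM2l// ltW.
pose cand (v : {ffun 'I_6 -> 'I_N}) : 'rV[R]_6 :=
  \row_j (c ord0 j + (v j)%:R * (4 * rho)).
apply: contrapT => none.
have bad (v : {ffun 'I_6 -> 'I_N}) : exists p, D p /\ forall j, `|Phi p ord0 j - cand v ord0 j| <= rho.
  apply: contrapT => nv; apply: none; exists (cand v); split.
    move=> j; rewrite mxE addrC addKr ger0_norm; last by rewrite !mulr_ge0// ltW.
    apply: le_trans Ns; apply: ler_wpM2r; first by rewrite mulr_ge0// ltW.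
    by rewrite ler_nat ltnW.
  exists rho => // p Dp; apply: contrapT => hp; apply: nv; exists p; split=> // j.
  by rewrite leNgt; apply/negP => lt; apply: hp; exists j.
have cell p : D p -> exists k : {ffun 'I_4 -> 'I_m.+1},
    forall i, `|rcoord i p + r - (k i)%:R * hh| <= hh.
  move=> Dp; have cx i : 0 <= rcoord i p + r <= 2 * r.
    have := le_trans (rcoord_le i p) (hr p Dp).
    by rewrite ler_norml => /andP[? ?]; apply/andP; split; lra.
  have x0 i : 0 <= (rcoord i p + r) / hh.
    by have /andP[? _] := cx i; apply: divr_ge0 => //; exact: ltW.
  have idx i : (Num.truncn ((rcoord i p + r) / hh) < m.+1)%N.
    rewrite ltnS -(ler_nat R); have /andP[+ _] := truncn_itv (x0 i); move=> /le_trans; apply.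
    rewrite ler_pdivrMr// /hh mulrCA mulfV ?mulr1 ?gt_eqF//.
    by have /andP[] := cx i.
  exists [ffun i => Ordinal (idx i)] => i; rewrite ffunE /=.
  have := truncn_itv (x0 i); set t := Num.truncn _ => /andP[t1 t2].
  rewrite ler_pdivlMr// in t1; rewrite ltr_pdivrMr// -natr1 in t2.
  by rewrite ler_norml; apply/andP; split; lra.
have [P hP] : exists P : {ffun 'I_6 -> 'I_N} -> Cplx2 R, forall v, D (P v) /\
    forall j, `|Phi (P v) ord0 j - cand v ord0 j| <= rho.
  exists (fun v => projT1 (cid (bad v))) => v; exact: projT2 (cid (bad v)).
pose K v := projT1 (cid (cell _ (hP v).1)).
have hK v i : `|rcoord i (P v) + r - (K v i)%:R * hh| <= hh.
  exact: (projT2 (cid (cell _ (hP v).1)) i).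
(* Points of one cell have images within [rho] of each other, so the two candidates they approximate
   are within [3 * rho], less than the spacing. *)
have Kinj : injective K.
  move=> v w vw; apply/ffunP => j; apply: val_inj => /=.
  have close : nrm (P v - P w) <= 4 * hh.
    rewrite (_ : 4 * hh = 2 * (2 * hh)); last by ring.
    apply: nrm_rcoord => i; rewrite rcoordB; have := hK v i; have := hK w i.
    by rewrite -vw !ler_norml => /andP[? ?] /andP[? ?]; apply/andP; split; lra.
  have h1 := hL _ _ j (hP v).1 (hP w).1.
  have h2 : L * nrm (P v - P w) <= rho.
    by have := ler_wpM2l (ltW L0) close; rewrite /rho; lra.
  have h3 := (hP v).2 j; have h4 := (hP w).2 j.
  move: (le_trans h1 h2) h3 h4; rewrite !mxE !ler_norml.
  move=> /andP[a1 a2] /andP[b1 b2] /andP[c1 c2].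
  have lt3 : `|(v j)%:R - (w j)%:R : R| < 1.
    have r4 : 0 < 4 * rho by rewrite mulr_gt0.
    rewrite ltr_norml; apply/andP; split; rewrite -(ltr_pM2r r4); lra.
  apply/eqP; rewrite eqn_leq; apply/andP; split; rewrite leqNgt; apply/negP => lt;
    move: lt3; rewrite ltr_norml => /andP[];
    have : (1 + (w j)%:R <= (v j)%:R :> R) \/ (1 + (v j)%:R <= (w j)%:R :> R).
      by left; rewrite addrC natr1 ler_nat.
    by move=> _; have : 1 + (w j)%:R <= (v j)%:R :> R by [rewrite addrC natr1 ler_nat]; lra.
    by right; rewrite addrC natr1 ler_nat.
  by move=> _; have : 1 + (v j)%:R <= (w j)%:R :> R by [rewrite addrC natr1 ler_nat]; lra.
have := leq_card K Kinj; rewrite !card_ffun !card_ord -(ler_nat R) !natrX.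
apply/negP; rewrite -ltNge.
have A2 : 0 < A + 2 by lra.
apply: (@le_lt_trans _ _ ((N%:R * (A + 2)) ^+ 4)).
  rewrite lerXn2r ?nnegrE ?mulr_ge0 ?(ltW A2)// -natr1; lra.
have N0 : 0 < N%:R :> R by rewrite ltr0n.
rewrite exprMn (_ : 6 = 4 + 2)%N// exprD ltr_pM2l ?exprn_gt0//.
rewrite (_ : 4 = 2 * 2)%N// exprM ltr_pXn2r ?nnegrE ?sqr_ge0//.
Qed.

Lemma rV_nbhsP n (x : 'rV[R]_n.+1) (A : set 'rV[R]_n.+1) : nbhs x A <->
  exists2 e : R, 0 < e & forall y : 'rV[R]_n.+1, (forall j, `|y ord0 j - x ord0 j| < e) -> A y.
Proof.
split.
  move=> /nbhs_ballP[e /= e0 he]; exists e => // y hy; apply: he; split=> // i j.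
  by rewrite (ord1 i) /ball /= distrC.
move=> [e e0 he]; apply/nbhs_ballP; exists e => // y [_ hy]; apply: he => j.
by have := hy ord0 j; rewrite /ball /= distrC.
Qed.

(* The triple [(a, b, d)], as a real vector, for which [p] is a singular zero of
   the perturbation of [J] by [a z + b w + d]. *)
Definition singular_data (J : jet R) p : 'rV[R]_6 :=
  let s := j0 J p - jz J p * p.1 - jw J p * p.2 in
  \row_j - match val j with
    | 0%N => complex.Re (jz J p) | 1%N => complex.Im (jz J p)
    | 2%N => complex.Re (jw J p) | 3%N => complex.Im (jw J p)
    | 4%N => complex.Re s | _ => complex.Im s end.

Lemma singular_data_lipschitz J D (r c : R) : 0 <= r -> (forall p, D p -> nrm p <= r) ->
  jbound J D c -> forall p q j, D p -> D q ->
  `|singular_data J p ord0 j - singular_data J q ord0 j| <=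
    (`|c| * (3 + 2 * r)) * nrm (p - q).
Proof.
move=> r0 hr hJ p q j Dp Dq; set n := nrm (p - q); have n0 : 0 <= n := nrm_ge0 _.
have {}hJ : jbound J D `|c| by apply: jbound_le hJ; exact: ler_norm.
set k := `|c| in hJ *; have k0 : 0 <= k by rewrite normr_ge0.
have h0 := hJ 6 _ _ Dq Dp; have h1 := hJ 7 _ _ Dq Dp; have h2 := hJ 8 _ _ Dq Dp.
rewrite /= -/n in h0 h1 h2.
have z1 := hJ 1%N _ _ Dp Dp; have w1 := hJ 2 _ _ Dp Dp; rewrite /= mulr1 in z1 w1.
have q1 : cabs q.1 <= r by exact: le_trans (cabs1_le _) (hr _ Dq).
have q2 : cabs q.2 <= r by exact: le_trans (cabs2_le _) (hr _ Dq).
have d1 : cabs (p.1 - q.1) <= n by exact: (cabs1_le (p - q)).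
have d2 : cabs (p.2 - q.2) <= n by exact: (cabs2_le (p - q)).
have kn : 0 <= k * n by rewrite mulr_ge0.
have rkn : 0 <= r * (k * n) by rewrite mulr_ge0.
pose s p := j0 J p - jz J p * p.1 - jw J p * p.2.
have hs : cabs (s p - s q) <= k * (3 + 2 * r) * n.
  have -> : s p - s q = (j0 J p - j0 J q) -
    ((jz J p * (p.1 - q.1) + (jz J p - jz J q) * q.1) +
     (jw J p * (p.2 - q.2) + (jw J p - jw J q) * q.2)) by rewrite /s; ring.
  apply: le_trans (cabs_leB h0 (cabs_leD (cabs_leD (cabs_leM z1 d1) (cabs_leM h1 q1))
    (cabs_leD (cabs_leM w1 d2) (cabs_leM h2 q2)))) _.
  lra.
have m1 : k * n <= k * (3 + 2 * r) * n by lra.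
have re (u v : Cplx R) : cabs (u - v) <= k * (3 + 2 * r) * n ->
    `|- complex.Re u - - complex.Re v| <= k * (3 + 2 * r) * n.
  by move=> h; rewrite -opprD normrN -ReN -ReD; exact: le_trans (Re_le_cabs _) h.
have im (u v : Cplx R) : cabs (u - v) <= k * (3 + 2 * r) * n ->
    `|- complex.Im u - - complex.Im v| <= k * (3 + 2 * r) * n.
  by move=> h; rewrite -opprD normrN -ImN -ImD; exact: le_trans (Im_le_cabs _) h.
rewrite !mxE; case: j => -[|[|[|[|[|[|//]]]]]] /= _.
- by apply: re; exact: le_trans m1.
- by apply: im; exact: le_trans m1.
- by apply: re; exact: le_trans m1.
- by apply: im; exact: le_trans m1.
- exact: re.
- exact: im.
Qed.

(** A singular zero [p] of the perturbed function determines the parameters, as [singular_data J p].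
    It is thus enough to take small parameters outside the images of all the bounded sets [C n]. *)
Lemma generic_affine_perturbation (J : jet R) (C : nat -> set (Cplx2 R)) (e : R) : 0 < e ->
  (forall n, exists r, forall p, C n p -> nrm p <= r) ->
  (forall n, exists c, jbound J (C n) c) ->
  exists a b d : Cplx R, [/\ cabs a <= e, cabs b <= e, cabs d <= e &
    forall n p, C n p -> j0 J p + (a * p.1 + b * p.2 + d) = 0 ->
      jz J p + a != 0 \/ jw J p + b != 0].
Proof.
move=> e0 hC hJ.
(* A positive distance to the image, rather than mere avoidance, makes openness immediate; density
   is [lipschitz_image_avoid]. *)
pose U n : set 'rV[R]_6 := [set c | exists2 r', 0 < r' &
  forall p, C n p -> exists j, r' < `|singular_data J p ord0 j - c ord0 j|].
have hU n : open (U n) /\ dense (U n).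
  split.
    rewrite openE => c [r' r0 hr']; apply/rV_nbhsP; exists (r' / 2); first by rewrite divr_gt0.
    move=> y hy; exists (r' / 2); first by rewrite divr_gt0.
    move=> p /hr'[j hj]; exists j.
    have := ler_distD (y ord0 j) (singular_data J p ord0 j) (c ord0 j).
    by have := hy j; lra.
  move=> O [c Oc]; rewrite openE => /(_ c Oc) /rV_nbhsP[d d0 hd].
  have [r hr] := hC n; have [k hk] := hJ n.
  have hr' p : C n p -> nrm p <= `|r| + 1.
    by move=> /hr h; apply: le_trans h _; apply: le_trans (ler_norm r) _; rewrite lerDl.
  have r10 : 0 < `|r| + 1 by rewrite ltr_wpDl.
  have L0 : 0 < `|k| * (3 + 2 * (`|r| + 1)) + 1 by rewrite ltr_wpDl// mulr_ge0//; lra.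
  have d2 : 0 < d / 2 by rewrite divr_gt0.
  have [|c' [h1 h2]] := @lipschitz_image_avoid (C n) (singular_data J) _ _ r10 L0 hr' _ c _ d2.
    move=> p q j Cp Cq; apply: le_trans (singular_data_lipschitz _ hr' hk _ Cp Cq) _.
      exact: ltW.
    by rewrite ler_wpM2r ?nrm_ge0// lerDl.
  exists c'; split=> //; apply: hd => j; apply: le_lt_trans (h1 j) _; lra.
have e2 : 0 < e / 2 by rewrite divr_gt0.
have dU : dense (\bigcap_i U i) by exact: (@Baire R 'rV[R]_6).
have [||c [hc cU]] := dU [set c | forall j, `|c ord0 j| < e / 2].
- by exists 0 => j; rewrite mxE normr0.
- rewrite openE => c hc; apply/rV_nbhsP.
  exists (\big[Num.min/1]_j (e / 2 - `|c ord0 j|)).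
    by elim/big_ind : _ => // [x y x0 y0|j _]; rewrite ?lt_min ?x0 ?subr_gt0.
  move=> y hy j; have := hy j.
  rewrite (bigD1 j)//= lt_min => /andP[+ _].
  have := lerB_dist (y ord0 j) (c ord0 j); lra.
pose o i (h : (i < 6)%N) := @Ordinal 6 i h.
exists (Complex (c ord0 (o 0%N isT)) (c ord0 (o 1%N isT))),
  (Complex (c ord0 (o 2 isT)) (c ord0 (o 3 isT))),
  (Complex (c ord0 (o 4 isT)) (c ord0 (o 5 isT))).
have small i k (hi : (i < 6)%N) (hk : (k < 6)%N) : cabs (Complex (c ord0 (o i hi)) (c ord0 (o k hk))) <= e.
  by apply: le_trans (cabs_le_ReIm _) _ => /=; have := hc (o i hi); have := hc (o k hk); lra.
split; [exact: small|exact: small|exact: small|].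
move=> n p Cp h.
have [hz|hz] := eqVneq (jz J p + Complex (c ord0 (o 0%N isT)) (c ord0 (o 1%N isT))) 0; last by left.
have [hw|hw] := eqVneq (jw J p + Complex (c ord0 (o 2 isT)) (c ord0 (o 3 isT))) 0; last by right.
exfalso; have [r' r0 /(_ p Cp)[j]] := cU n I; rewrite ltNge => /negP; apply.
suff -> : singular_data J p ord0 j = c ord0 j by rewrite subrr normr0 ltW.
have ez : jz J p = - Complex (c ord0 (o 0%N isT)) (c ord0 (o 1%N isT)) by apply/eqP; rewrite -addr_eq0 hz.
have ew : jw J p = - Complex (c ord0 (o 2 isT)) (c ord0 (o 3 isT)) by apply/eqP; rewrite -addr_eq0 hw.
have es : j0 J p - jz J p * p.1 - jw J p * p.2 = - Complex (c ord0 (o 4 isT)) (c ord0 (o 5 isT)).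
  by rewrite ez ew; apply/eqP; rewrite -addr_eq0 -h; apply/eqP; ring.
rewrite mxE es ez ew !ReImE /=.
case: j => -[|[|[|[|[|[|//]]]]]] /= hj; rewrite ?opprK; congr (c _ _); exact/val_inj.
Qed.

End Generic.

(** * Functions large on the walls *)

Section WallFunctions.
Variable R : realType.
Implicit Types (x y p q : Cplx2 R) (o : (Cplx2 R * Cplx2 R)%type) (E : set (Cplx2 R)).
Local Notation dot := (@euclidean_metric R).

(** What is kept of polynomiality: estimates on every bounded set, also far outside the sets where
    the jet is small. *)
Definition poly_jet (J : jet R) := forall K (r : R), (forall p, K p -> nrm p <= r) ->
  exists c, jbound J K c.

Lemma wall_compact (d : R) o : compact (wall d o).
Proof.
apply: (@closed_bounded_compact _ _ (d + nrm o.1)); last first.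
  move=> y [_ hy]; have := nrmD (y - o.1) o.1; rewrite subrK; lra.
apply/Cplx2_closedP => p hp; split.
  apply/eqP; rewrite -normr_eq0 eq_le normr_ge0 andbT.
  apply/ler_addgt0Pr => e e0; rewrite add0r.
  have n0 : 0 < nrm o.2 + 1 by rewrite ltr_wpDl// nrm_ge0.
  have [q [hq _] qp] := hp _ (divr_gt0 e0 n0).
  have -> : dot o.2 (p - o.1) = dot o.2 (p - q).
    have pq : p - q = (p - o.1) - (q - o.1) by rewrite opprB addrA subrK.
    by rewrite pq [RHS]dotBr hq subr0.
  rewrite nrmBC ltr_pdivlMr// in qp.
  have := dot_le o.2 (p - q); have := dot_ge o.2 (p - q); have := nrm_ge0 (p - q).
  by rewrite ler_norml => n1 n2 n3; apply/andP; split; lra.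
apply/ler_addgt0Pr => e e0; have [q [_ hq] qp] := hp e e0.
by have := nrm_triangle q p o.1; rewrite (nrmBC p q); lra.
Qed.

(* The real half-space [{Re L < 0}] is approximated by large discs
   [{|L + P| < P}], so that powers of [(L + delta/2) / P + 1] separate. *)
Lemma wall_separation (d : R) o E : compact E -> (forall y, E y -> below o y) ->
  exists (a b c : Cplx R) (q eta : R), [/\ 0 <= q, q < 1, 0 < eta,
    forall y, E y -> cabs (a * y.1 + b * y.2 + c) <= q &
    forall y, wall d o y -> 1 + eta <= cabs (a * y.1 + b * y.2 + c)].
Proof.
move=> cE hE.
(* The complex-linear form whose real part is the dot product with [o.2]. *)
pose L (h : Cplx2 R) : Cplx R := (conjc o.2.1) * h.1 + (conjc o.2.2) * h.2.
have ReL h : complex.Re (L h) = dot o.2 h.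
  rewrite /L /euclidean_metric !ReImE; case: o.2.1 => ? ?; case: o.2.2 => ? ? /=; ring.
have [delta d0 hd] : exists2 delta, 0 < delta & forall y, E y -> dot o.2 (y - o.1) <= - delta.
  have [[y0 Ey0]|nE] := pselect (E !=set0); last first.
    by exists 1 => // y Ey; exfalso; apply: nE; exists y.
  have cf : {within E, continuous (fun y => dot o.2 (y - o.1))}.
    apply: continuous_subspaceT; apply: (@lipschitz_Cplx2_continuous _ _ (nrm o.2)) => p q.
    by rewrite -dotBr opprB addrA subrK ler_norml dot_le dot_ge.
  have [y1 Ey1 hy1] := compact_EVT_max (ex_intro _ y0 Ey0) cE cf.
  exists (- dot o.2 (y1 - o.1)); first by rewrite oppr_gt0; apply: hE; rewrite inE in Ey1.
  by move=> y Ey; rewrite opprK; apply: hy1; rewrite inE.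
have [r hr] := compact_bounded cE.
pose W := 2 * nrm o.2 * (`|r| + nrm o.1).
have hW y : E y -> cabs (L (y - o.1)) <= W.
  move=> Ey; have n1 : nrm (y - o.1) <= `|r| + nrm o.1.
    apply: le_trans (nrmD _ _) _; rewrite nrmN lerD2r.
    exact: le_trans (hr _ Ey) (ler_norm r).
  have c1 (z : Cplx R) : cabs (conjc z) = cabs z by case: z => u v; rewrite /cabs /= sqrrN.
  have b1 : cabs (conjc o.2.1 * (y - o.1).1) <= nrm o.2 * (`|r| + nrm o.1).
    by apply: cabs_leM; [rewrite c1; exact: cabs1_le|exact: le_trans (cabs1_le _) n1].
  have b2 : cabs (conjc o.2.2 * (y - o.1).2) <= nrm o.2 * (`|r| + nrm o.1).
    by apply: cabs_leM; [rewrite c1; exact: cabs2_le|exact: le_trans (cabs2_le _) n1].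
  by apply: le_trans (cabs_leD b1 b2) _; rewrite /W; lra.
have W0 : 0 <= W by rewrite /W !mulr_ge0 ?addr_ge0 ?nrm_ge0.
(* On [E], where [Re L <= - delta] and [cabs L <= W], the square of [cabs (L + delta / 2 + P)] is at
   most [(P - delta / 2) ^+ 2 + W ^+ 2], and this [P] is large enough to bring it under
   [(1 - t) * P ^+ 2] with [t * P = delta / 2]. On the wall [Re L = 0], and the modulus is at least
   [(1 + t) * P]. *)
pose P := W + 2 * (W ^+ 2 + delta ^+ 2) / delta + delta.
have Pd : 2 * (W ^+ 2 + delta ^+ 2) <= P * delta.
  rewrite /P !mulrDl divfK ?gt_eqF//; have := mulr_ge0 W0 (ltW d0); nra.
have sq : 0 <= 2 * (W ^+ 2 + delta ^+ 2) / delta.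
  by rewrite divr_ge0 ?mulr_ge0 ?addr_ge0 ?sqr_ge0// ltW.
have PW : W <= P by rewrite /P; lra.
have Pdl : delta <= P by rewrite /P; lra.
have P0 : 0 < P by lra.
pose t := delta / (2 * P).
have P2 : 0 < 2 * P by rewrite mulr_gt0.
have t0 : 0 < t by rewrite divr_gt0.
have t1 : t <= 2^-1 by rewrite /t ler_pdivrMr//; lra.
have tP : t * P = delta / 2 by rewrite /t; field; rewrite gt_eqF.
pose iP : Cplx R := (P^-1)%:C%C.
pose A y := (L (y - o.1) + (delta / 2 + P)%:C%C) * iP.
exists (conjc o.2.1 * iP), (conjc o.2.2 * iP),
  (((delta / 2 + P)%:C%C - conjc o.2.1 * o.1.1 - conjc o.2.2 * o.1.2) * iP),
  (Num.sqrt (1 - t)), t.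
have AE y : conjc o.2.1 * iP * y.1 + conjc o.2.2 * iP * y.2 +
   ((delta / 2 + P)%:C%C - conjc o.2.1 * o.1.1 - conjc o.2.2 * o.1.2) * iP = A y.
  by rewrite /A /L /=; ring.
have absA y : cabs (A y) * P = cabs (L (y - o.1) + (delta / 2 + P)%:C%C).
  rewrite /A cabsM /iP cabs_real ger0_norm ?invr_ge0 ?(ltW P0)//.
  by rewrite divfK ?gt_eqF.
split=> //.
- by rewrite -[ltRHS]sqrtr1 ltr_sqrt//; lra.
- move=> y Ey; rewrite AE -(ler_pM2r P0) absA.
  have q0 : 0 <= Num.sqrt (1 - t) * P by rewrite mulr_ge0 ?sqrtr_ge0// ltW.
  have t11 : 0 <= 1 - t by lra.
  rewrite -ler_sqr ?nnegrE ?cabs_ge0// exprMn [X in _ <= X * _]sqr_sqrtr //.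
  rewrite cabs_sqr ReD ImD ReL /= addr0.
  have h1 := hd y Ey; have := hW y Ey => h2.
  have h3 := le_trans (Re_le_cabs (L (y - o.1))) h2; rewrite ReL ler_norml in h3.
  have h4 := le_trans (Im_le_cabs (L (y - o.1))) h2.
  have h5 : complex.Im (L (y - o.1)) ^+ 2 <= W ^+ 2.
    by rewrite -(@real_normK _ (complex.Im _)) ?num_real// lerXn2r ?nnegrE.
  have h6 : (dot o.2 (y - o.1) + (delta / 2 + P)) ^+ 2 <= (P - delta / 2) ^+ 2.
    have /andP[h3a _] := h3.
    by rewrite lerXn2r ?nnegrE//; lra.
  have e1 : (1 - t) * P ^+ 2 = P ^+ 2 - P * (t * P) by ring.
  rewrite e1 tP; nra.
- move=> y [h1 h2]; rewrite AE -(ler_pM2r P0) absA.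
  apply: le_trans (Re_le_cabs _); rewrite ReD ReL h1 add0r /=.
  rewrite ger0_norm; last lra.
  by rewrite mulrDl mul1r tP; lra.
Qed.

Lemma jpow_poly_jet (a b d : Cplx R) n : poly_jet (jpow a b d n).
Proof.
move=> K r hr.
pose m := Num.max 1 (cabs a + cabs b).
pose q := Num.max 1 ((cabs a + cabs b) * `|r| + cabs d).
exists (n.+3%:R ^+ 3 * q ^+ n.+3 * m ^+ 3).
have q1 : 1 <= q by rewrite le_max lexx.
apply: (@jpow_bound R a b d n K q).
- lra.
- by rewrite le_max lexx orbT.
- by rewrite le_max lexx.
- move=> x Kx; rewrite le_max; apply/orP; right.
  have hx : nrm x <= `|r| by apply: le_trans (hr _ Kx) (ler_norm _).
  apply: cabs_leD => //; rewrite mulrDl; apply: cabs_leD; apply: cabs_leM => //.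
    exact: le_trans (cabs1_le _) hx.
  exact: le_trans (cabs2_le _) hx.
- by move=> i i3; apply: ler_weXn2l => //; rewrite -addn3 leq_add2l.
Qed.

Lemma poly_jetD J J' : poly_jet J -> poly_jet J' -> poly_jet (jadd J J').
Proof.
move=> h h' K r hr; have [c hc] := h K r hr; have [c' hc'] := h' K r hr.
by exists (c + c'); exact: jboundD.
Qed.

Lemma wall_jet (d : R) o E (e W : R) : compact E -> (forall y, E y -> below o y) -> 0 < e ->
  exists P, [/\ poly_jet P, jbound P E e & forall y, wall d o y -> W <= cabs (j0 P y)].
Proof.
move=> cE hE e0.
have [a [b [c [q [eta [q0 q1 eta0 hA hw]]]]]] := @wall_separation d o E cE hE.
pose m := Num.max 1 (cabs a + cabs b).
have [n0 hn0] := @cube_pow_small R q (m ^+ 3) e ltac:(by rewrite q0) e0.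
have [n1 hn1] := @pow_large R (1 + eta) W ltac:(by lra).
pose n := maxn n0 n1.
exists (jpow a b c n); split; first exact: jpow_poly_jet.
  apply: (jbound_le (hn0 n (leq_maxl _ _))).
  apply: (jpow_bound (q := q)); rewrite ?le_max ?lexx ?orbT//.
  move=> i _; rewrite exprD; apply: ler_piMr; first exact: exprn_ge0.
  by apply: exprn_ile1 => //; exact: ltW.
move=> y /hw hy; rewrite /= cabsX.
have e1 : 0 <= 1 + eta by lra.
apply: (@le_trans _ _ ((1 + eta) ^+ n.+3)).
  by apply: hn1; apply: leq_trans (leq_maxr n0 n1) _; rewrite -addn3 leq_addr.
by rewrite lerXn2r ?nnegrE ?cabs_ge0.
Qed.

Lemma jzero_bound (K : set (Cplx2 R)) (e : R) : 0 <= e -> jbound (jaffine 0 0 0) K e.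
Proof.
move=> e0 i x y _ _; have -> : jtest i x y (jaffine (0 : Cplx R) 0 0) = 0.
  do 10 (case: i => [|i] /=; first by rewrite /jlin /= ?mul0r ?addr0 ?subr0 ?addr0).
  by rewrite /jlin /jquad /= !mul0r !addr0 !subr0.
by rewrite cabs0 mulr_ge0// jweight_ge0// nrm_ge0.
Qed.

Lemma jaffine_poly_jet (a b d : Cplx R) : poly_jet (jaffine a b d).
Proof. by move=> K r hr; exact: jaffine_bound hr. Qed.

(** Induction on the ordered list. The power for the head overcomes the bound [c] of [F] on its
    wall. The remaining obstacles are then treated with this wall added to [E], which the order
    permits, so that later terms cannot undo what was gained. *)
Lemma walls_jet (d : R) (obs : seq (Cplx2 R * Cplx2 R)) E F (e W : R) : compact E ->
  (forall o y, o \in obs -> E y -> below o y) -> ordered_walls d obs -> poly_jet F -> 0 < e ->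
  exists P, [/\ poly_jet P, jbound P E e &
    forall y, walls d obs y -> W <= cabs (j0 F y + j0 P y)].
Proof.
elim: obs E F e W => [|o s ih] E F e W cE hE hord hF e0.
  exists (jaffine 0 0 0); split; [exact: jaffine_poly_jet|exact: jzero_bound (ltW e0)|].
  by move=> y [].
have [c hc] := hF (wall d o) (d + nrm o.1) ltac:(
  by move=> y [_ hy]; have := nrmD (y - o.1) o.1; rewrite subrK; lra).
have e2 : 0 < e / 2 by rewrite divr_gt0.
have [P1 [p1 b1 w1]] := @wall_jet d o E (e / 2) (W + c + 1) cE
  (fun y Ey => hE o y (mem_head _ _) Ey) e2.
move: hord => /= [ho hs].
(* The bound 1 is the loss on the head wall provided for in [W + c + 1]. *)
have m0 : 0 < Num.min (e / 2) 1 by rewrite lt_min e2 ltr01.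
have [|||P2 [p2 b2 w2]] := ih (E `|` wall d o) (jadd F P1) (Num.min (e / 2) 1) W _ _ hs _ m0.
- by apply: compactU => //; exact: wall_compact.
- move=> o' y o's [Ey|wy]; first by apply: hE => //; rewrite in_cons o's orbT.
  exact: ho.
- exact: poly_jetD.
exists (jadd P1 P2); split; first exact: poly_jetD.
  rewrite [e]splitr; apply: jboundD => //.
  apply: (jbound_le _ (jbound_sub _ b2)); first by rewrite ge_min lexx.
  by move=> y Ey; left.
move=> y [v ho' wy]; move: ho'; rewrite in_cons => /orP[/eqP oE|vs]; last first.
  by have := w2 y (ex_intro2 _ _ v vs wy); rewrite /= addrA.
rewrite oE in wy; have := w1 y wy; have := hc 0%N y y wy wy.
have := b2 0%N y y (or_intror wy) (or_intror wy); rewrite /= !mulr1 => h2 h3 h1.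
have h2' : cabs (j0 P2 y) <= 1 by apply: le_trans h2 _; rewrite ge_min lexx orbT.
have := cabs_dist (j0 P1 y) (- (j0 F y + j0 P2 y)); rewrite cabsN opprK.
have -> : j0 P1 y + (j0 F y + j0 P2 y) = j0 F y + (j0 P1 y + j0 P2 y) by ring.
have := cabs_leD h3 h2'; lra.
Qed.

End WallFunctions.

(** * Exhaustion and construction *)

Section Exhaustion.
Variable R : realType.
Implicit Types (x y p q : Cplx2 R) (B : set (Cplx2 R)).
Local Notation dot := (@euclidean_metric R).

(** The ratio 4 leaves room between consecutive sets: a point within half a width of [inner B k]
    still has a ball of a quarter width inside [B]. *)
Definition shell_width k : R := 4^-1 ^+ k.

Lemma shell_width_gt0 k : 0 < shell_width k.
Proof. by rewrite exprn_gt0. Qed.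

Lemma shell_widthS k : shell_width k.+1 = shell_width k / 4.
Proof. by rewrite /shell_width exprSr. Qed.

Lemma shell_width_le1 k : shell_width k <= 1.
Proof. by apply: exprn_ile1; lra. Qed.

(** Stated by balls contained in [B] instead of the distance to the frontier, which makes sense also
    when [B] is the whole plane. *)
Definition inner B k : set (Cplx2 R) :=
  [set p | nrm p <= k%:R /\ forall q, nrm (q - p) < shell_width k -> B q].

Lemma inner_sub B k : inner B k `<=` B.
Proof. by move=> p [_]; apply; rewrite subrr nrm0 shell_width_gt0. Qed.

Lemma inner_leS B k : inner B k `<=` inner B k.+1.
Proof.
move=> p [h1 h2]; split; first by apply: le_trans h1 _; rewrite ler_nat.
move=> q; rewrite shell_widthS => h; apply: h2; apply: lt_le_trans h _.
by have := shell_width_gt0 k; lra.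
Qed.

Lemma inner_le B k l : (k <= l)%N -> inner B k `<=` inner B l.
Proof.
move=> /subnK <-; elim: (l - k)%N => [|n ih] // p /ih; rewrite addSn; exact: inner_leS.
Qed.

Lemma inner_compact B k : compact (inner B k).
Proof.
apply: (@closed_bounded_compact _ _ k%:R); last by move=> p [].
apply/Cplx2_closedP => p hp; split.
  apply/ler_addgt0Pr => e e0; have [q [hq _] qp] := hp e e0.
  by have := nrmD (p - q) q; rewrite subrK nrmBC; lra.
move=> q hq; have [|p' [_ hp'] pp] := hp (shell_width k - nrm (q - p)).
  by rewrite subr_gt0.
by apply: hp'; have := nrm_triangle p q p'; rewrite (nrmBC p p'); lra.
Qed.

(** A point [q] near the combination [z] of [x] and [y] is the same combination of [x] and [y] both
    translated by [q - z]. *)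
Lemma inner_rconvex B k : rconvex B -> rconvex (inner B k).
Proof.
move=> cB x y t [x1 x2] [y1 y2] /andP[t0 t1].
have e0 : x + rscale t (y - x) = rscale (1 - t) x + rscale t y.
  by case: x {x1 x2} => x1 x2; case: y {y1 y2} => y1 y2; congr pair; rewrite /= rmorphB rmorph1; ring.
split.
  rewrite e0; apply: le_trans (nrmD _ _) _; rewrite !nrmZ !ger0_norm ?subr_ge0//.
  have := ler_wpM2l t0 y1; have t1' : 0 <= 1 - t by rewrite subr_ge0.
  by have := ler_wpM2l t1' x1; lra.
move=> q hq; set z := x + rscale t (y - x).
have -> : q = (x + (q - z)) + rscale t ((y + (q - z)) - (x + (q - z))).
  have e1 w : y + w - (x + w) = y - x by rewrite opprD addrACA subrr addr0.
  by rewrite e1 addrAC -/z addrC subrK.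
apply: cB; last by rewrite t0.
  by apply: x2; rewrite addrAC subrr add0r.
by apply: y2; rewrite addrAC subrr add0r.
Qed.

Lemma inner_next B k c x : inner B k c -> nrm (x - c) <= shell_width k / 2 -> inner B k.+1 x.
Proof.
move=> [c1 c2] hx; have w0 := shell_width_gt0 k; have w1 := shell_width_le1 k; split.
  by have := nrmD (x - c) c; rewrite subrK -natr1; lra.
move=> q; rewrite shell_widthS => hq; apply: c2.
by have := nrm_triangle x q c; lra.
Qed.

Lemma inner_exhaust B p : open B -> B p ->
  exists k (s : R), 0 < s /\ forall q, nrm (q - p) < s -> inner B k q.
Proof.
move=> /Cplx2_openP oB /oB[e e0 he].
have [n hn] := @pow_small R 4^-1 (e / 2) ltac:(lra) ltac:(lra).
pose k := maxn n (Num.truncn (nrm p + e)).+1.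
exists k, (e / 2); split; first lra.
move=> q hq; split.
  have h : nrm p + e < k%:R.
    apply: lt_le_trans (truncnS_gt _) _; first by rewrite ler_nat leq_maxr.
  by have := nrmD (q - p) p; rewrite subrK; lra.
move=> q' hq'; apply: he; have := nrm_triangle q q' p.
have := hn k (leq_maxl _ _); rewrite -/(shell_width k); lra.
Qed.

Lemma convex_set_rconvex B : convex_set B -> rconvex B.
Proof.
move=> cB x y t Bx By /andP[t0 t1].
have c0 : 0 <= t%:C%C :> R[i] by rewrite lecR.
have c1 : t%:C%C <= 1 :> R[i] by rewrite lecR.
have := cB y x (Itv01 c0 c1) (mem_set By) (mem_set Bx); rewrite inE.
suff -> : x + rscale t (y - x) = t%:C%C *: y + (1 - t%:C%C) *: x by [].
by case: x {Bx} => x1 x2; case: y {By} => y1 y2; congr pair; rewrite /= /GRing.scale /=; ring.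
Qed.

(** The labyrinth is built between the levels [eta ^+ 2 / 2] and [eta ^+ 2] of a function close to
    the squared distance to [inner B k]: the lower sublevel set contains [inner B k], the upper one
    stays within [eta] of it, hence in [inner B k.+1]. *)
Lemma shell_walls B k : rconvex B -> inner B k !=set0 -> exists (d : R) obs,
  [/\ forall o y, o \in obs -> inner B k y -> below o y, ordered_walls d obs,
      walls d obs `<=` inner B k.+1 &
      forall p q L, inner B k p -> ~ inner B k.+1 q ->
        rect_curve (~` walls d obs) p q L -> 1 <= L].
Proof.
move=> cB C0.
have [v [g [hv v0 vd]]] := sqdist_convex C0 (@inner_compact B k) (@inner_rconvex B k cB).
pose eta := shell_width k / 2.
have eta0 : 0 < eta by rewrite divr_gt0// shell_width_gt0.
have k0 : 0 < 2 * k.+1%:R ^+ 2 :> R by rewrite mulr_gt0// exprn_gt0.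
(* Keeps [eps * dot x x] under [eta ^+ 2 / 2] on [inner B k]; the successor avoids a zero
   denominator at [k = 0]. *)
pose eps := eta ^+ 2 / (2 * k.+1%:R ^+ 2).
have eps0 : 0 < eps by rewrite divr_gt0// exprn_gt0.
(* The squared distance to [inner B k] is not strictly convex. *)
pose u x := v x + eps * dot x x.
have uconv : uniformly_convex u (fun x => g x + rscale (2 * eps) x) eps (1 + eps).
  move=> x y; have [h1 h2] := hv x y; rewrite /u dotDl dotZl.
  have e1 : eps * dot y y = eps * dot x x + 2 * eps * dot x (y - x) + eps * nrm (y - x) ^+ 2.
    by rewrite nrm_sqr !dotBr !dotBl (dotC y x); ring.
  by rewrite e1; split; lra.
have near x : u x <= eta ^+ 2 -> inner B k.+1 x.
  rewrite /u => h; have [c Cc vx] := vd x; apply: (inner_next Cc).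
  have : nrm (x - c) ^+ 2 <= eta ^+ 2.
    by rewrite -vx; have := mulr_ge0 (ltW eps0) (dot_ge0 x); lra.
  by rewrite ler_sqr ?nnegrE ?nrm_ge0// ltW.
have s01 : eta ^+ 2 / 2 < eta ^+ 2 by have := exprn_gt0 2 eta0; lra.
have eps1 : 0 < 1 + eps by lra.
have [d [obs [_ [ob1 ob2 ob3 ob4]]]] :=
  labyrinth eps0 eps1 uconv s01 (fun x hx => proj1 (near x hx)).
have low x : inner B k x -> u x <= eta ^+ 2 / 2.
  move=> Cx; rewrite /u v0// add0r -nrm_sqr.
  have -> : eta ^+ 2 / 2 = eps * k.+1%:R ^+ 2.
    have e1 (A K : R) : K != 0 -> A / 2 = A / (2 * K) * K by move=> h; field.
    by apply: e1; rewrite expf_neq0// pnatr_eq0.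
  rewrite ler_pM2l// ler_sqr ?nnegrE ?nrm_ge0//; case: Cx => h _.
  by apply: le_trans h _; rewrite ler_nat.
exists d, obs; split=> //.
- by move=> o y oo Cy; apply: ob1 => //; exact: low.
- by move=> y [w oo wy]; apply: near; exact: ob3 wy.
- move=> p q L Cp nCq; apply: ob4; first exact: low.
  by case: (leP (eta ^+ 2) (u q)) => // h; exfalso; apply: nCq; apply: near; exact: ltW.
Qed.

End Exhaustion.

(** * Summing the corrections for all labyrinths *)

Section WalledJet.
Variable R : realType.
Implicit Types (x y p q : Cplx2 R) (e : R).

Definition dyadic e k : R := e * 2^-1 ^+ k.+1.

Lemma dyadic_gt0 e k : 0 < e -> 0 < dyadic e k.
Proof. by move=> e0; rewrite mulr_gt0// exprn_gt0. Qed.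

Lemma dyadic_sum (c : nat -> R) e n j : 0 < e -> (forall k, (n <= k)%N -> c k <= dyadic e k) ->
  \sum_(k < n + j) c k <= \sum_(k < n) c k + e.
Proof.
move=> e0 hc; suff : \sum_(k < n + j) c k <= \sum_(k < n) c k + e * (1 - 2^-1 ^+ j).
  have : 0 < e * 2^-1 ^+ j by rewrite mulr_gt0// exprn_gt0.
  by rewrite mulrBr mulr1; lra.
elim: j => [|j ih]; first by rewrite addn0 expr0 subrr mulr0 addr0.
rewrite addnS big_ord_recr /=; have := hc (n + j)%N (leq_addr _ _).
have : dyadic e (n + j) <= e * 2^-1 ^+ j.+1.
  rewrite ler_pM2l//; apply: ler_wiXn2l; [lra|lra|].
  by rewrite ltnS leq_addl.
rewrite exprS; move: ih; rewrite !mulrBr mulr1; move: (_ ^+ j) => t; lra.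
Qed.

(** The [n]-th term is chosen after the partial sum [F n], so as to make [F n.+1] large on the
    [n]-th walls, and is small on [C n]. As these walls lie in [C n.+1], all later terms together
    change the value there by at most [e]. On a given [C n] the finitely many terms that are not
    small are still bounded, being polynomial. *)
Lemma walled_jet (C : nat -> set (Cplx2 R)) (F0 : jet R) e (d : nat -> R)
    (obs : nat -> seq (Cplx2 R * Cplx2 R)) (W : nat -> R) :
  (forall n, compact (C n)) -> (forall n, C n `<=` C n.+1) ->
  (forall n o y, o \in obs n -> C n y -> below o y) ->
  (forall n, ordered_walls (d n) (obs n)) -> (forall n, walls (d n) (obs n) `<=` C n.+1) ->
  poly_jet F0 -> 0 < e -> exists J, [/\ forall n, exists c, jbound J (C n) c,
    jbound J (C 0%N) e &
    forall n y, walls (d n) (obs n) y -> W n - e <= cabs (j0 F0 y + j0 J y)].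
Proof.
move=> cC mC hob hord hw pF0 e0.
(* The choice is made once for all pairs, before the recursion; [F0] is a placeholder where the jet
   is not polynomial. *)
have /choice[pick hpick] : forall nF : nat * jet R, exists P, poly_jet nF.2 ->
    [/\ poly_jet P, jbound P (C nF.1) (dyadic e nF.1) &
     forall y, walls (d nF.1) (obs nF.1) y -> W nF.1 <= cabs (j0 nF.2 y + j0 P y)].
  move=> [n F] /=; have [pF|nF] := pselect (poly_jet F); last by exists F0.
  by have [P hP] := walls_jet (W n) (cC n) (hob n) (hord n) pF (dyadic_gt0 n e0); exists P.
pose F := fix F n := if n is m.+1 then jadd (F m) (pick (m, F m)) else F0.
pose P n := pick (n, F n).
have pF n : poly_jet (F n).
  by elim: n => [|n ih] //=; apply: poly_jetD => //; have [] := hpick (n, F n) ih.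
have hP n := hpick (n, F n) (pF n); rewrite -/(P _) /= in hP.
have F0E n y : j0 (F n) y = j0 F0 y + \sum_(k < n) j0 (P k) y.
  by elim: n => [|n ih]; rewrite ?big_ord0 ?addr0// big_ord_recr /= ih addrA.
have mono n k : (n <= k)%N -> C n `<=` C k.
  by move=> /subnK <-; elim: (k - n)%N => [|m ih] // y /ih; rewrite addSn; exact: mC.
have small n k : (n <= k)%N -> jbound (P k) (C n) (dyadic e k).
  by move=> nk; have [_ b _] := hP k; exact: jbound_sub (mono _ _ nk) b.
have bound n : exists2 c, jbound (jseries P) (C n) c & (n = 0%N -> c = e) /\
    forall y, C n y -> has_sum (fun k => j0 (P k) y) (j0 (jseries P) y).
  have [r hr] := compact_bounded (cC n).
  have /choice[c hc] : forall k, exists c, [/\ 0 <= c, jbound (P k) (C n) c &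
      (n <= k)%N -> c = dyadic e k].
    move=> k; case: (leqP n k) => nk.
      by exists (dyadic e k); split=> //; [exact/ltW/dyadic_gt0|exact: small].
    have [pP _ _] := hP k; have [c hc] := pP _ _ hr.
    by exists `|c|; split=> //; exact: jbound_le (ler_norm c) hc.
  have ub m : \sum_(k < m) c k <= \sum_(k < n) c k + e.
    apply: (@le_trans _ _ (\sum_(k < n + m) c k)).
      rewrite addnC big_split_ord /= lerDl sumr_ge0// => i _.
      by have [] := hc (m + i)%N.
    by apply: dyadic_sum => // k nk; have [_ _ ->] := hc k.
  have [b1 b2] := jseries_bound (fun k => let: And3 _ h _ := hc k in h) ub.
  by exists (\sum_(k < n) c k + e) => //; split=> // ->; rewrite big_ord0 add0r.
exists (jseries P); split.
- by move=> n; have [c hc _] := bound n; exists c.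
- by have [c hc [/(_ erefl) <- _]] := bound 0%N.
- move=> n y wy; have Cy := hw n y wy; have [_ _ [_ hs]] := bound n.+1.
  have h1 : W n <= cabs (j0 F0 y + \sum_(k < n.+1) j0 (P k) y).
    by rewrite big_ord_recr /= addrA -F0E; have [_ _] := hP n; exact.
  have h2 : cabs (j0 (jseries P) y - \sum_(k < n.+1) j0 (P k) y) <= e.
    apply: (has_sum_le (n := n.+1) (hs y Cy)) => m /subnK <-.
    rewrite addnC big_split_ord /= addrAC subrr add0r.
    apply: (@le_trans _ _ (\sum_(i < m - n.+1) dyadic e (n.+1 + i))).
      elim/big_ind2: _ => [|a b a' b' h h'|i _]; first by rewrite cabs0.
        exact: cabs_leD.
      have := small n.+1 (n.+1 + i)%N (leq_addr _ _) 0%N y y Cy Cy.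
      by rewrite /= mulr1.
    have := @dyadic_sum (fun k => dyadic e k) e n.+1 (m - n.+1) e0 (fun k _ => lexx _).
    by rewrite big_split_ord /= lerD2l.
  have := cabs_dist (j0 F0 y + \sum_(k < n.+1) j0 (P k) y)
    (\sum_(k < n.+1) j0 (P k) y - j0 (jseries P) y).
  by rewrite opprB addrACA subrr addr0 cabsBC; lra.
Qed.

End WalledJet.

(** * A zero near the base point *)

Section VerticalZero.
Variable R : realType.
Implicit Types (x y p q : Cplx2 R).

Lemma rect_curve_sub (A A' : set (Cplx2 R)) p q L : A `<=` A' ->
  rect_curve A p q L -> rect_curve A' p q L.
Proof.
move=> AA' [n [s [l [h1 [h2 h3]]]]]; exists n, s, l; do 2 split=> //.
by move=> t tn; apply: AA'; exact: h3.
Qed.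

(** On the vertical line through [p] the function is [w - p.2] plus terms with Lipschitz constant at
    most [e + e1 <= 1 / 2] and value at most [2 * e] at [p], so [newton_zero] applies with slope 1.
    The unreduced first summand is the value of [jaffine 0 1 (- p.2)]. *)
Lemma vertical_zero (J : jet R) p (K : set (Cplx2 R)) (a b d : Cplx R) (r e e1 : R) :
  0 < r -> e <= 4^-1 -> e <= r / 4 -> e1 <= e -> e1 * (cabs p.1 + cabs p.2 + 1) <= e ->
  cabs a <= e1 -> cabs b <= e1 -> cabs d <= e1 ->
  (forall w, cabs (w - p.2) <= r -> K (p.1, w)) -> jbound J K e ->
  exists2 w, cabs (w - p.2) <= r &
    (0 * p.1 + 1 * w - p.2) + j0 J (p.1, w) + (a * p.1 + b * w + d) = 0.
Proof.
move=> r0 e4 er e1e e1p ha hb hd hK hJ.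
pose G (w : Cplx R) : Cplx R := (0 * p.1 + 1 * w - p.2) + j0 J (p.1, w) + (a * p.1 + b * w + d).
have Kp : K (p.1, p.2) by apply: hK; rewrite subrr cabs0 ltW.
have G0 : cabs (G p.2) <= r / 2.
  rewrite /G mul0r add0r mul1r subrr add0r.
  have h1 := hJ 0%N _ _ Kp Kp; rewrite /= mulr1 in h1.
  have h2 : cabs (a * p.1 + b * p.2 + d) <= e1 * cabs p.1 + e1 * cabs p.2 + e1.
    by apply: cabs_leD => //; apply: cabs_leD; apply: cabs_leM.
  by apply: le_trans (cabs_leD h1 h2) _; lra.
have G1 w w' : cabs (w - p.2) <= r -> cabs (w' - p.2) <= r ->
    cabs (G w - G w' - 1 * (w - w')) <= cabs 1 / 2 * cabs (w - w').
  move=> hw hw'.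
  have -> : G w - G w' - 1 * (w - w') = (j0 J (p.1, w) - j0 J (p.1, w')) + b * (w - w').
    by rewrite /G; ring.
  have h1 := hJ 6%N _ _ (hK _ hw') (hK _ hw); rewrite /= in h1.
  have h2 : nrm ((p.1, w) - (p.1, w') : Cplx2 R) <= cabs (w - w').
    by apply: le_trans (nrm_le _) _; rewrite /= subrr cabs0 add0r.
  have e0 : 0 <= e by apply: le_trans e1e; apply: le_trans ha; exact: cabs_ge0.
  have h3 : cabs (j0 J (p.1, w) - j0 J (p.1, w')) <= e * cabs (w - w').
    by apply: le_trans h1 _; rewrite ler_wpM2l.
  apply: le_trans (cabs_leD h3 (cabs_leM hb (lexx _))) _.
  rewrite cabs1 -mulrDl ler_wpM2r ?cabs_ge0//; lra.
have [|w hw Gw] := @newton_zero R G 1 p.2 r (oner_neq0 _) G1.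
  by rewrite cabs1 mul1r.
exists w => //; apply: le_trans hw _; rewrite cabs1 divr1; lra.
Qed.

End VerticalZero.

(** * Assembly of the labyrinths, the series and the perturbation *)

Theorem theorem1p1 (R : realType) (B : set (Cplx2 R)) (hB : convex_domain B) :
  exists (M : riemann_surface R) (Y : M -> Cplx2 R),
    [/\ open_riemann_surface M,
        complete_immersion Y,
        holomorphic_embedding Y,
        range Y `<=` B &
        proper_into Y B].
Proof.
have [oB _ [p0 Bp0] /convex_set_rconvex cB] := hB.
have [k0 [s [s0 hs]]] := inner_exhaust oB Bp0.
pose C n := inner B (k0 + n).
have /choice[w hw] : forall n, exists w : R * seq (Cplx2 R * Cplx2 R),
    [/\ forall o y, o \in w.2 -> C n y -> below o y, ordered_walls w.1 w.2,
      walls w.1 w.2 `<=` C n.+1 &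
      forall p q L, C n p -> ~ C n.+1 q -> rect_curve (~` walls w.1 w.2) p q L -> 1 <= L].
  move=> n; have [|d [obs h]] := @shell_walls R B (k0 + n) cB.
    by exists p0; apply: (@inner_le _ _ k0); rewrite ?leq_addr//; apply: hs; rewrite subrr nrm0.
  by exists (d, obs); rewrite /C addnS.
(* The closed vertical disc of radius [s / 2] about [p0] lies in [C 0]; the two bounds on [e] are
   those asked for by [vertical_zero]. *)
pose r := s / 2; pose e := Num.min 4^-1 (r / 4).
have r0 : 0 < r by rewrite /r; lra.
have e0 : 0 < e by rewrite lt_min; apply/andP; split; lra.
have e4 : e <= 4^-1 by rewrite ge_min lexx.
have er : e <= r / 4 by rewrite ge_min lexx orbT.
pose F0 := jaffine 0 1 (- p0.2).
have mC n : C n `<=` C n.+1 by rewrite /C addnS; exact: inner_leS.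
(* On the [n]-th walls the norm is at most [K = k0 + n + 1], so a perturbation with coefficients at
   most 1/4 is at most [K / 2 + 1 / 4]. The prescribed size [2 + 2 * K], diminished by [e <= 1 / 4],
   exceeds it, and the final function does not vanish on the walls. *)
have [J [bJ bJ0 wJ]] := @walled_jet R C F0 e (fun n => (w n).1) (fun n => (w n).2)
  (fun n => 2 + 2 * (k0 + n).+1%:R) (fun n => @inner_compact R B _) mC
  (fun n => let: And4 h _ _ _ := hw n in h) (fun n => let: And4 _ h _ _ := hw n in h)
  (fun n => let: And4 _ _ h _ := hw n in h) (@jaffine_poly_jet R 0 1 (- p0.2)) e0.
pose N := cabs p0.1 + cabs p0.2 + 1.
have N1 : 1 <= N by rewrite /N lerDr addr_ge0 ?cabs_ge0.
(* Division by [N] keeps the perturbation at [p0] within [e], so that it does not destroy the zero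
   near [p0]. *)
pose e1 := e / N.
have e10 : 0 < e1 by rewrite divr_gt0//; lra.
have e1N : e1 * N = e by rewrite divfK// gt_eqF//; lra.
have e1e : e1 <= e by rewrite -e1N ler_peMr// ltW.
have bC n : exists r, forall p, C n p -> nrm p <= r by exists (k0 + n)%:R => p [].
have bJC n : exists c, jbound (jadd F0 J) (C n) c.
  have [c hc] := bJ n; have [r' hr'] := bC n; have [c' hc'] := jaffine_bound 0 1 (- p0.2) hr'.
  by exists (c' + c); exact: jboundD.
have [a [b [d [ha hb hd reg0]]]] := generic_affine_perturbation e10 bC bJC.
pose Jh := jadd (jadd F0 J) (jaffine a b d).
have exh p : B p -> exists n (t : R), 0 < t /\ forall q, nrm (q - p) < t -> C n q.
  move=> Bp; have [n [t [t0 ht]]] := inner_exhaust oB Bp; exists n, t; split=> // q /ht.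
  by apply: inner_le; exact: leq_addl.
have CB n : C n `<=` B := @inner_sub R B _.
have inC p : B p -> exists n, C n p.
  by move=> /exh[n [t [t0 ht]]]; exists n; apply: ht; rewrite subrr nrm0.
have hJ : locally_jbounded B Jh.
  move=> p /exh[n [t [t0 ht]]]; have [c hc] := bJC n; have [r' hr'] := bC n.
  have [c' hc'] := jaffine_bound a b d hr'.
  exists t, (c + c'); split=> //; first by move=> q /ht; exact: CB.
  by apply: (jbound_sub ht); exact: jboundD.
have reg : regular_zeros B Jh by move=> p /inC[n Cp]; exact: reg0 Cp.
have off n y : walls (w n).1 (w n).2 y -> j0 Jh y != 0.
  move=> wy; have [_ _ /(_ y wy) [ny _] _] := hw n; rewrite addnS in ny.
  have := wJ n y wy; rewrite -cabs_gt0 /= => h1.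
  have h2 : cabs (a * y.1 + b * y.2 + d) <= 4^-1 * (k0 + n).+1%:R + 4^-1 * (k0 + n).+1%:R + 4^-1.
    apply: cabs_leD; last lra.
    apply: cabs_leD; apply: cabs_leM; try lra.
      exact: le_trans (cabs1_le _) ny.
    exact: le_trans (cabs2_le _) ny.
  have := cabs_dist (0 * y.1 + 1 * y.2 - p0.2 + j0 J y) (- (a * y.1 + b * y.2 + d)).
  rewrite opprK cabsN; have : 0 <= (k0 + n).+1%:R :> R by []. lra.
have hK z : cabs (z - p0.2) <= r -> C 0%N (p0.1, z).
  move=> hz; rewrite /C addn0; apply: hs; apply: le_lt_trans (nrm_le _) _.
  by rewrite /= subrr cabs0 add0r; apply: le_lt_trans hz _; rewrite /r; lra.
have [v hv zv] := @vertical_zero R J p0 (C 0%N) a b d r e e1 r0 e4 er e1e ltac:(by rewrite -/N e1N)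
  ha hb hd hK bJ0.
have zp : zset B Jh (p0.1, v) by split; [exact: CB (hK _ hv)|exact: zv].
exists (zsurface hJ reg zp), (zincl (hJ := hJ) (reg := reg) (zp0 := zp)); split.
- exact: zsurface_open.
- apply: zincl_complete => p [Bp Jp]; have [n Cp] := inC p Bp.
  exists (C n.+1); split; [exact: CB|exact: inner_compact|].
  move=> q L hq L1; have [//|nC] := pselect (C n.+1 q); exfalso.
  have [_ _ _ /(_ p q L Cp nC)] := hw n; rewrite leNgt L1 => /(_ _)/negP; apply=> //.
  by apply: rect_curve_sub hq => y [_ Jy] /off; rewrite Jy eqxx.
- exact: zincl_embedding.
- exact: zincl_range.
- exact: zincl_proper.
Qed.
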